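(* Let $\zeta_Z(t),t\in\mathcal T$ be a max-stable process with unit Gumbel marginals associated to the spectral process $Z$, and suppose that $\mathbb P\{Z(h)>-\infty\}=1$ for every $h\in\mathcal T$. Then the following are equivalent: a) $\zeta_Z$ is stationary, i.e. $\zeta_Z\overset{fdd}{=}\zeta_{L^hZ}$ for any $h\in\mathcal T$. b) For any positive $\sigma$-finite measure $\mu$ on $\mathcal T$ such that $\mathcal S_Z=\int_{\mathcal T}e^{Z(t)}\mu(dt)$ is a positive finite random variable, $$\zeta_Z(t)\overset{fdd}{=}\max_{i\ge1}\Bigl(P_i+L^{T_i}\Xi_0Z_i(t)-\ln\int_{\mathcal T}e^{L^{T_i}\Xi_0Z_i(s)}\,\mu(ds)\Bigr),\qquad t\in\mathcal T,$$ where $\sum_i\varepsilon_{(P_i,T_i)}$ is a Poisson point process on $\mathbb R\times\mathcal T$ with intensity $e^{-p}dp\cdot\mu(dt)$, independent of $(\Xi_0Z_i)_{i\ge1}$, which are independent copies of $\Xi_0Z$. c) For any functional $\Gamma:\mathcal F_{-\infty}\to[0,\infty)$ which is $\mathcal B(\mathcal F_{-\infty})/\mathcal B(\mathbb R)$ measurable and satisfies $\Gamma(f+c)=\Gamma(f)$ for all $c\in\mathbb R$ and all $f$, we have $$\mathbb E\{e^{Z(a+h)}\Gamma(Z)\}=\mathbb E\{e^{Z(a)}\Gamma(L^hZ)\}\qquad\text{for all }a,h\in\mathcal T,$$ provided that the expectations exist. d) For any $a,a+h\in\mathcal T$, $$\Xi_{a+h}Z\overset{fdd}{=}L^h\Xi_aZ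 .$$
   Context: $\mathcal T=\mathbb R^d$ or $\mathcal T=\mathbb Z^d$, $d\ge1$; $0$ denotes the origin of $\mathcal T$. Processes take values in $[-\infty,\infty)$ with $e^{-\infty}=0$; $\overset{fdd}{=}$ means equality of all finite dimensional distributions. $\mathbb E\{e^{Z(t)}\}=1$ for all $t\in\mathcal T$. Associated max-stable process: $\zeta_Z(t)=\max_{i\ge1}(P_i+Z_i(t))$, where $\sum_i\varepsilon_{P_i}$ is a Poisson point process on $\mathbb R$ with intensity $e^{-x}dx$ and $Z_i$ are independent copies of $Z$, independent of the point process. $L$ is the shift operator: $L^hf(t)=f(t-h)$. $\mathcal F_{-\infty}$ is the set of functions $\mathcal T\to[-\infty,\infty)$ excluding the function identically $-\infty$, with $\sigma$-field $\mathcal B(\mathcal F_{-\infty})$ generated by the evaluation maps. The tilt $Z^{[a]}$ of $Z$ by $Z(a)$ has law $\mathbb P\{Z^{[a]}\in A\}=\mathbb E\{e^{Z(a)}\mathbb I\{Z\in A\}\}$, $A\in\mathcal B(\mathcal F_{-\infty})$; $\Xi_aZ(t)=Z^{[a]}(t)-Z^{[a]}(a)$; and $L^b\Xi_aZ:=L^b(\Xi_aZ)$, i.e. $L^b\Xi_aZ(t)=Z^{[a]}(t-b)-Z^{[a]}(a)$. *)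

(* Defs.v *)
From HB Require Import structures.
From mathcomp Require Import all_boot all_order all_algebra.
From mathcomp Require Import all_classical all_reals all_analysis.
From mathcomp Require Import measurable_realfun.

Set Implicit Arguments.
Unset Strict Implicit.
Unset Printing Implicit Defensive.

Import Order.TTheory GRing.Theory Num.Theory.
Import numFieldNormedType.Exports.

Local Open Scope classical_set_scope.
Local Open Scope ring_scope.
Local Open Scope ereal_scope.

Variant time_kind := Euclidean | Lattice.

Definition time_coord (R : realType) (k : time_kind) : zmodType :=
  match k with Euclidean => R | Lattice => int end.

Definition time_open (R : realType) (k : time_kind) (d : nat) :
    set (set 'rV[time_coord R k]_d) :=
  match k with
  | Euclidean => @open 'rV[R]_d
  | Lattice => setT
  end.

(* R^d with its Borel sigma-algebra, or Z^d with the discrete one *)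
Definition time (R : realType) (k : time_kind) (d : nat) : Type :=
  'rV[time_coord R k]_d.
HB.instance Definition _ R k d :=
  GRing.Zmodule.copy (time R k d) 'rV[time_coord R k]_d.
HB.instance Definition _ R k d :=
  Measurable.copy (time R k d) (g_sigma_algebraType (@time_open R k d)).

(* the shift operator L^h, on functions and, pointwise, on processes *)
Definition Lshift (T : zmodType) (U : Type) (h : T) (f : T -> U) : T -> U :=
  fun t => f (t - h)%R.

Section processes.
Context {R : realType} {d : measure_display} {Omega : measurableType d}.

(* a family of random variables with values in [-oo, +oo) *)
Definition process (I : Type) (Z : I -> Omega -> \bar R) : Prop :=
  (forall t, measurable_fun [set: Omega] (Z t)) /\
  (forall t w, Z t w != +oo).

(* the joint law, under mu, of the values of Z at the times in s *)
Definition fdd (I : Type) (mu : set Omega -> \bar R)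
    (Z : I -> Omega -> \bar R) (n : nat) (s : n.-tuple I) :
    set (n.-tuple (\bar R)) -> \bar R :=
  fun B => mu [set w | B [tuple Z (tnth s j) w | j < n]].

(* Under tilt mu Z a, the process Z is a version of the tilt of Z by Z a:
   tilt mu Z a [set w | A (Z ^~ w)] is the mu-expectation of
   e^(Z a) 1{Z \in A}. *)
Definition tilt (I : Type) (mu : {measure set Omega -> \bar R})
    (Z : I -> Omega -> \bar R) (a : I) : set Omega -> \bar R :=
  fun E => \int[mu]_(w in E) expeR (Z a w).

(* Xi_a Z is the process Xi a Z considered under the law tilt mu Z a *)
Definition Xi (I : Type) (a : I) (Z : I -> Omega -> \bar R) :
    I -> Omega -> \bar R :=
  fun t w => Z t w - Z a w.

(* The expectation of f exists, possibly as an infinite number. *)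
Definition has_expectation (mu : {measure set Omega -> \bar R})
    (f : Omega -> \bar R) : Prop :=
  measurable_fun [set: Omega] f /\
  (\int[mu]_w f^\+ w < +oo \/ \int[mu]_w f^\- w < +oo).

(* Joint measurability of (t, w) |-> Z t w on D * Omega *)
Definition measurable_paths d' (I : measurableType d') (D : set I)
    (Z : I -> Omega -> \bar R) : Prop :=
  measurable_fun (D `*` [set: Omega]) (fun x : I * Omega => Z x.1 x.2).

Definition mutually_independent (mu : set Omega -> \bar R) (J : eqType)
    (G : J -> set (set Omega)) : Prop :=
  (forall j, sigma_algebra setT (G j)) /\
  (forall j, G j `<=` measurable) /\
  (forall (s : seq J) (E : J -> set Omega), uniq s ->
    (forall j, j \in s -> G j (E j)) ->
    mu (\bigcap_(j in [set` s]) E j) = \prod_(j <- s) mu (E j)).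

(* the mass that the sum of the Dirac measures at the points X i w gives to A *)
Definition point_count d' (E : measurableType d') (X : nat -> Omega -> E)
    (A : set E) (w : Omega) : \bar R := \sum_(i <oo) \d_(X i w) A.

(* poisson_pmf is not used: its value at rate 0 is 1 for every n. *)
Definition poisson_process d' (E : measurableType d')
    (mu : set Omega -> \bar R) (X : nat -> Omega -> E)
    (lambda : set E -> \bar R) : Prop :=
  [/\ forall i, measurable_fun [set: Omega] (X i),
      forall A n, measurable A -> lambda A < +oo ->
        mu [set w | point_count X A w = n%:R%:E] =
        (fine (lambda A) ^+ n / n`!%:R * expR (- fine (lambda A)))%R%:E
    & forall n (A : 'I_n -> set E) (x : 'I_n -> \bar R),
        (forall j, measurable (A j)) -> trivIset setT A ->
        mu [set w | forall j, point_count X (A j) w = x j] =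
        \prod_(j < n) mu [set w | point_count X (A j) w = x j]].

(* The sequence (X i)_i, and the processes Z 0, Z 1, etc., are independent:
   they are measurable with respect to the independent sigma-algebras G None,
   and G (Some 0), G (Some 1), etc. *)
Definition independent_marks d' (E : measurableType d') (I : Type)
    (mu : set Omega -> \bar R) (G : option nat -> set (set Omega))
    (X : nat -> Omega -> E) (Z : nat -> I -> Omega -> \bar R) : Prop :=
  [/\ mutually_independent mu G,
      forall i, measurable_fun [set: g_sigma_algebraType (G None)] (X i)
    & forall i t,
        measurable_fun [set: g_sigma_algebraType (G (Some i))] (Z i t)].

End processes.

(* The measurability in (s, u, w) of the shifted paths s |-> X (s - u) w, needed
   for X (t - tau) and \int[mu]_s expeR (X (s - tau)) to be random variables
   when tau is a random time with values in D, and mu is carried by D *)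
Definition measurable_shifts {R : realType} {d : measure_display}
    {Omega : measurableType d} k n (D : set (time R k n))
    (F : set (set Omega)) (X : time R k n -> Omega -> \bar R) : Prop :=
  let Omega' : measurableType _ := g_sigma_algebraType F in
  (forall t : time R k n,
    measurable_paths (Omega := Omega') D (fun u => X (t - u)%R)) /\
  measurable_paths (Omega := Omega') (D `*` D) (fun x => X (x.1 - x.2)%R).

Definition fdd_eq {R : realType} {d1 d2 : measure_display}
    {Omega1 : measurableType d1} {Omega2 : measurableType d2} (I : Type)
    (mu1 : set Omega1 -> \bar R) (Z1 : I -> Omega1 -> \bar R)
    (mu2 : set Omega2 -> \bar R) (Z2 : I -> Omega2 -> \bar R) : Prop :=
  forall n (s : n.-tuple I) (B : set (n.-tuple (\bar R))), measurable B ->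
    fdd mu1 Z1 s B = fdd mu2 Z2 s B.

(* zeta, defined on (Omega, mu), is the max-stable process associated to the
   process Z0 defined on (Omega0, mu0). *)
Definition max_stable {R : realType} {d d0 : measure_display}
    {Omega : measurableType d} {Omega0 : measurableType d0} (I : Type)
    (mu : set Omega -> \bar R) (zeta : I -> Omega -> \bar R)
    (mu0 : set Omega0 -> \bar R) (Z0 : I -> Omega0 -> \bar R) : Prop :=
  exists (p : nat -> Omega -> R) (Z : nat -> I -> Omega -> \bar R)
    (G : option nat -> set (set Omega)),
  [/\ poisson_process mu p
        (fun A => \int[lebesgue_measure]_(x in A) (expR (- x))%:E),
      independent_marks mu G p Z,
      forall i, process (Z i) /\ fdd_eq mu (Z i) mu0 Z0
    & forall t w, zeta t w = ereal_sup (range (fun i => (p i w)%:E + Z i t w))].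

(* the paths with values in [-oo, +oo) that are not identically -oo *)
Definition Fminf (R : realType) (I : Type) : set (I -> \bar R) :=
  [set f | (forall t, f t != +oo) /\ exists t, f t != -oo].
Arguments Fminf : clear implicits.

(* The sigma-algebra on Fminf generated by the evaluation maps; Fminf itself
   need not belong to the product sigma-algebra on I -> \bar R, so
   measurable_fun (Fminf R I) would be vacuous. *)
Definition Fminf_measurable (R : realType) (I : Type) :
    set (set (I -> \bar R)) :=
  <<s Fminf R I, \bigcup_t preimage_set_system (Fminf R I)
                    (fun f : I -> \bar R => f t) measurable>>.

(* Main.v *)
Require Import Defs.
From HB Require Import structures.
From mathcomp Require Import all_boot all_order all_algebra.
From mathcomp Require Import finmap.
From mathcomp Require Import all_classical all_reals all_analysis.
From mathcomp Require Import measurable_realfun.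
From mathcomp Require Import lra ring zify.

Set SsrOldRewriteGoalsOrder.
Set Implicit Arguments.
Unset Strict Implicit.
Unset Printing Implicit Defensive.

Import Order.TTheory GRing.Theory Num.Theory.
Import numFieldNormedType.Exports.

Local Open Scope classical_set_scope.
Local Open Scope ring_scope.
Local Open Scope ereal_scope.

(** Write score x u for the maximum over j of exp (u_j - x_j), where u lists the
    values of a process at finitely many times and x lists bounds. The proof rests
    on the stationarity of expected scores: for Z and its shifts, the expectations
    of the scores coincide at all tuples of times. All four assertions are
    equivalent to this property.

    Laws of max-stable processes. The inequalities zeta (t_j) <= x_j hold for all j
    if and only if no point P_i of the Poisson process has a mark Z_i whose score
    exceeds exp (- P_i). As the marks are independent of the points, the probability
    of this event is the expectation of an infinite product over the points, which
    the exponential formula for Poisson processes evaluates; integrating the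
    intensity exp (- p) dp gives exp (- E score x (Z (t_j))). This is
    [marked_poisson_avoidance] and [max_stable_orthant]. Orthants determine
    finite-dimensional laws, so two max-stable processes have the same law exactly
    when their expected scores agree ([max_stable_fdd_eq]), and a) is the
    stationarity of expected scores.

    Scores and tilts. The score is the sum over i of exp (- x_i) exp (u_i) r, where
    r, the ratio of the maximum to the sum of the exp (u_j - x_j), only depends on
    the differences u_j - u_i. Since exp (Z (t_i)) is the density of the tilt at
    t_i, assertion d) implies the stationarity of scores ([tilt_score_stationary]).
    Conversely the slope at c = 1 of the expectation of max (c exp (Z (a)), M), with
    M a score, is the tilted probability that M <= exp (Z (a)); such events are the
    orthants of the process Z - Z (a), so scores determine the tilts
    ([score_tilt_stationary]).

    Functionals. A functional Gamma that is invariant under the addition of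
    constants is a function of the path Z - Z (a), and finite-dimensional laws
    determine laws on the space of paths, so d) and c) are equivalent
    ([tilt_functional_stationary], [functional_tilt_stationary]).

    From d) to b). Given T_i = t, the mark shifted by t has the law of Z - Z (t)
    under the tilt at t, by d). The exponential formula then applies as above, and
    the exponent becomes the integral over mu (dt) of the expectations of
    exp (Z (t)) score x (Z (t_j) - ln S), where S is the integral of exp (Z); by
    Fubini's theorem this is the expectation of S score x (Z (t_j) - ln S), that is
    of score x (Z (t_j)) ([tilted_representation]). The one delicate point is that
    equality of finite-dimensional laws carries over to the joint law with the
    integral of the exponential of the path, which need not be a function of
    countably many values of the path; but the moments of its truncations are
    iterated integrals of finite-dimensional expectations, and moments determine
    bounded variables ([joint_law_path_integral]).

    From b) to a). For the Dirac measure at a time h, the process in b) is the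
    max-stable process associated to the tilt of Z at 0, centred and shifted by h.
    Its expected scores are those of the shift of Z, because the density exp (Z (0))
    compensates the centring ([represents_dirac_score]). To apply b) one needs a
    probability space that carries a Poisson process and independent copies of the
    tilted process; it is obtained as a countable product of probability spaces
    ([product_law]). *)

(** * Image measures and densities *)

Lemma measurable_forall_ord d (T : measurableType d) n (A : 'I_n -> set T) :
  (forall j, measurable (A j)) -> measurable [set w | forall j, A j w].
Proof.
move=> mA; rewrite (_ : [set w | _] = \bigcap_(j in [set: 'I_n]) A j).
  exact: fin_bigcap_measurable.
by apply/seteqP; split => w /= wA j => [_|]; exact: wA.
Qed.

Lemma measurable_id_sub d (T : measurableType d) (F : set (set T)) :
  F `<=` measurable -> measurable_fun [set: T] (id : T -> g_sigma_algebraType F).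
Proof.
move=> Fm _ B mB; rewrite setTI; apply: (smallest_sub _ Fm mB).
exact: sigma_algebra_measurable.
Qed.

Lemma measurable_fun_of_sub d d' (T : measurableType d) (U : measurableType d')
    (F : set (set T)) (f : T -> U) : F `<=` measurable ->
  measurable_fun [set: g_sigma_algebraType F] f -> measurable_fun [set: T] f.
Proof. by move=> /measurable_id_sub mid mf; exact: (measurableT_comp mf mid). Qed.

Section image_measure.
Context d1 d2 (T1 : measurableType d1) (T2 : measurableType d2) (R : realType).
Variables (mu : {measure set T1 -> \bar R}) (f : T1 -> T2).
Hypothesis mf : measurable_fun [set: T1] f.

Definition image_measure of measurable_fun [set: T1] f := pushforward mu f.
Local Notation im := (image_measure mf).

Let im0 : im set0 = 0. Proof. exact: measure0. Qed.
Let im_ge0 A : 0 <= im A. Proof. exact: measure_ge0. Qed.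
Let im_sigma_additive : semi_sigma_additive im.
Proof. exact: measure_semi_sigma_additive. Qed.

HB.instance Definition _ := isMeasure.Build _ _ _ im
  im0 im_ge0 im_sigma_additive.

Lemma integral_image (g : T2 -> \bar R) :
  measurable_fun setT g -> (forall y, 0 <= g y) ->
  \int[im]_y g y = \int[mu]_x g (f x).
Proof. by move=> mg g0; exact: ge0_integral_pushforward. Qed.

End image_measure.

Section image_probability.
Context d1 d2 (T1 : measurableType d1) (T2 : measurableType d2) (R : realType).
Variables (mu : probability T1 R) (f : T1 -> T2).
Hypothesis mf : measurable_fun [set: T1] f.

Let imT : image_measure mu mf setT = 1.
Proof. by rewrite /image_measure /pushforward preimage_setT; exact: probability_setT. Qed.

HB.instance Definition _ :=
  Measure_isProbability.Build _ _ _ (image_measure mu mf) imT.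

End image_probability.

Section density.
Context d (T : measurableType d) (R : realType).
Variable mu : {measure set T -> \bar R}.
Import HBNNSimple.

(** Induction on nonnegative measurable functions, from indicator functions through
    sums and increasing limits *)
Lemma ge0_measurable_ind (Q : (T -> \bar R) -> Prop) :
  (forall A (c : R), (0 <= c)%R -> measurable A ->
    Q (fun x => c%:E * (\1_A x)%:E)) ->
  (forall f g, measurable_fun setT f -> measurable_fun setT g ->
    (forall x, 0 <= f x) -> (forall x, 0 <= g x) -> Q f -> Q g ->
    Q (fun x => f x + g x)) ->
  (forall f : (T -> \bar R)^nat, (forall n, measurable_fun setT (f n)) ->
    (forall n x, 0 <= f n x) ->
    (forall x, nondecreasing_seq (f ^~ x)) ->
    (forall n, Q (f n)) -> Q (fun x => limn (f ^~ x))) ->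
  forall f, measurable_fun setT f -> (forall x, 0 <= f x) -> Q f.
Proof.
move=> Qi Qd Ql f mf f0.
pose f_ := nnsfun_approx measurableT mf.
have -> : f = fun x => limn (fun n => (f_ n x)%:E).
  apply/funext => x; apply/esym/cvg_lim => //.
  by apply: cvg_nnsfun_approx.
apply: Ql => [n|n x|x m n mn|n].
- exact/measurable_EFinP.
- by rewrite lee_fin.
- by rewrite lee_fin; exact/lefP/nd_nnsfun_approx.
have -> : (fun x => (f_ n x)%:E) = fun x =>
    \sum_(k <- fset_set (range (f_ n))) (k * \1_(f_ n @^-1` [set k]) x)%:E.
  apply/funext => x; rewrite fimfunE -fsumEFin//.
  by rewrite fsbig_finite.
suff sumP (s : seq R) : (forall k, k \in s -> (0 <= k)%R) ->
    Q (fun x => \sum_(k <- s) (k * \1_(f_ n @^-1` [set k]) x)%:E).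
  by apply: sumP => k; rewrite in_fset_set// inE => -[x _ <-].
elim: s => [|k s ih] sP.
  under eq_fun do rewrite big_nil.
  have := @Qi set0 0%R (lexx _) measurable0.
  by under eq_fun do rewrite mul0e.
under eq_fun do rewrite big_cons.
have mi j : measurable_fun setT (fun x => (j * \1_(f_ n @^-1` [set j]) x)%:E).
  by apply/measurable_EFinP/measurable_funM.
apply: Qd => //.
- exact: emeasurable_sum.
- by move=> x; rewrite lee_fin mulr_ge0// sP// mem_head.
- move=> x; rewrite big_seq; apply: sume_ge0 => j js.
  by rewrite lee_fin mulr_ge0// sP// inE js orbT.
- by under eq_fun do rewrite EFinM; apply: Qi => //; rewrite sP// mem_head.
- by apply: ih => j js; rewrite sP// inE js orbT.
Qed.

Variable f : T -> \bar R.
Hypotheses (f0 : forall x, 0 <= f x) (mf : measurable_fun setT f).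

Definition density of measurable_fun setT f & (forall x, 0 <= f x) :
  set T -> \bar R := fun A => \int[mu]_(x in A) f x.
Local Notation dens := (density mf f0).

Let dens0 : dens set0 = 0. Proof. exact: integral_set0. Qed.
Let dens_ge0 A : 0 <= dens A. Proof. exact: integral_ge0. Qed.
Let dens_sigma_additive : semi_sigma_additive dens.
Proof.
move=> F mF tF mUF; rewrite /density.
rewrite ge0_integral_bigcup//; last exact: measurable_funTS.
by apply: is_cvg_nneseries => n _ _; exact: integral_ge0.
Qed.

HB.instance Definition _ := isMeasure.Build _ _ _ dens
  dens0 dens_ge0 dens_sigma_additive.

Lemma integral_density (g : T -> \bar R) :
  measurable_fun setT g -> (forall y, 0 <= g y) ->
  \int[dens]_y g y = \int[mu]_x (f x * g x).
Proof.
apply: (ge0_measurable_ind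
  (Q := fun g => \int[dens]_y g y = \int[mu]_x (f x * g x)))
  => [A c c0 mA|g1 h mg1 mh g0 h0 gE hE|h mh h0 nd hE].
- rewrite ge0_integralZl_EFin//; last first.
    exact/measurable_EFinP/measurable_indic.
  rewrite integral_indic// setIT.
  rewrite -[LHS]/(c%:E * \int[mu]_(x in A) f x).
  under [RHS]eq_integral do rewrite muleCA.
  rewrite ge0_integralZl_EFin//; last first.
  - by apply: emeasurable_funM => //; exact/measurable_EFinP/measurable_indic.
  - by move=> x _; rewrite mule_ge0// lee_fin.
  congr (_ * _); rewrite [LHS]integral_mkcond; apply: eq_integral => x _.
  by rewrite patchE indicE; case: ifP; rewrite (mule1, mule0).
- rewrite ge0_integralD// gE hE -ge0_integralD//.
  + by apply: eq_integral => x _; rewrite ge0_muleDr.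
  + by move=> x _; rewrite mule_ge0.
  + exact: emeasurable_funM.
  + by move=> x _; rewrite mule_ge0.
  + exact: emeasurable_funM.
- have {}hE n : \int[dens]_y h n y = \int[mu]_x (f x * h n x) by exact: hE.
  have ch x : cvgn (h^~ x) by apply: ereal_nondecreasing_is_cvgn; exact: nd.
  rewrite monotone_convergence//.
  transitivity (limn (fun n => \int[mu]_x (f x * h n x))).
    by congr (limn _); apply/funext => n; exact: hE.
  rewrite -monotone_convergence//.
  + apply: eq_integral => x _; apply/cvg_lim => //.
    have [fx|fx] := boolP (f x \is a fin_num).
      by apply: cvgeZl => //; exact: ch.
    have {fx} fxy : f x = +oo.
      by move: fx (f0 x); case: (f x).
    rewrite fxy; have [hx0|] := pselect (forall n, h n x = 0).
      have -> : limn (h^~ x) = 0.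
        by apply: cvg_lim => //; apply: cvg_near_cst; exact: nearW.
      by apply: cvg_near_cst; apply: nearW => n; rewrite hx0 !mule0.
    move=> /existsNP[N /eqP hN0].
    have hgt0 n : (N <= n)%N -> 0 < h n x.
      by move=> Nn; rewrite (lt_le_trans _ (nd x _ _ Nn))// lt0e hN0 h0.
    rewrite gt0_mulye; last first.
      rewrite (lt_le_trans (hgt0 N (leqnn N)))//.
      by apply: lime_ge; [exact: ch|exists N => // n /= Nn; exact: nd].
    apply: cvg_near_cst; exists N => // n /= Nn.
    by rewrite gt0_mulye// hgt0.
  + by move=> n; exact: emeasurable_funM.
  + by move=> n x _; exact: mule_ge0.
  + by move=> x _ m n mn; apply: lee_wpmul2l => //; exact: nd.
Qed.

End density.

(** * The exponential scale and tilted laws *)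

Lemma measurable_natr_bool d (T : measurableType d) (R : realType)
    (b : T -> bool) : measurable_fun setT b ->
  measurable_fun setT (fun x => (b x)%:R : R).
Proof.
move=> mb; rewrite (_ : (fun _ => _) = \1_[set x | b x]).
  apply: measurable_indic.
  by rewrite -[X in measurable X]setTI; exact: (mb measurableT [set true]).
by apply/funext => x; rewrite indicE mem_setE.
Qed.

Section exponential_scale.
Context {R : realType}.
Implicit Types (x u m : \bar R) (p : R).

Lemma measurable_expeR : measurable_fun [set: \bar R] (@expeR R).
Proof.
move=> mD; apply: (measurability _ (ErealGenOInfty.measurableE R)) => //.
move=> _ [_ [r ->] <-]; rewrite setTI.
have [r0|r0] := ltP r 0%R.
  rewrite (_ : _ @^-1` _ = setT)//; apply/seteqP; split => // x _ /=.
  by rewrite in_itv/= andbT (lt_le_trans _ (expeR_ge0 x))// lte_fin.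
have [y yr] : exists y : \bar R, expeR y = r%:E.
  by apply: expeR_total; rewrite lee_fin.
rewrite (_ : _ @^-1` _ = `]y, +oo]%classic); first exact: emeasurable_itv.
apply/seteqP; split => x /=; rewrite !in_itv/= -yr ?leey ?andbT.
  by rewrite lte_expeR.
by rewrite lte_expeR.
Qed.

Lemma lt_lne p x : (p%:E < lne x) = ((expR p)%:E < x).
Proof.
have [x0|x0] := leP x 0.
  rewrite le0_lneNy// ltNge leNye/=; apply/esym/negbTE; rewrite -leNgt.
  by rewrite (le_trans x0)// lee_fin expR_ge0.
rewrite -lte_expeR lneK// in_itv/= leey andbT; exact: ltW.
Qed.

Lemma measurable_lne : measurable_fun [set: \bar R] (@lne R).
Proof.
move=> mD; apply: (measurability _ (ErealGenOInfty.measurableE R)) => //.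
move=> _ [_ [r ->] <-]; rewrite setTI.
rewrite (_ : _ @^-1` _ = `](expR r)%:E, +oo]%classic).
  exact: emeasurable_itv.
by apply/seteqP; split => x /=; rewrite !in_itv/= !leey !andbT lt_lne.
Qed.

(** The conventions for infinite values make this equivalence hold for every u,
    +oo included. *)
Lemma le_expeR_score p u x : x != -oo ->
  (p%:E + u <= x) = (expeR (u - x) <= (expR (- p))%:E).
Proof.
move=> xNy; rewrite -[(expR _)%:E]/(expeR (- p)%:E) lee_expeR.
case: x xNy => [x| |]//= _; case: u => [u| |]//=.
- by rewrite -EFinD -EFinB !lee_fin; apply/idP/idP => ?; lra.
- by rewrite addeNy addNye !leNye.
- by rewrite addeNy leey leNye.
- by rewrite addeNy leey leNye.
- by rewrite addeNy leey leNye.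
Qed.

(** The substitution v = exp (- p) turns this integral into the length of the
    interval from 0 to m. *)
Lemma integral_expRN m : 0 <= m ->
  \int[lebesgue_measure]_p ((expR (- p))%:E * ((expR (- p))%:E < m)%E%:R%:E) = m.
Proof.
have real (r : R) : (0 < r)%R -> \int[lebesgue_measure]_p
    ((expR (- p))%:E * ((expR (- p))%:E < r%:E)%E%:R%:E) = r%:E.
  move=> r0; pose c := (- ln r)%R.
  have cE p : (((expR (- p))%:E < r%:E) = (c < p)%R).
    rewrite lte_fin -[in LHS](lnK r0) ltr_expR /c.
    by apply/idP/idP => ?; lra.
  transitivity (\int[lebesgue_measure]_(p in `]c, +oo[) (expR (- p))%:E).
    rewrite [RHS]integral_mkcond; apply: eq_integral => p _.
    rewrite cE patchE mem_setE in_itv/= andbT.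
    by case: ifP; rewrite (mule1, mule0).
  have mexp : measurable_fun setT (fun p : R => (expR (- p))%R).
    by apply: measurableT_comp => //; exact: measurable_funN.
  rewrite integral_itv_obnd_cbnd; last first.
    by apply/measurable_EFinP; exact: measurable_funTS.
  have dF (x : R) : is_derive x 1%R (fun p => - expR (- p))%R (expR (- x)).
    apply: is_derive_eq.
    by rewrite /GRing.scale/=; ring.
  rewrite (@ge0_continuous_FTC2y _ _ (fun p => - expR (- p))%R _ 0%R).
  - by rewrite /c opprK lnK// sub0e EFinN oppeK.
  - by move=> x _; exact: expR_ge0.
  - apply: continuous_subspaceT => x.
    by apply: continuous_comp; [exact: continuousN|exact: continuous_expR].
  - rewrite -[X in _ --> X]oppr0; apply: cvgN.
    exact: cvgr_expR.
  - by move=> x _; apply: ex_derive.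
  - apply: cvg_at_right_filter.
    apply: cvgN; apply: continuous_comp; [exact: continuousN|].
    exact: continuous_expR.
  - by move=> x _; rewrite derive1E; apply: derive_val.
case: m => [r| |]//.
- rewrite lee_fin le_eqVlt => /predU1P[<-|]; last exact: real.
  apply: integral0_eq => p _.
  by rewrite lte_fin ltNge expR_ge0 mule0.
- move=> _; apply: eq_infty => r.
  rewrite (@le_trans _ _ (Num.max r 1)%:E)//.
    by rewrite lee_fin le_max lexx.
  rewrite -[leLHS](real (Num.max r 1)%R); last by rewrite lt_max ltr01 orbT.
  have mexp : measurable_fun setT (fun p : R => (expR (- p))%R).
    by apply: measurableT_comp => //; exact: measurable_funN.
  apply: ge0_le_integral => //.
  - apply: emeasurable_funM; first exact/measurable_EFinP.
    apply/measurable_EFinP/measurable_natr_bool.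
    by apply: measurable_fun_lte => //; exact/measurable_EFinP.
  - apply: emeasurable_funM; first exact/measurable_EFinP.
    apply/measurable_EFinP/measurable_natr_bool.
    by apply: measurable_fun_lte => //; exact/measurable_EFinP.
  - move=> p _; rewrite ltry mule1.
    by case: (_ < _); rewrite ?mule1 ?mule0 ?lexx ?lee_fin ?expR_ge0.
Qed.
End exponential_scale.

Section normalized_density.
Context d (T : measurableType d) (R : realType).
Variables (P : {measure set T -> \bar R}) (f : T -> \bar R).
Hypotheses (f0 : forall x, 0 <= f x) (mf : measurable_fun setT f).
Hypothesis f1 : \int[P]_x f x = 1.

(** The same set function as the density of f, on which f1 puts the structure of a
    probability *)
Definition normalized_density of \int[P]_x f x = 1 := density P mf f0.
Local Notation nd := (normalized_density f1).

Let nd0 : nd set0 = 0. Proof. exact: measure0. Qed.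
Let nd_ge0 A : 0 <= nd A. Proof. exact: measure_ge0. Qed.
Let nd_sigma_additive : semi_sigma_additive nd.
Proof. exact: measure_semi_sigma_additive. Qed.

HB.instance Definition _ := isMeasure.Build _ _ _ nd nd0 nd_ge0 nd_sigma_additive.
HB.instance Definition _ := Measure_isProbability.Build _ _ _ nd f1.

End normalized_density.

Section tilted_law.
Context (R : realType) (I : Type).
Context d (Omega : measurableType d) (P : probability Omega R).
Variable Z : I -> Omega -> \bar R.
Hypothesis procZ : process Z.
Hypothesis expZ : forall t, \int[P]_w expeR (Z t w) = 1.

Lemma measurable_expZ t : measurable_fun setT (fun w => expeR (Z t w)).
Proof.
by have [mZ _] := procZ; exact: (measurableT_comp measurable_expeR (mZ t)).
Qed.

Definition tilted_law t :=
  normalized_density (fun w => expeR_ge0 (Z t w)) (measurable_expZ t) (expZ t).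

Lemma integral_tilted_law t (g : Omega -> \bar R) :
  measurable_fun setT g -> (forall w, 0 <= g w) ->
  \int[tilted_law t]_w g w = \int[P]_w (expeR (Z t w) * g w).
Proof.
move=> mg g0; exact: (integral_density P (fun w => expeR_ge0 (Z t w))
  (measurable_expZ t) mg g0).
Qed.

End tilted_law.

(** * Laws of finitely many values *)

Section orthants.
Context {R : realType}.

Definition orthant n (x : 'I_n -> \bar R) : set (n.-tuple (\bar R)) :=
  [set y | forall j, tnth y j <= x j].

(** Bounds equal to -oo are excluded, as the events to which orthants are applied
    below are described by exponentials of differences with the bounds. *)
Definition orthants n : set (set (n.-tuple (\bar R))) :=
  [set orthant x | x in [set x | forall j, x j != -oo]].

Lemma measurable_orthant n (x : 'I_n -> \bar R) : measurable (orthant x).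
Proof.
apply: measurable_forall_ord => j; rewrite -[X in measurable X]setTI.
by apply: measurable_lee => //; exact: measurable_tnth.
Qed.

Lemma orthants_generate n :
  @measurable _ (n.-tuple (\bar R)) = <<s @orthants n >>.
Proof.
apply/seteqP; split; last first.
  apply: smallest_sub; first exact: sigma_algebra_measurable.
  by move=> _ [x _ <-]; exact: measurable_orthant.
apply: smallest_sub; first exact: smallest_sigma_algebra.
move=> A; rewrite -bigcup_seq => -[j _].
suff mj : measurable_fun [set: g_sigma_algebraType (@orthants n)]
    (fun y => tnth (y : n.-tuple (\bar R)) j).
  by move=> [B mB <-]; exact: (mj measurableT B mB).
move=> mT; apply: (measurability _ (ErealGenOInfty.measurableE R)) => //.
move=> _ [_ [r ->] <-]; rewrite setTI.
rewrite (_ : _ @^-1` _ = ~` orthant (fun i => if i == j then r%:E else +oo)).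
  apply: measurableC; apply: sub_sigma_algebra; eexists; last reflexivity.
  by move=> i /=; case: ifP.
apply/seteqP; split => y /=; rewrite in_itv/= andbT.
  by move=> ry /(_ j); rewrite eqxx leNgt ry.
rewrite ltNge => yP; apply/negP => yr; apply: yP => i.
by case: eqP => [->//|_]; exact: leey.
Qed.

(** The orthants are stable under intersection and generate the sigma-algebra. *)
Lemma measure_eq_orthants n (m1 m2 : {measure set (n.-tuple (\bar R)) -> \bar R}) :
  m1 setT < +oo ->
  (forall x, (forall j, x j != -oo) -> m1 (orthant x) = m2 (orthant x)) ->
  forall A, measurable A -> m1 A = m2 A.
Proof.
move=> m1T m12 A mA.
apply: (measure_unique (@orthants n) (fun=> setT)) => //.
- exact: orthants_generate.
- move=> _ _ [x xNy <-] [y yNy <-].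
  exists (fun j => mine (x j) (y j)) => [j|].
    by rewrite /mine; case: ifP.
  apply/seteqP; split => z /= zP.
    by split=> j; have := zP j; rewrite le_min => /andP[].
  by move=> j; rewrite le_min zP.1 zP.2.
- move=> _; exists (fun=> +oo) => //; apply/seteqP; split => // y _ j.
  exact: leey.
- by rewrite bigcup_const//; exists 0%N.
- by move=> _ [x xNy <-]; exact: m12.
Qed.

End orthants.

Section finite_dimensional_laws.
Context {R : realType}.

Definition values d (Omega : measurableType d) (I : Type) n (s : n.-tuple I)
  (Z : I -> Omega -> \bar R) (w : Omega) : n.-tuple (\bar R) :=
  [tuple Z (tnth s j) w | j < n].

Lemma measurable_values d (Omega : measurableType d) (I : Type) n
    (s : n.-tuple I) (Z : I -> Omega -> \bar R) :
  (forall t, measurable_fun setT (Z t)) -> measurable_fun setT (values s Z).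
Proof.
move=> mZ; apply/measurable_fun_tnthP => j.
rewrite (_ : _ \o _ = Z (tnth s j)); first exact: mZ.
by apply/funext => w /=; rewrite tnth_mktuple.
Qed.

Section two_processes.
Context d1 d2 (Omega1 : measurableType d1) (Omega2 : measurableType d2).
Variables (I : Type) (Z1 : I -> Omega1 -> \bar R) (Z2 : I -> Omega2 -> \bar R).
Variables (mu1 : {measure set Omega1 -> \bar R}).
Variables (mu2 : {measure set Omega2 -> \bar R}).
Hypotheses (mZ1 : forall t, measurable_fun setT (Z1 t)).
Hypotheses (mZ2 : forall t, measurable_fun setT (Z2 t)).

Lemma fdd_eq_orthants : mu1 setT < +oo ->
  (forall n (s : n.-tuple I) x, (forall j, x j != -oo) ->
     mu1 [set w | forall j, Z1 (tnth s j) w <= x j] =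
     mu2 [set w | forall j, Z2 (tnth s j) w <= x j]) ->
  fdd_eq mu1 Z1 mu2 Z2.
Proof.
move=> mu1T Z12 n s B mB; rewrite /fdd.
pose m1 := image_measure mu1 (measurable_values s mZ1).
pose m2 := image_measure mu2 (measurable_values s mZ2).
apply: (@measure_eq_orthants _ _ m1 m2) => // x xNy.
transitivity (mu1 [set w | forall j, Z1 (tnth s j) w <= x j]).
  congr (mu1 _); apply/seteqP; split => w /= wx j;
    by have := wx j; rewrite tnth_mktuple.
rewrite Z12//; congr (mu2 _); apply/seteqP; split => w /= wx j;
  by have := wx j; rewrite tnth_mktuple.
Qed.

Lemma fdd_eq_integral n (s : n.-tuple I) (phi : n.-tuple (\bar R) -> \bar R) :
  fdd_eq mu1 Z1 mu2 Z2 ->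
  measurable_fun setT phi -> (forall y, 0 <= phi y) ->
  \int[mu1]_w phi (values s Z1 w) = \int[mu2]_w phi (values s Z2 w).
Proof.
move=> Z12 mphi phi0.
rewrite -(integral_image mu1 (measurable_values s mZ1))//.
rewrite -(integral_image mu2 (measurable_values s mZ2))//.
by apply: eq_measure_integral => A mA _; exact: Z12.
Qed.

End two_processes.

End finite_dimensional_laws.

(** * The exponential formula for Poisson processes *)

Section discrete_product.
Context d (Omega : measurableType d) (R : realType) (P : probability Omega R).

(** Counts of points are extended real numbers; this evaluates a at those that are
    natural numbers. *)
Definition nat_fun (a : nat -> R) (y : \bar R) : R :=
  let m := Num.truncn (fine y) in if y == m%:R%:E then a m else 0%R.

Lemma nat_fun_nat a m : nat_fun a m%:R%:E = a m.
Proof. by rewrite /nat_fun/= natrK eqxx. Qed.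

Lemma nat_fun_notin a y : (forall m : nat, y != m%:R%:E) -> nat_fun a y = 0%R.
Proof. by move=> ym; rewrite /nat_fun (negbTE (ym _)). Qed.

Lemma nat_fun_in (a : nat -> R) (B : set R) y :
  B 0%R -> (forall m, B (a m)) -> B (nat_fun a y).
Proof. by move=> B0 Ba; rewrite /nat_fun; case: ifP. Qed.

Lemma nat_fun_series a y : (forall m, 0 <= a m)%R ->
  (nat_fun a y)%:E = \sum_(m <oo) (a m)%:E * ((y == m%:R%:E)%:R)%:E.
Proof.
move=> a0; have t0 m : 0 <= (a m)%:E * ((y == m%:R%:E)%:R)%:E :> \bar R.
  by rewrite mule_ge0// lee_fin.
have [[m ->]|ym] := pselect (exists m : nat, y = m%:R%:E).
  rewrite nat_fun_nat (@nneseriesD1 _ _ m)//=; last first.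
    by move=> k _; rewrite mule_ge0// lee_fin.
  rewrite eqxx mule1 eseries0 ?adde0//.
  move=> k _ /= km; rewrite eqe eqr_nat eq_sym (negbTE km).
  by rewrite mule0.
have {}ym m : y != m%:R%:E by apply/eqP => e; apply: ym; exists m.
rewrite nat_fun_notin// eseries0// => k _ _.
by rewrite (negbTE (ym k)) mule0.
Qed.

Lemma measurable_eq_nat (N : Omega -> \bar R) (x : \bar R) :
  measurable_fun setT N -> measurable_fun setT (fun w => (N w == x)%:R : R).
Proof.
move=> mN; apply: measurable_natr_bool; apply: measurable_fun_eqe => //.
Qed.

Lemma expectation_eq (N : Omega -> \bar R) (x : \bar R) :
  measurable_fun setT N ->
  \int[P]_w ((N w == x)%:R)%:E = P [set w | N w = x].
Proof.
move=> mN; rewrite -[X in P X]setIT -integral_indic//; last first.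
  by rewrite -[X in measurable X]setTI; exact: measurable_eqe.
apply: eq_integral => w _; rewrite indicE.
by have -> : (w \in [set w | N w = x]) = (N w == x)
  by apply/idP/eqP => [/set_mem|e]; last exact/mem_set.
Qed.

Lemma measurable_nat_fun (a : nat -> R) (N : Omega -> \bar R) :
  (forall m, 0 <= a m)%R ->
  measurable_fun setT N -> measurable_fun setT (fun w => nat_fun a (N w)).
Proof.
move=> a0 mN; apply/measurable_EFinP.
rewrite (_ : _ \o _ = fun w => \sum_(m <oo) (a m)%:E * ((N w == m%:R%:E)%:R)%:E).
  apply: ge0_emeasurable_sum => [k w _ _|k _].
    by rewrite mule_ge0// lee_fin.
  apply: emeasurable_funM => //; apply/measurable_EFinP.
  exact: measurable_eq_nat.
by apply/funext => w /=; exact: nat_fun_series.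
Qed.

Lemma integral_nat_fun (a : nat -> R) (N : Omega -> \bar R) (V : Omega -> R) :
  (forall m, 0 <= a m)%R ->
  measurable_fun setT N -> measurable_fun setT V -> (forall w, 0 <= V w)%R ->
  \int[P]_w (nat_fun a (N w) * V w)%:E =
  \sum_(m <oo) (a m)%:E * \int[P]_w ((N w == m%:R%:E)%:R * V w)%:E.
Proof.
move=> a0 mN mV V0.
have mNm m : measurable_fun setT (fun w => ((N w == m%:R%:E)%:R * V w)%R).
  by apply: measurable_funM => //; exact: measurable_eq_nat.
transitivity (\int[P]_w
    \sum_(m <oo) (a m)%:E * ((N w == m%:R%:E)%:R * V w)%:E).
  apply: eq_integral => w _; rewrite EFinM nat_fun_series// muleC -nneseriesZl.
    by apply: eq_eseriesr => m _; rewrite muleCA -EFinM (mulrC (V w)).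
  by move=> m _; rewrite mule_ge0// lee_fin.
rewrite integral_nneseries//.
- apply: eq_eseriesr => m _; rewrite ge0_integralZl_EFin//.
  + by move=> w _; rewrite lee_fin mulr_ge0.
  + exact/measurable_EFinP.
- by move=> m; apply: emeasurable_funM => //; exact/measurable_EFinP.
- by move=> m w _; rewrite mule_ge0// lee_fin// mulr_ge0.
Qed.

Lemma expectation_nat_fun (a : nat -> R) (N : Omega -> \bar R) :
  (forall m, 0 <= a m)%R -> measurable_fun setT N ->
  \int[P]_w (nat_fun a (N w))%:E =
  \sum_(m <oo) (a m)%:E * P [set w | N w = m%:R%:E].
Proof.
move=> a0 mN.
transitivity (\int[P]_w (nat_fun a (N w) * 1)%:E).
  by apply: eq_integral => w _; rewrite mulr1.
rewrite integral_nat_fun//; apply: eq_eseriesr => m _; congr (_ * _).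
by under eq_integral do rewrite mulr1; exact: expectation_eq.
Qed.

(** Independence of the events on which discrete variables take given values
    extends to functions of these variables, one variable at a time. *)
Lemma expectation_prod_nat_fun n (N : 'I_n -> Omega -> \bar R)
    (a : 'I_n -> nat -> R) :
  (forall j m, 0 <= a j m <= 1)%R ->
  (forall j, measurable_fun setT (N j)) ->
  (forall x, P [set w | forall j, N j w = x j] =
     \prod_(j < n) P [set w | N j w = x j]) ->
  \int[P]_w (\prod_(j < n) nat_fun (a j) (N j w))%:E =
  \prod_(j < n) \int[P]_w (nat_fun (a j) (N j w))%:E.
Proof.
move=> a01 mN indepN.
have a0 j m : (0 <= a j m)%R by case/andP: (a01 j m).
(* the first k variables are already replaced by functions of them, and the
   others are still restricted to their values in x *)
pose psi k (x : 'I_n -> \bar R) (j : 'I_n) w : R :=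
  if (j < k)%N then nat_fun (a j) (N j w) else (N j w == x j)%:R.
have psi01 k x j w : (0 <= psi k x j w <= 1)%R.
  rewrite /psi; case: ifP => _; last by rewrite ler0n lern1 leq_b1.
  by apply: (@nat_fun_in _ [set r | 0 <= r <= 1]%R) => //=; rewrite lexx ler01.
have psi0 k x j w : (0 <= psi k x j w)%R by case/andP: (psi01 k x j w).
have mpsi k x j : measurable_fun setT (psi k x j).
  rewrite /psi; case: (j < k)%N; first exact: measurable_nat_fun.
  exact: measurable_eq_nat.
suff H k x : \int[P]_w (\prod_(j < n) psi k x j w)%:E =
    \prod_(j < n) \int[P]_w (psi k x j w)%:E.
  have := H n (fun=> 0); rewrite /psi.
  under eq_integral do under eq_bigr do rewrite ltn_ord.
  by under [RHS]eq_bigr do under eq_integral do rewrite ltn_ord.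
elim: k x => [|k ih] x.
  have psi0E j w : psi 0%N x j w = \1_[set w | N j w = x j] w.
    rewrite /psi ltn0 indicE.
    by have -> : (w \in [set w0 | N j w0 = x j]) = (N j w == x j)
      by apply/idP/eqP => [/set_mem|e]; last exact/mem_set.
  have mNx j : measurable [set w | N j w = x j].
    by rewrite -[X in measurable X]setTI; exact: measurable_eqe.
  transitivity (P [set w | forall j, N j w = x j]).
    rewrite -[X in P X]setIT -integral_indic//.
      apply: eq_integral => w _; congr (_%:E); rewrite indicE.
      have [|/existsNP[j Nj]] := pselect (forall j, N j w = x j).
        move=> Nx; rewrite mem_set// big1// => j _.
        by rewrite psi0E indicE mem_set.
      rewrite memNset => [|/(_ j)//].
      by rewrite (bigD1 j)//= psi0E indicE memNset// mul0r.
    exact: (measurable_forall_ord mNx).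
  rewrite indepN; apply: eq_bigr => j _.
  under eq_integral do rewrite psi0E.
  by rewrite integral_indic// setIT.
have [kn|nk] := ltnP k n; last first.
  have psiE j w : psi k.+1 x j w = psi k x j w.
    have jk : (j < k)%N by rewrite (leq_trans (ltn_ord j)).
    by rewrite /psi jk (ltn_trans jk).
  under eq_integral do under eq_bigr do rewrite psiE.
  by rewrite ih; apply: eq_bigr => j _; apply: eq_integral => w _; rewrite psiE.
pose j0 := Ordinal kn.
pose x_ m j : \bar R := if j == j0 then m%:R%:E else x j.
have psij0 w : psi k.+1 x j0 w = nat_fun (a j0) (N j0 w).
  by rewrite /psi /= ltnSn.
have psi_j0 m w : psi k (x_ m) j0 w = (N j0 w == m%:R%:E)%:R.
  by rewrite /psi /= ltnn /x_ eqxx.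
have psi_j m j w : j != j0 -> psi k (x_ m) j w = psi k.+1 x j w.
  move=> jj0; rewrite /psi /x_ (negbTE jj0) ltnS [in RHS]leq_eqVlt.
  by have -> : (nat_of_ord j == k) = false by apply/negbTE; rewrite -val_eqE in jj0.
pose V w := (\prod_(j < n | j != j0) psi k.+1 x j w)%R.
have mV : measurable_fun setT V.
  rewrite /V; under eq_fun do rewrite -big_filter; exact: measurable_prod.
have V0 w : (0 <= V w)%R by apply: prodr_ge0.
under eq_integral do rewrite (bigD1 j0)//= psij0 -/(V _).
rewrite integral_nat_fun// (bigD1 j0)//=.
set C := \prod_(j < n | j != j0) _.
have intpsi k' x' j : 0 <= \int[P]_w (psi k' x' j w)%:E <= 1.
  rewrite integral_ge0/=; last by move=> w _; rewrite lee_fin.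
  rewrite -(@probability_setT _ _ _ P) -[leRHS]mul1e -(@integral_cst _ _ _ P)//.
  apply: ge0_le_integral => //; do ?by move=> w _; rewrite lee_fin.
    by apply/measurable_EFinP.
  by move=> w _; rewrite lee_fin; case/andP: (psi01 k' x' j w).
have C01 : 0 <= C <= 1.
  rewrite /C; elim/big_ind : _ => // [|u v /andP[u0 u1] /andP[v0 v1]].
    by rewrite lexx lee01.
  by rewrite mule_ge0//= -[leRHS]mule1 lee_pmul.
have CE : C = (fine C)%:E.
  case/andP: C01 => C0 C1; rewrite fineK// ge0_fin_numE//.
  by rewrite (le_lt_trans C1)// ltry.
transitivity (\sum_(m <oo) C * ((a j0 m)%:E * \int[P]_w (N j0 w == m%:R%:E)%:R%:E)).
  apply: eq_eseriesr => m _; rewrite muleCA; congr (_ * _).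
  have -> : \int[P]_w ((N j0 w == m%:R%:E)%:R * V w)%:E =
      \int[P]_w (\prod_(j < n) psi k (x_ m) j w)%:E.
    apply: eq_integral => w _; rewrite [in RHS](bigD1 j0)//= psi_j0.
    by congr (_ * _)%:E; apply: eq_bigr => j jj0; rewrite psi_j.
  rewrite ih (bigD1 j0)//= muleC; congr (_ * _).
    by apply: eq_bigr => j jj0; apply: eq_integral => w _; rewrite psi_j.
  by apply: eq_integral => w _; rewrite psi_j0.
rewrite CE nneseriesZl; last first.
  move=> m _; apply: mule_ge0; first by rewrite lee_fin.
  by apply: integral_ge0 => w _; rewrite lee_fin.
rewrite -CE muleC; congr (_ * _).
under [RHS]eq_integral do rewrite psij0.
rewrite expectation_nat_fun//; apply: eq_eseriesr => m _; congr (_ * _).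
exact: expectation_eq.
Qed.

End discrete_product.

Section probability_facts.
Context d (T : measurableType d) (R : realType) (P : probability T R).

Lemma ae_of_probability1 (A : set T) : measurable A -> P A = 1 ->
  {ae P, forall w, A w}.
Proof.
move=> mA PA; exists (~` A); split => //; first exact: measurableC.
by rewrite probability_setC// PA subee.
Qed.

Lemma bounded_cvg (f_ : nat -> T -> R) (f : T -> R) :
  (forall n, measurable_fun setT (f_ n)) -> measurable_fun setT f ->
  (forall n w, 0 <= f_ n w <= 1)%R ->
  {ae P, forall w, f_ n w @[n --> \oo] --> f w} ->
  (fun n => \int[P]_w (f_ n w)%:E) @ \oo --> \int[P]_w (f w)%:E.
Proof.
move=> mf_ mf f01 fcvg.
have h1 n : measurable_fun setT (fun w => (f_ n w)%:E).
  by apply/measurable_EFinP.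
have h2 : measurable_fun setT (fun w => (f w)%:E) by apply/measurable_EFinP.
have h3 : {ae P, forall w, setT w -> (f_ n w)%:E @[n --> \oo] --> (f w)%:E}.
  by apply: filterS fcvg => w fw _; apply: cvg_EFin => //; exact: nearW.
have h4 : P.-integrable setT (cst 1) by exact: finite_measure_integrable_cst.
have h5 : {ae P, forall w n, setT w -> `|(f_ n w)%:E| <= cst 1 w}.
  by apply: aeW => w n _; rewrite gee0_abs lee_fin; case/andP: (f01 n w).
by have [] := dominated_convergence measurableT h1 h2 h3 h4 h5.
Qed.

End probability_facts.

Section poisson_product.
Context d (Omega : measurableType d) (R : realType) (P : probability Omega R).
Context dE (E : measurableType dE).
Variables (nu : {measure set E -> \bar R}) (g : E -> \bar R).
Hypotheses (mg : measurable_fun setT g) (g0 : forall x, 0 <= g x).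
Variable X : nat -> Omega -> E.

Local Notation lambda A := (\int[nu]_(x in A) g x).
Hypothesis poissonX : poisson_process P X (fun A => lambda A).

Let mX i : measurable_fun setT (X i). Proof. by case: poissonX. Qed.

Lemma measurable_point_count A : measurable A ->
  measurable_fun setT (point_count (R := R) X A).
Proof.
move=> mA; apply: ge0_emeasurable_sum => // i _.
apply: (@measurableT_comp _ _ _ _ _ _ (fun x => (\1_A x)%:E)) => //.
exact/measurable_EFinP/measurable_indic.
Qed.

Lemma poisson_generating_function A (c : R) : measurable A -> lambda A < +oo ->
  (0 <= c)%R ->
  \int[P]_w (nat_fun (fun m => c ^+ m)%R (point_count (R := R) X A w))%:E =
  (expR (- (1 - c) * fine (lambda A)))%:E.
Proof.
move=> mA lA c0; have mN := measurable_point_count mA.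
have l0 : (0 <= fine (lambda A))%R.
  by apply/fine_ge0/integral_ge0 => x _.
have cm0 m : (0 <= c ^+ m)%R by rewrite exprn_ge0.
have [_ /(_ A) law _] := poissonX.
rewrite expectation_nat_fun//; set r := (c * fine (lambda A))%R.
transitivity (\sum_(m <oo) (expR (- fine (lambda A)))%:E * (exp_coeff r m)%:E).
  apply: eq_eseriesr => m _.
  rewrite law// -!EFinM; congr (_%:E).
  rewrite /exp_coeff/= /r exprMn mulrA [RHS]mulrC; congr (_ * _)%R.
  by rewrite mulrA.
rewrite nneseriesZl; last first.
  by move=> m _; rewrite lee_fin exp_coeff_ge0// /r mulr_ge0.
have -> : \sum_(m <oo) (exp_coeff r m)%:E = (expR r)%:E :> \bar R.
  rewrite expRE -EFin_lim; last first.
    rewrite /pseries/=; under eq_fun do rewrite mulrC.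
    exact: is_cvg_series_exp_coeff.
  apply/congr_lim/funext => n /=; rewrite /pseries/= /series/= -sumEFin//.
  by under eq_bigr do rewrite /exp_coeff/= mulrC.
by rewrite -EFinM -expRD; congr (expR _)%:E; rewrite /r; ring.
Qed.

(** The value at 1 of the generating function is the probability that the count is a
    natural number. *)
Lemma point_count_nat A : measurable A -> lambda A < +oo ->
  {ae P, forall w, exists m : nat, point_count (R := R) X A w = m%:R%:E}.
Proof.
move=> mA lA; have mN := measurable_point_count mA.
pose B := [set w | nat_fun (cst 1%R) (point_count (R := R) X A w) == 1%R].
have one0 (m : nat) : (0 <= (cst 1 m : R))%R by [].
have mB : measurable B.
  have -> : B = (fun w => nat_fun (cst 1%R) (point_count (R := R) X A w))
      @^-1` [set 1%R] by apply/seteqP; split => w /eqP.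
  rewrite -[X in measurable X]setTI.
  by apply: (measurable_nat_fun one0 mN) => //; exact: measurable_set1.
have B01 w : nat_fun (cst 1%R) (point_count (R := R) X A w) = \1_B w.
  rewrite indicE; case: (boolP (w \in B)) => [/set_mem/eqP//|].
  move=> /negP wB; have [//|] := @nat_fun_in _ (cst 1%R)
    [set r | r = 0%R \/ r = 1%R] (point_count (R := R) X A w) (or_introl erefl)
    (fun=> or_intror erefl).
  by move=> e; exfalso; apply: wB; apply/mem_set/eqP.
have PB : P B = 1.
  rewrite -[B]setIT -integral_indic//.
  under eq_integral do rewrite -B01.
  have := poisson_generating_function mA lA ler01.
  rewrite subrr oppr0 mul0r expR0 => <-; apply: eq_integral => w _.
  congr (nat_fun _ _)%:E; apply/funext => m; by rewrite expr1n.
apply: filterS (ae_of_probability1 mB PB) => w /eqP wB.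
apply: contrapT => /forallNP wN; move: wB.
rewrite nat_fun_notin => [/esym/eqP|m]; first by rewrite oner_eq0.
by apply/eqP; exact: wN.
Qed.

(** A convergent sequence of natural numbers is eventually constant. *)
Lemma point_count_near A (m : nat) w : point_count (R := R) X A w = m%:R%:E ->
  \forall k \near \oo, (\sum_(i < k) (X i w \in A))%N = m.
Proof.
move=> wm; pose u k := (\sum_(i < k) (X i w \in A))%N.
have uE : (fun k => (u k)%:R%:E) @ \oo --> (m%:R%:E : \bar R).
  rewrite -wm /point_count.
  rewrite (_ : (fun k => _) = fun k => \sum_(0 <= i < k) \d_(X i w) A).
    by apply: is_cvg_nneseries => // i _ _.
  apply/funext => k; rewrite big_mkord /u natr_sum -sumEFin.
  by apply: eq_bigr => i _; rewrite diracE.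
have /fine_cvgP[_ /= {}uE] := uE.
have /cvgrPdist_lt/(_ 1%R ltr01) := uE.
apply: filterS => k /=; rewrite -/(u k) => ukm.
have : (`|m%:Z - (u k)%:Z| < 1)%R.
  by rewrite -(ltr_int R) intr_norm rmorphB/= -!pmulrn.
by move=> um; apply/esym/eqP; lia.
Qed.

(** Grouping the points by the set A j to which they belong turns the product into a
    product over j of powers, with the counts as exponents; the counts are
    independent, and each factor is a generating function. *)
Lemma poisson_simple n (A : 'I_n -> set E) (c : 'I_n -> R) :
  (forall j, measurable (A j)) -> trivIset setT A ->
  (forall j, lambda (A j) < +oo) -> (forall j, 0 <= c j <= 1)%R ->
  (fun k => \int[P]_w
     (\prod_(i < k) \prod_(j < n) c j ^+ (X i w \in A j))%:E) @ \oo -->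
  (expR (- \sum_(j < n) (1 - c j) * fine (lambda (A j))))%:E.
Proof.
move=> mA tA lA c01; have c0 j : (0 <= c j)%R by case/andP: (c01 j).
have cm01 j m : (0 <= c j ^+ m <= 1)%R.
  by rewrite exprn_ge0//= exprn_ile1//; case/andP: (c01 j).
have [_ _ indepX] := poissonX.
have -> : (expR (- \sum_(j < n) (1 - c j) * fine (lambda (A j))))%:E =
    \int[P]_w (\prod_(j < n)
      nat_fun (fun m => c j ^+ m)%R (point_count (R := R) X (A j) w))%:E.
  rewrite (@expectation_prod_nat_fun _ _ _ P _
    (fun j => point_count (R := R) X (A j)) (fun j m => c j ^+ m)%R)//.
  - rewrite [RHS](eq_bigr (fun j =>
        (expR (- (1 - c j) * fine (lambda (A j))))%:E)); last first.
      by move=> j _; exact: poisson_generating_function.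
    rewrite prodEFin -expR_sum -sumrN; congr (expR _)%:E.
    by apply: eq_bigr => j _; rewrite mulNr.
  - by move=> j; exact: measurable_point_count.
  - by move=> x; apply: indepX.
apply: bounded_cvg.
- move=> k; apply: measurable_prod => i _; apply: measurable_prod => j _.
  rewrite (_ : (fun w => _) = fun w => 1 - (1 - c j) * \1_(A j) (X i w))%R.
    apply: measurable_funB => //; apply: measurable_funM => //.
    by apply: measurableT_comp => //; exact: measurable_indic.
  apply/funext => w; rewrite indicE; case: (_ \in _).
    by rewrite expr1 mulr1 subKr.
  by rewrite expr0 mulr0 subr0.
- apply: measurable_prod => j _; apply: measurable_nat_fun.
    by move=> m; case/andP: (cm01 j m).
  exact: measurable_point_count.
- move=> k w; apply/andP; split.
    by apply: prodr_ge0 => i _; apply: prodr_ge0 => j _; rewrite exprn_ge0.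
  apply: Num.Theory.prodr_ile1 => i _; apply/andP; split.
    by apply: prodr_ge0 => j _; rewrite exprn_ge0.
  apply: Num.Theory.prodr_ile1 => j _; exact: cm01.
- have : {ae P, forall w, forall j, exists m : nat,
      point_count (R := R) X (A j) w = m%:R%:E}.
    by apply: filter_forall => j; exact: point_count_nat.
  apply: filterS => w Nw.
  pose m j := projT1 (cid (Nw j)).
  have mP j : point_count (R := R) X (A j) w = (m j)%:R%:E := projT2 (cid (Nw j)).
  apply: cvg_near_cst.
  have : \forall k \near \oo, forall j,
      (\sum_(i < k) (X i w \in A j))%N = m j.
    apply: filter_forall => j; exact: point_count_near.
  apply: filterS => k kP; rewrite exchange_big/=; apply: eq_bigr => j _.
  by rewrite mP nat_fun_nat prodrXr kP.
Qed.

End poisson_product.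

Section poisson_product_general.
Context d (Omega : measurableType d) (R : realType) (P : probability Omega R).
Context dE (E : measurableType dE).
Variables (nu : {measure set E -> \bar R}) (g : E -> \bar R).
Hypotheses (mg : measurable_fun setT g) (g0 : forall x, 0 <= g x).
Variable X : nat -> Omega -> E.
Hypothesis poissonX : poisson_process P X (fun A => \int[nu]_(x in A) g x).
Import HBNNSimple.

Let mX i : measurable_fun setT (X i). Proof. by case: poissonX. Qed.

(** The level sets of the simple function h are disjoint, and 1 - h is constant on
    each of them. *)
Lemma poisson_product_nnsfun (h : {nnsfun E >-> R}) : (forall x, h x <= 1)%R ->
  \int[nu]_x ((h x)%:E * g x) < +oo ->
  (fun k => \int[P]_w (\prod_(i < k) (1 - h (X i w)))%:E) @ \oo -->
  (expR (- fine (\int[nu]_x ((h x)%:E * g x))))%:E.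
Proof.
move=> h1 hg.
pose s : seq R := [seq c <- (fset_set (range h) : seq R) | c != 0%R].
have us : uniq s by apply: filter_uniq; exact: fset_uniq.
have sP c : (c \in s) = (c != 0%R) && (c \in range h).
  by rewrite mem_filter in_fset_set.
pose c_ (j : 'I_(size s)) : R := nth 0%R s j.
have c_s j : c_ j \in s by apply: mem_nth.
pose A (j : 'I_(size s)) := h @^-1` [set c_ j].
have c_inj : injective c_.
  by move=> i j /eqP; rewrite nth_uniq// => /eqP ij; exact: val_inj.
have c01 j : (0 < c_ j <= 1)%R.
  have := c_s j; rewrite sP => /andP[c0 /set_mem[x _ hx]].
  by rewrite lt_neqAle eq_sym c0/= -hx h1 fun_ge0.
have mA j : measurable (A j) by exact: measurable_sfunP.
have tA : trivIset setT A.
  move=> i j _ _ [x [/= hi hj]]; apply: c_inj.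
  by rewrite -hi -hj.
have hE x : h x = (\sum_(j < size s) c_ j * \1_(A j) x)%R.
  have [hx0|hx0] := eqVneq (h x) 0%R.
    rewrite hx0 big1// => j _; rewrite indicE memNset ?mulr0//.
    by rewrite /A /= hx0 => e; move: (c01 j); rewrite -e ltxx.
  have hs : h x \in s by rewrite sP hx0 mem_set//; exists x.
  have js : (index (h x) s < size s)%N by rewrite index_mem.
  rewrite (bigD1 (Ordinal js))//= indicE mem_set; last first.
    by rewrite /A /c_ /= nth_index.
  rewrite /c_ /= nth_index// mulr1 big1 ?addr0// => j jj.
  rewrite indicE memNset ?mulr0// /A /= => hxj; move/eqP: jj; apply.
  by apply: c_inj; rewrite -hxj /c_ /= nth_index.
have intE : \int[nu]_x ((h x)%:E * g x) =
    \sum_(j < size s) (c_ j)%:E * \int[nu]_(x in A j) g x.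
  have cg0 j x : 0 <= (c_ j)%:E * ((\1_(A j) x)%:E * g x).
    by rewrite !mule_ge0// lee_fin; case/andP: (c01 j) => /ltW.
  have mi j : measurable_fun setT (fun x => (\1_(A j) x)%:E * g x).
    by apply: emeasurable_funM => //; apply/measurable_EFinP/measurable_indic.
  transitivity (\int[nu]_x \sum_(j < size s) (c_ j)%:E * ((\1_(A j) x)%:E * g x)).
    apply: eq_integral => x _; rewrite {1}hE -sumEFin ge0_sume_distrl.
      by apply: eq_bigr => j _; rewrite EFinM muleA.
    by move=> j _; rewrite lee_fin mulr_ge0//; case/andP: (c01 j) => /ltW.
  rewrite ge0_integral_sum//; last first.
    by move=> j; exact: emeasurable_funM.
  apply: eq_bigr => j _; rewrite ge0_integralZl_EFin//.
  - congr (_ * _); rewrite [RHS]integral_mkcond; apply: eq_integral => x _.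
    by rewrite patchE indicE; case: ifP; rewrite (mul1e, mul0e).
  - by move=> x _; rewrite mule_ge0// lee_fin.
  - by case/andP: (c01 j) => /ltW.
have lA0 j : 0 <= \int[nu]_(x in A j) g x by exact: integral_ge0.
have clA0 j : 0 <= (c_ j)%:E * \int[nu]_(x in A j) g x.
  by rewrite mule_ge0// lee_fin; case/andP: (c01 j) => /ltW.
have lA j : \int[nu]_(x in A j) g x < +oo.
  have : (c_ j)%:E * \int[nu]_(x in A j) g x < +oo.
    apply: le_lt_trans hg; rewrite intE (bigD1 j)//= leeDl//.
    exact: sume_ge0.
  case: (\int[nu]_(x in A j) g x) (lA0 j) => // [r _ _|_].
    by rewrite ltry.
  by rewrite gt0_muley// lte_fin; case/andP: (c01 j).
have prodE w k : (\prod_(i < k) (1 - h (X i w)) =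
    \prod_(i < k) \prod_(j < size s) (1 - c_ j) ^+ (X i w \in A j))%R.
  apply: eq_bigr => i _; set x := X i w.
  have [/existsP[j /set_mem xj]|] := boolP [exists j, x \in A j].
    rewrite (bigD1 j)//= mem_set// expr1 [X in (1 - X)%R](_ : _ = c_ j)//.
    rewrite big1 ?mulr1// => j' j'j; rewrite memNset ?expr0// => xj'.
    by move/eqP: j'j; apply; apply: c_inj; rewrite -xj -xj'.
  rewrite negb_exists => /forallP xA.
  rewrite hE big1 ?subr0; last by move=> j _; rewrite indicE (negbTE (xA j)) mulr0.
  by rewrite big1// => j _; rewrite (negbTE (xA j)) expr0.
under eq_fun do under eq_integral do rewrite prodE.
have -> : fine (\int[nu]_x ((h x)%:E * g x)) =
    (\sum_(j < size s) (1 - (1 - c_ j)) * fine (\int[nu]_(x in A j) g x))%R.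
  rewrite intE -sum_fine.
    apply: eq_bigr => j _; rewrite subKr fineM//.
    by rewrite ge0_fin_numE.
  move=> j _; rewrite fin_numM// ge0_fin_numE//.
apply: (poisson_simple g0 poissonX (c := fun j => 1 - c_ j)%R mA tA lA) => j.
by case/andP: (c01 j) => c0 c1; apply/andP; split; lra.
Qed.

(** The exponential formula. The expectations of the partial products decrease both
    in the number of factors and in G, which allows to approximate G from below by
    simple functions. *)
Theorem poisson_product (G : E -> R) : (forall x, g x \is a fin_num) ->
  measurable_fun setT G ->
  (forall x, 0 <= G x <= 1)%R ->
  \int[nu]_x ((G x)%:E * g x) < +oo ->
  (fun k => \int[P]_w (\prod_(i < k) (1 - G (X i w)))%:E) @ \oo -->
  (expR (- fine (\int[nu]_x ((G x)%:E * g x))))%:E.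
Proof.
move=> gfin mG G01 intG.
have mEG : measurable_fun setT (EFin \o G) by exact/measurable_EFinP.
pose h := nnsfun_approx measurableT mEG.
have G0 x : setT x -> 0 <= (EFin \o G) x.
  by move=> _; rewrite lee_fin; case/andP: (G01 x).
have hG x : (fun m => (h m x)%:E) @ \oo --> (G x)%:E.
  exact: (cvg_nnsfun_approx measurableT mEG G0).
have ndh x : {homo (fun m => h m x) : m n / (m <= n)%N >-> (m <= n)%R}.
  by move=> m n mn; exact/lefP/nd_nnsfun_approx.
have h_le m x : (h m x <= G x)%R.
  rewrite -lee_fin; apply: (cvge_to_ge (hG x)).
  by exists m => // k /= mk; rewrite lee_fin ndh.
have h01 m x : (0 <= h m x <= 1)%R.
  by rewrite fun_ge0/= (le_trans (h_le m x))//; case/andP: (G01 x).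
pose F (f : E -> R) w k : R := (\prod_(i < k) (1 - f (X i w)))%R.
have F01 f w k : (forall x, 0 <= f x <= 1)%R -> (0 <= F f w k <= 1)%R.
  move=> f01; apply/andP; split.
    by apply: prodr_ge0 => i _; rewrite subr_ge0; case/andP: (f01 (X i w)).
  apply: Num.Theory.prodr_ile1 => i _.
  by case/andP: (f01 (X i w)) => ? ?; apply/andP; split; lra.
have mF f k : measurable_fun setT f -> measurable_fun setT (fun w => F f w k).
  move=> mf; apply: measurable_prod => i _; apply: measurable_funB => //.
  exact: measurableT_comp.
have mh m : measurable_fun setT (h m : E -> R) by [].
have F_le f1 f2 w k : (forall x, 0 <= f1 x <= 1)%R -> (forall x, 0 <= f2 x <= 1)%R ->
    (forall x, f1 x <= f2 x)%R -> (F f2 w k <= F f1 w k)%R.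
  move=> f1_01 f2_01 f12; apply: ler_prod => i _.
  rewrite subr_ge0 lerB// andbT; by case/andP: (f2_01 (X i w)).
pose a f k := \int[P]_w (F f w k)%:E.
have a_le (f1 f2 : E -> R) k : measurable_fun setT f1 -> measurable_fun setT f2 ->
    (forall x, 0 <= f1 x <= 1)%R -> (forall x, 0 <= f2 x <= 1)%R ->
    (forall x, f1 x <= f2 x)%R -> a f2 k <= a f1 k.
  move=> mf1 mf2 f1_01 f2_01 f12; apply: ge0_le_integral => //.
  - by move=> w _; rewrite lee_fin; case/andP: (F01 f2 w k f2_01).
  - by apply/measurable_EFinP; exact: mF.
  - by apply/measurable_EFinP; exact: mF.
  - by move=> w _; rewrite lee_fin F_le.
have a_ni (f : E -> R) : measurable_fun setT f -> (forall x, 0 <= f x <= 1)%R ->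
    nonincreasing_seq (a f).
  move=> mf f01; apply/nonincreasing_seqP => k; apply: ge0_le_integral => //.
  - by move=> w _; rewrite lee_fin; case/andP: (F01 f w k.+1 f01).
  - by apply/measurable_EFinP; exact: mF.
  - by apply/measurable_EFinP; exact: mF.
  - move=> w _; rewrite lee_fin /F big_ord_recr/=.
    rewrite ler_piMr//; first by case/andP: (F01 f w k f01).
    by rewrite gerBl; case/andP: (f01 (X k w)).
have mhg m : measurable_fun setT (fun x => (h m x)%:E * g x).
  by apply: emeasurable_funM => //; exact/measurable_EFinP.
have mGg : measurable_fun setT (fun x => (G x)%:E * g x).
  exact: emeasurable_funM.
have hg0 m x : 0 <= (h m x)%:E * g x by rewrite mule_ge0// lee_fin.
have Gg0 x : 0 <= (G x)%:E * g x by rewrite mule_ge0// (G0 x).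
have inth m : \int[nu]_x ((h m x)%:E * g x) <= \int[nu]_x ((G x)%:E * g x).
  by apply: ge0_le_integral => // x _; rewrite lee_wpmul2r ?lee_fin.
have inth_oo m : \int[nu]_x ((h m x)%:E * g x) < +oo.
  exact: le_lt_trans (inth m) intG.
pose L (r : \bar R) : \bar R := (expR (- fine r))%:E.
have ahL m : a (h m) @ \oo --> L (\int[nu]_x ((h m x)%:E * g x)).
  by apply: poisson_product_nnsfun => // x; case/andP: (h01 m x).
have hgcvg : (fun m => \int[nu]_x ((h m x)%:E * g x)) @ \oo -->
    \int[nu]_x ((G x)%:E * g x).
  rewrite (_ : \int[nu]_x ((G x)%:E * g x) =
      \int[nu]_x limn (fun m => (h m x)%:E * g x)).
    apply: cvg_monotone_convergence => //.
    by move=> x _ m n mn; rewrite lee_wpmul2r// lee_fin; exact: ndh.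
  apply: eq_integral => x _; apply/esym/cvg_lim => //.
  exact: cvgeZr.
have Lcvg : (fun m => L (\int[nu]_x ((h m x)%:E * g x))) @ \oo -->
    L (\int[nu]_x ((G x)%:E * g x)).
  apply: cvg_EFin; first exact: nearW.
  apply: continuous_cvg; first exact: continuous_expR.
  by apply: cvgN; apply: fine_cvg; rewrite fineK// ge0_fin_numE// integral_ge0.
(* on the one hand a G k <= a (h m) k, where k and then m tend to infinity; on the
   other hand a (h m) k is above its limit in k, and tends to a G k with m *)
have aG : a G @ \oo --> ereal_inf (range (a G)).
  apply: ereal_nonincreasing_cvgn; exact: a_ni.
rewrite -[X in _ --> X](_ : ereal_inf (range (a G)) = _)//.
apply/eqP; rewrite eq_le; apply/andP; split.
  apply: (cvge_to_ge Lcvg); apply: nearW => m.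
  apply: (cvge_to_ge (ahL m)); apply: nearW => k.
  apply: le_trans (a_le (h m) G k _ _ _ _ _) => //.
  by apply: ereal_inf_lbound; exists k.
apply: le_ereal_inf_tmp => _ [k _ <-].
have ahk : (fun m => a (h m) k) @ \oo --> a G k.
  apply: bounded_cvg => //.
  - by move=> m; exact: mF.
  - exact: mF.
  - by move=> m w; exact: F01.
  - apply: aeW => w; rewrite /F; elim: (k) => [|j ih].
      by rewrite big_ord0; under eq_fun do rewrite big_ord0; exact: cvg_cst.
    rewrite big_ord_recr/=; under eq_fun do rewrite big_ord_recr/=.
    apply: cvgM => //; apply: cvgB; first exact: cvg_cst.
    by have /fine_cvgP[_] := hG (X j w).
apply: (cvge_to_ge ahk); apply: nearW => m.
apply: (@le_trans _ _ (L (\int[nu]_x ((h m x)%:E * g x)))).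
  rewrite lee_fin ler_expR lerN2 fine_le ?inth//.
    by rewrite ge0_fin_numE// integral_ge0.
  by rewrite ge0_fin_numE// integral_ge0.
apply: (cvge_to_le (ahL m)); exists k => // j /= kj.
exact: a_ni.
Qed.

End poisson_product_general.

(** * Poisson processes with independent marks *)

Section independent_variables.
Context d (Omega : measurableType d) (R : realType) (P : probability Omega R).
Context d1 d2 (T1 : measurableType d1) (T2 : measurableType d2).
Variables (U : Omega -> T1) (V : Omega -> T2).
Hypotheses (mU : measurable_fun setT U) (mV : measurable_fun setT V).
Hypothesis indepUV : forall A B, measurable A -> measurable B ->
  P (U @^-1` A `&` V @^-1` B) = P (U @^-1` A) * P (V @^-1` B).

(** The joint law of independent variables is a product measure. *)
Lemma integral_independent (f : T1 * T2 -> \bar R) :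
  measurable_fun setT f -> (forall x, 0 <= f x) ->
  \int[P]_w f (U w, V w) = \int[P]_w \int[P]_w' f (U w, V w').
Proof.
move=> mf f0.
have mUV : measurable_fun setT (fun w => (U w, V w)).
  exact: measurable_fun_pair.
pose mu1 := image_measure P mU; pose mu2 := image_measure P mV.
pose m := image_measure P mUV.
rewrite -(integral_image P mUV)//.
transitivity (\int[mu1 \x mu2]_z f z).
  apply: eq_measure_integral => A mA _; apply/esym.
  by apply: product_measure_unique => // B C mB mC; exact: indepUV.
rewrite fubini_tonelli1//.
rewrite /fubini_F (integral_image P mU)//.
- apply: eq_integral => w _; rewrite (integral_image P mV)//.
  exact: measurableT_comp.
- exact: (measurable_fun_fubini_tonelli_F (m2 := mu2)).
- by move=> x; exact: integral_ge0.
Qed.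

End independent_variables.

Section independent_sigma_algebras.
Context d (Omega : measurableType d) (R : realType) (P : probability Omega R).
Context (J : choiceType) (G : J -> set (set Omega)).
Hypothesis indepG : mutually_independent P G.

(** Finite intersections of events of the G j, for j in s, are stable under
    intersection, and their independence of B is the hypothesis. *)
Lemma independent_generated (s : seq J) k A B : uniq (k :: s) ->
  <<s \bigcup_(j in [set` s]) G j >> A -> G k B -> P (A `&` B) = P A * P B.
Proof.
move=> uks sA GB; have [saG [Gm prodG]] := indepG.
have mB : measurable B by exact: Gm GB.
pose PI : set (set Omega) := [set C | exists2 E : J -> set Omega,
  (forall j, G j (E j)) & C = \bigcap_(j in [set` s]) E j].
have GT j : G j setT.
  have [G0 GC _] := saG j; rewrite -(setD0 setT); exact: GC.
have GI j : setI_closed (G j).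
  move=> C D GjC GjD.
  pose T := g_sigma_algebraType (G j).
  have TE : @measurable _ T = G j by exact: sigma_algebra_id.
  by rewrite -TE; apply: measurableI; rewrite TE.
have PIm : PI `<=` measurable.
  move=> _ [E GE ->]; rewrite bigcap_seq.
  by apply: bigsetI_measurable => j _; exact: Gm (GE j).
have {sA} sPI : <<s PI >> A.
  apply: sub_sigma_algebra2 sA => C [j /= js GjC].
  exists (fun i => if i == j then C else setT).
    by move=> i; case: eqP => // ->.
  apply/seteqP; split => w.
    by move=> Cw i _ /=; case: eqP.
  by move=> /(_ j js); rewrite eqxx.
pose m1 := mrestr P mB.
pose m2 := mscale (NngNum (fine_ge0 (measure_ge0 P B))) P.
have PBE : P B = (fine (P B))%:E by rewrite fineK// fin_num_measure.
suff -> : P (A `&` B) = m2 A by rewrite /m2/= /mscale/= muleC -PBE.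
rewrite -[LHS]/(m1 A).
apply: (g_sigma_algebra_measure_unique PI PIm (fun=> setT)) => //.
- by move=> _; exists (fun=> setT) => //; rewrite bigcapT.
- by rewrite bigcup_const//; exists 0%N.
- move=> _ _ [C GC ->] [D GD ->]; exists (fun j => C j `&` D j).
    by move=> j; exact: GI.
  by rewrite bigcapI.
- move=> _ [E GE ->]; rewrite /m2/= /mscale/= -PBE /m1/= /mrestr.
  pose E' j := if j == k then B else E j.
  have kE' : \bigcap_(j in [set` k :: s]) E' j =
      (\bigcap_(j in [set` s]) E j) `&` B.
    move: uks => /= /andP[ks _].
    apply/seteqP; split => w.
      move=> wE; split.
        move=> j js; have := wE j; rewrite /= inE js orbT => /(_ erefl).
        by rewrite /E'; case: eqP => // jk; rewrite -jk (js : j \in s) in ks.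
      by have := wE k; rewrite /= mem_head /E' eqxx; apply.
    move=> [wE wB] j /=; rewrite inE /E'; case: eqP => // _ /=; exact: wE.
  rewrite -kE' prodG//; last first.
    by move=> j _; rewrite /E'; case: eqP => // ->.
  rewrite prodG//; last by case/andP: uks.
  rewrite big_cons {1}/E' eqxx; congr (_ * _).
  apply: eq_big_seq => j js; rewrite /E'; case: eqP => // jk.
  by move: uks => /=; rewrite -jk js.
- by move=> _; rewrite /m1/= /mrestr setTI; rewrite -ge0_fin_numE// fin_num_measure.
Qed.

End independent_sigma_algebras.

Section marked_poisson.
Context d (Omega : measurableType d) (R : realType) (P : probability Omega R).
Context dE (E : measurableType dE) (G : option nat -> set (set Omega)).
Variables (X : nat -> Omega -> E).
Hypothesis indepG : mutually_independent P G.
Hypothesis mX : forall i,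
  measurable_fun [set: g_sigma_algebraType (G None)] (X i).
Variable H : forall i, set (E * g_sigma_algebraType (G (Some i))).
Arguments H : clear implicits.
Hypothesis mH : forall i, measurable (H i).
Arguments mH : clear implicits.

Let F i y : R := fine (P (xsection (H i) y)).

Let G_measurable j : G j `<=` measurable. Proof. by case: indepG => _ []. Qed.

Let idG j : Omega -> g_sigma_algebraType (G j) := id.

Let measurable_idG j : measurable_fun setT (idG j).
Proof. exact: (measurable_id_sub (@G_measurable j)). Qed.

(** The last mark is independent of the points and of the other marks, so its
    factor may be replaced by its average given the point; the factor v makes the
    induction on the number of marks go through. *)
Lemma marked_poisson_product k (v : Omega -> R) :
  measurable_fun [set: g_sigma_algebraType (G None)] v ->
  (forall w, 0 <= v w)%R ->
  \int[P]_w (v w * \prod_(i < k) \1_(H i) (X i w, w))%:E =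
  \int[P]_w (v w * \prod_(i < k) F i (X i w))%:E.
Proof.
elim: k v => [|k ih] v mv v0.
  by apply: eq_integral => w _; rewrite !big_ord0.
pose s : seq (option nat) := None :: [seq Some i | i <- iota 0 k].
have us : uniq (Some k :: s).
  rewrite /= map_inj_uniq ?iota_uniq ?andbT; last by move=> ? ? [].
  rewrite !inE negb_or/=; apply/andP; split.
    by apply/mapP => -[i]; rewrite mem_iota add0n => /andP[_ ik] [e]; rewrite e ltnn in ik.
  by apply/mapP => -[].
pose GU := \bigcup_(j in [set` s]) G j.
pose T1 := g_sigma_algebraType GU.
pose T2 := g_sigma_algebraType (G (Some k)).
have GU_measurable : GU `<=` measurable.
  by move=> A [j _ GjA]; exact: (@G_measurable j).
have mid1 := measurable_id_sub GU_measurable.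
have from_G j d' (T : measurableType d') (f : g_sigma_algebraType (G j) -> T) :
    j \in s -> measurable_fun setT f -> measurable_fun [set: T1] f.
  move=> js mf _ B mB; have := mf measurableT B mB.
  by rewrite !setTI; apply: sub_sigma_algebra2 => A GA; exists j.
have Ns : None \in s by rewrite mem_head.
have is_ (i : 'I_k) : Some (nat_of_ord i) \in s.
  by rewrite inE/= map_f// mem_iota add0n ltn_ord.
have m1H i : measurable_fun setT (\1_(H i) : _ -> R) by exact: measurable_indic.
pose f (x : T1 * T2) : \bar R :=
  (v x.1 * (\prod_(i < k) \1_(H i) (X i x.1, x.1)) *
   \1_(H k) (X k x.1, x.2))%:E.
have mpair : measurable_fun [set: T1]
    (fun w => (v w * \prod_(i < k) \1_(H i) (X i w, w))%R).
  apply: measurable_funM; first exact: (@from_G None).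
  apply: measurable_prod => i _.
  apply: (measurableT_comp (m1H i)).
  apply: measurable_fun_pair; first exact: (@from_G None).
  exact: (@from_G (Some (nat_of_ord i)) _ _ id).
have mf : measurable_fun setT f.
  apply/measurable_EFinP; apply: measurable_funM.
    exact: (measurableT_comp mpair measurable_fst).
  have mXk : measurable_fun setT (fun x : T1 * T2 => X k x.1).
    exact: (measurableT_comp (@from_G None _ _ _ Ns (mX k)) measurable_fst).
  exact: (measurableT_comp (m1H k) (measurable_fun_pair mXk measurable_snd)).
have f0 x : 0 <= f x.
  by rewrite lee_fin !mulr_ge0// prodr_ge0.
transitivity (\int[P]_w f (w, w)).
  by apply: eq_integral => w _; rewrite /f big_ord_recr/= mulrA.
rewrite (@integral_independent _ _ _ P _ _ T1 T2 id (idG (Some k)))//; last first.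
  move=> A B mA mB; apply: (independent_generated indepG us) => //.
  have [saG _] := indepG; by rewrite -[G _](sigma_algebra_id (saG _)).
have mF i : measurable_fun setT (F i).
  apply: measurableT_comp => //.
  have := measurable_fun_xsection (image_measure P (measurable_idG (j := Some i))) (mH i).
  exact.
transitivity (\int[P]_w ((v w * F k (X k w)) * \prod_(i < k) \1_(H i) (X i w, w))%:E).
  apply: eq_integral => w _; rewrite /f/=.
  under eq_integral do rewrite EFinM.
  have c0 : (0 <= v w * \prod_(i < k) \1_(H i) (X i w, w))%R.
    by rewrite mulr_ge0// prodr_ge0.
  have m1 : measurable_fun setT
      (fun w' => (\1_(H k) (X k w, idG (Some k) w'))%:E : \bar R).
    have mXw : measurable_fun [set: T2] (fun w' => (X k w, w')).
      exact: measurable_fun_pair.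
    apply/measurable_EFinP.
    exact: (measurableT_comp (measurableT_comp (m1H k) mXw)
      (measurable_idG (j := Some k))).
  rewrite ge0_integralZl_EFin//.
  have -> : \int[P]_w' (\1_(H k) (X k w, w'))%:E = (F k (X k w))%:E.
    rewrite /F fineK ?fin_num_measure//; last first.
      have := measurable_idG (j := Some k) measurableT.
      move=> /(_ _ (measurable_xsection (X k w) (mH k))).
      by rewrite setTI.
    rewrite -[X in P X]setIT -integral_indic//; last first.
      have := measurable_idG (j := Some k) measurableT.
      move=> /(_ _ (measurable_xsection (X k w) (mH k))).
      by rewrite setTI.
    by apply: eq_integral => w' _; rewrite !indicE mem_xsection.
  by rewrite -EFinM; congr (_%:E); ring.
rewrite ih.
- by apply: eq_integral => w _; rewrite big_ord_recr/=; congr (_%:E); ring.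
- apply: measurable_funM => //; exact: measurableT_comp.
- by move=> w; rewrite mulr_ge0// fine_ge0.
Qed.

End marked_poisson.

Section marked_poisson_avoidance.
Context d (Omega : measurableType d) (R : realType) (P : probability Omega R).
Context dE (E : measurableType dE) (G : option nat -> set (set Omega)).
Variables (nu : {measure set E -> \bar R}) (g : E -> \bar R).
Hypotheses (mg : measurable_fun setT g) (g0 : forall x, 0 <= g x).
Hypothesis gfin : forall x, g x \is a fin_num.
Variables (X : nat -> Omega -> E).
Hypothesis poissonX : poisson_process P X (fun A => \int[nu]_(x in A) g x).
Hypothesis indepG : mutually_independent P G.
Hypothesis mX : forall i,
  measurable_fun [set: g_sigma_algebraType (G None)] (X i).
Variable H : forall i, set (E * g_sigma_algebraType (G (Some i))).
Arguments H : clear implicits.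
Hypothesis mH : forall i, measurable (H i).
Arguments mH : clear implicits.
Variable F : E -> R.
Hypotheses (mF : measurable_fun setT F).
Hypothesis PH : forall i y, P (xsection (H i) y) = (F y)%:E.

Let G_measurable j : G j `<=` measurable. Proof. by case: indepG => _ []. Qed.

Let measurable_idG j : measurable_fun [set: Omega] (id : Omega -> g_sigma_algebraType (G j)).
Proof. exact: (measurable_id_sub (@G_measurable j)). Qed.

Let event i := [set w | H i (X i w, w)].

Let mevent i : measurable (event i).
Proof.
have mXG := measurable_fun_of_sub (@G_measurable None) (mX i).
have := measurable_fun_pair mXG (@measurable_idG (Some i)) measurableT (mH i).
by rewrite setTI.
Qed.

Let F01 y : (0 <= F y <= 1)%R.
Proof.
have mHy : measurable (xsection (H 0%N) y : set Omega).
  have := @measurable_idG (Some 0%N) measurableT _ (measurable_xsection y (mH 0%N)).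
  by rewrite setTI.
by rewrite -!lee_fin -(PH 0%N) measure_ge0 probability_le1.
Qed.

(** Given the Poisson points, the events are independent, so the probability of
    all of them is the expectation of an infinite product over these points. *)
Theorem marked_poisson_avoidance :
  \int[nu]_x ((1 - F x)%:E * g x) < +oo ->
  P (\bigcap_i event i) =
  (expR (- fine (\int[nu]_x ((1 - F x)%:E * g x))))%:E.
Proof.
move=> intF.
pose C k := \big[setI/setT]_(i < k) event i.
have mC k : measurable (C k) by exact: bigsetI_measurable.
have PC k : P (C k) = \int[P]_w (\prod_(i < k) (1 - (1 - F (X i w))))%:E.
  transitivity (\int[P]_w (1 * \prod_(i < k) \1_(H i) (X i w, w))%:E).
    rewrite -[X in P X]setIT -integral_indic//; apply: eq_integral => w _.
    rewrite mul1r; congr (_%:E); rewrite /C.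
    elim: (k) => [|j ih]; first by rewrite !big_ord0 indicE mem_set.
    by rewrite !big_ord_recr/= indicI -ih/=.
  rewrite (@marked_poisson_product _ _ _ P _ _ _ X indepG mX H mH k (cst 1%R))//.
  apply: eq_integral => w _; congr (_%:E); rewrite mul1r.
  by apply: eq_bigr => i _; rewrite PH/= subKr.
have cvgC : P \o C @ \oo --> P (\bigcap_i event i).
  have -> : \bigcap_i event i = \bigcap_k C k.
    apply/seteqP; split => w.
      move=> wE k _; rewrite /C -bigcap_mkord => i _; exact: wE.
    by move=> wC i _; have := wC i.+1 I; rewrite /C big_ord_recr/= => -[].
  apply: nonincreasing_cvg_mu => //.
  - by rewrite -ge0_fin_numE// fin_num_measure.
  - exact: bigcapT_measurable.
  - move=> m k mk; apply/subsetPset; rewrite /C -!bigcap_mkord => w wk i /= im.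
    by apply: wk; exact: leq_trans mk.
apply: (@cvg_unique _ _ (P \o C @ \oo)) => //.
rewrite (_ : P \o C = fun k =>
    \int[P]_w (\prod_(i < k) (1 - (1 - F (X i w))))%:E); last first.
  by apply/funext => k; exact: PC.
apply: (poisson_product mg g0 poissonX gfin) => //.
  exact: measurable_funB.
by move=> x; case/andP: (F01 x) => ? ?; apply/andP; split; lra.
Qed.

End marked_poisson_avoidance.

(** * The law of a max-stable process *)

Section score.
Context {R : realType}.
Implicit Types p : R.

(** The values p + u j satisfy the bounds x j exactly when the score is at most
    exp (- p), so it is the only feature of a mark u that matters in the law of a
    max-stable process. *)
Definition score n (x u : 'I_n -> \bar R) : \bar R :=
  \big[maxe/0]_(j < n) expeR (u j - x j).

Lemma score_ge0 n (x u : 'I_n -> \bar R) : 0 <= score x u.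
Proof. by rewrite /score bigmax_ge_id. Qed.

Lemma le_score n (x u : 'I_n -> \bar R) p : (forall j, x j != -oo) ->
  (forall j, p%:E + u j <= x j) <-> score x u <= (expR (- p))%:E.
Proof.
move=> xNy; split.
  move=> ux; apply/bigmax_leP; split; first by rewrite lee_fin expR_ge0.
  by move=> j _; rewrite -le_expeR_score.
by move=> /bigmax_leP[_ ux] j; rewrite le_expeR_score//; exact: ux.
Qed.

Lemma score_lty n (x u : 'I_n -> \bar R) : (forall j, x j != -oo) ->
  (forall j, u j != +oo) -> score x u < +oo.
Proof.
move=> xNy uy; apply/bigmax_ltP; split => // j _.
rewrite ltey expeR_eqy; case: (x j) (u j) (xNy j) (uy j) => [a| |] [b| |]//.
Qed.

Lemma score_le_sum n (x u : 'I_n -> \bar R) :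
  score x u <= \sum_(j < n) expeR (u j - x j).
Proof.
apply/bigmax_leP; split => [|j _].
  by apply: sume_ge0 => j _; exact: expeR_ge0.
by rewrite (bigD1 j)//= leeDl// sume_ge0// => i _; exact: expeR_ge0.
Qed.

Lemma measurable_score d (T : measurableType d) n (x : 'I_n -> \bar R)
    (u : 'I_n -> T -> \bar R) : (forall j, measurable_fun setT (u j)) ->
  measurable_fun setT (fun w => score x (u ^~ w)).
Proof.
move=> mu; rewrite /score.
have : forall j, measurable_fun setT (fun w => expeR (u j w - x j)).
  move=> j; apply: (measurableT_comp measurable_expeR).
  exact: emeasurable_funB.
elim: (index_enum _) => [|j r ih] me.
  by under eq_fun do rewrite big_nil; exact: measurable_cst.
under eq_fun do rewrite big_cons.
by apply: measurable_maxe => //; exact: ih.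
Qed.

(** The intensity of the first coordinate turns probabilities into expectations. *)
Lemma integral_probability_score d (Omega : measurableType d)
    (P : probability Omega R) (f : Omega -> \bar R) :
  measurable_fun setT f -> (forall w, 0 <= f w) ->
  \int[@lebesgue_measure R]_p
    ((1 - fine (P [set w | (f w <= (expR (- p))%:E)%E]))%:E * (expR (- p))%:E) =
  \int[P]_w f w.
Proof.
move=> mf f0.
pose h (x : R * Omega) : \bar R :=
  (expR (- x.1))%:E * ((expR (- x.1))%:E < f x.2)%E%:R%:E.
have mexp : measurable_fun setT (fun p : R => (expR (- p))%R).
  by apply: measurableT_comp => //; exact: measurable_funN.
have mh : measurable_fun setT h.
  have m1 : measurable_fun setT (fun x : R * Omega => (expR (- x.1))%:E).
    by apply/measurable_EFinP; exact: (measurableT_comp mexp measurable_fst).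
  apply: emeasurable_funM => //; apply/measurable_EFinP/measurable_natr_bool.
  by apply: measurable_fun_lte => //; exact: (measurableT_comp mf measurable_snd).
have h0 x : 0 <= h x by rewrite mule_ge0// lee_fin ?expR_ge0.
transitivity (\int[@lebesgue_measure R]_p \int[P]_w h (p, w)).
  apply: eq_integral => p _; rewrite /h/= ge0_integralZl_EFin ?expR_ge0//.
  - rewrite muleC; congr (_ * _).
    pose A := [set w | f w <= (expR (- p))%:E].
    have mA : measurable A.
      by rewrite -[X in measurable X]setTI; apply: measurable_lee.
    transitivity (P (~` A)).
      by rewrite probability_setC// EFinB fineK// fin_num_measure.
    rewrite -[~` A]setIT -integral_indic//; last exact: measurableC.
    apply: eq_integral => w _; rewrite indicE; congr (_%:R%:E).
    congr nat_of_bool; rewrite ltNge; apply/idP/idP => [/set_mem/negP//|wA].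
    by apply/mem_set/negP.
  - apply/measurable_EFinP/measurable_natr_bool.
    by apply: measurable_fun_lte.
rewrite (fubini_tonelli (m1 := lebesgue_measure) (m2 := P) h mh h0).
by apply: eq_integral => w _; exact: (integral_expRN (f0 w)).
Qed.

End score.

Section max_stable_law.
Context (R : realType) (I : Type).
Context d (Omega : measurableType d) (P : probability Omega R).
Context d0 (Omega0 : measurableType d0) (P0 : probability Omega0 R).
Variables (zeta : I -> Omega -> \bar R) (Z0 : I -> Omega0 -> \bar R).
Hypothesis procZ0 : process Z0.
Hypothesis max_stable_zeta : max_stable P zeta P0 Z0.

Lemma max_stable_measurable t : measurable_fun setT (zeta t).
Proof.
have [p [Z [G [[mp _ _] _ Zi zetaE]]]] := max_stable_zeta.
rewrite (_ : zeta t = fun w => esups (fun i => (p i w)%:E + Z i t w) 0%N).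
  apply: measurable_fun_esups => i; apply: emeasurable_funD.
    exact/measurable_EFinP.
  by have [[mZ _] _] := Zi i.
apply/funext => w; rewrite zetaE /esups; congr ereal_sup.
by apply/seteqP; split => [_ [i _ <-]|_ [i _ <-]]; exists i.
Qed.

(** All the values of zeta are below their bounds when every point p and its mark
    satisfy score <= exp (- p). *)
Theorem max_stable_orthant n (s : n.-tuple I) (x : 'I_n -> \bar R) :
  (forall j, x j != -oo) ->
  \int[P0]_w score x (fun j => Z0 (tnth s j) w) < +oo ->
  P [set w | forall j, zeta (tnth s j) w <= x j] =
  (expR (- fine (\int[P0]_w score x (fun j => Z0 (tnth s j) w))))%:E.
Proof.
move=> xNy intM.
have [p [Z [G [poissonp [indepG mp mZ] Zi zetaE]]]] := max_stable_zeta.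
have [mZ0 _] := procZ0.
pose M w := score x (fun j => Z0 (tnth s j) w).
have mM : measurable_fun setT M by apply: measurable_score => j.
have M0 w : 0 <= M w by exact: score_ge0.
pose F (q : R) := fine (P0 [set w | M w <= (expR (- q))%:E]).
pose H i : set (R * g_sigma_algebraType (G (Some i))) :=
  [set z | forall j, z.1%:E + Z i (tnth s j) z.2 <= x j].
pose g (q : R) : \bar R := (expR (- q))%:E.
have mg : measurable_fun setT g.
  by apply/measurable_EFinP; apply: measurableT_comp => //; exact: measurable_funN.
have g0 q : 0 <= g q by rewrite lee_fin expR_ge0.
have mF : measurable_fun setT F.
  apply: measurableT_comp => //.
  have mK : measurable [set z : R * Omega0 | M z.2 <= (expR (- z.1))%:E].
    rewrite -[X in measurable X]setTI; apply: measurable_lee => //.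
      exact: (measurableT_comp mM measurable_snd).
    exact: (measurableT_comp mg measurable_fst).
  have := measurable_fun_xsection P0 mK.
  congr measurable_fun; apply/funext => q /=; congr (P0 _).
  by apply/seteqP; split => w; rewrite /xsection/= inE.
have mH i : measurable (H i).
  apply: measurable_forall_ord => j; rewrite -[X in measurable X]setTI.
  apply: measurable_lee => //; apply: emeasurable_funD.
    by apply/measurable_EFinP.
  exact: (measurableT_comp (mZ i _) measurable_snd).
have PH i q : P (xsection (H i) q) = (F q)%:E.
  have [_ /(_ n s [set y | forall j, q%:E + tnth y j <= x j]) fddZ] := Zi i.
  have mB : measurable [set y : n.-tuple (\bar R) | forall j, q%:E + tnth y j <= x j].
    apply: measurable_forall_ord => j; rewrite -[X in measurable X]setTI.
    by apply: measurable_lee => //; apply: emeasurable_funD => //; exact: measurable_tnth.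
  transitivity (P0 [set w | M w <= (expR (- q))%:E]); last first.
    rewrite /F fineK// fin_num_measure// -[X in measurable X]setTI.
    exact: measurable_lee.
  transitivity (fdd P (Z i) s [set y | forall j, q%:E + tnth y j <= x j]).
    congr (P _); apply/seteqP; split => w; rewrite /xsection/= ?inE /H/=.
      by move=> wx j; rewrite tnth_mktuple; exact: wx.
    by move=> wx j; have := wx j; rewrite tnth_mktuple.
  rewrite fddZ//; congr (P0 _); apply/seteqP; split => w /=.
    by move=> wx; apply/le_score => // j; have := wx j; rewrite tnth_mktuple.
  by move=> /le_score wx j; rewrite tnth_mktuple; exact: wx.
have intE := integral_probability_score P0 mM M0.
rewrite -intE.
have -> : [set w | forall j, zeta (tnth s j) w <= x j] =
    \bigcap_i [set w | H i (p i w, w)].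
  apply/seteqP; split => w /= wx.
    move=> i _ j /=; apply: le_trans (wx j); rewrite zetaE.
    by apply: ereal_sup_ubound; exists i.
  by move=> j; rewrite zetaE; apply: ge_ereal_sup => _ [i _ <-]; exact: wx.
have gfin q : g q \is a fin_num by [].
have := marked_poisson_avoidance (nu := lebesgue_measure) mg g0 gfin poissonp indepG mp mH mF PH.
by apply; rewrite intE.
Qed.

End max_stable_law.

(** * Scores under shifts and tilts *)

Section shifted_processes.
Context (R : realType) (T : zmodType).

Lemma values_Lshift d (Omega : measurableType d) n (s : n.-tuple T) h
    (Z : T -> Omega -> \bar R) w :
  values s (Lshift h Z) w = values [tuple of [seq t - h | t <- s]]%R Z w.
Proof. by apply: eq_mktuple => j; rewrite /Lshift tnth_map. Qed.

Lemma fdd_eq_Lshift d1 d2 (Omega1 : measurableType d1)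
    (Omega2 : measurableType d2) (mu1 : set Omega1 -> \bar R)
    (mu2 : set Omega2 -> \bar R) Z1 Z2 (h : T) :
  fdd_eq mu1 Z1 mu2 Z2 -> fdd_eq mu1 (Lshift h Z1) mu2 (Lshift h Z2).
Proof.
move=> Z12 n s B mB; have := Z12 n [tuple of [seq t - h | t <- s]]%R B mB.
by rewrite /fdd; under eq_set do rewrite -/(values _ _ _) -values_Lshift;
  under [in X in _ = X -> _]eq_set do rewrite -/(values _ _ _) -values_Lshift.
Qed.

Lemma process_Lshift d (Omega : measurableType d) (Z : T -> Omega -> \bar R) h :
  process Z -> process (Lshift h Z).
Proof. by move=> [mZ Zy]; split => t; [exact: mZ|exact: Zy]. Qed.

Lemma max_stable_Lshift d d0 (Omega : measurableType d)
    (Omega0 : measurableType d0) (mu : set Omega -> \bar R) zeta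
    (mu0 : set Omega0 -> \bar R) (Z0 : T -> Omega0 -> \bar R) h :
  max_stable mu zeta mu0 Z0 -> max_stable mu (Lshift h zeta) mu0 (Lshift h Z0).
Proof.
move=> [p [Z [G [poissonp [indepG mp mZ] Zi zetaE]]]].
exists p, (fun i => Lshift h (Z i)), G; split => //.
- by split => // i t; exact: mZ.
- move=> i; have [procZ fddZ] := Zi i; split; first exact: process_Lshift.
  exact: fdd_eq_Lshift.
- by move=> t w; rewrite /Lshift zetaE.
Qed.

End shifted_processes.

Section max_expectations.
Context (R : realType).

(** The right derivative at c = 1 of the function max (c V, M) *)
Lemma cvg_max_slope (V M : R) : (0 <= V)%R ->
  (fun m : nat => (Num.max ((1 + m.+1%:R^-1) * V) M - Num.max V M) * m.+1%:R)%R
    @ \oo --> (if M <= V then V else 0)%R.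
Proof.
move=> V0; have m0 (m : nat) : (0 < m.+1%:R :> R)%R by rewrite ltr0n.
case: ifPn => [MV|]; last rewrite -ltNge => VM.
  apply: cvg_near_cst; apply: nearW => m.
  rewrite (max_l MV) max_l; last first.
    rewrite (le_trans MV)// mulrDl mul1r lerDl mulr_ge0// invr_ge0 ltW//.
  by move: (m0 m); set e := m.+1%:R => e0; field; exact: lt0r_neq0.
apply: cvg_near_cst; near=> m.
rewrite (max_r (ltW VM)) max_r ?subrr ?mul0r//.
rewrite mulrDl mul1r -lerBrDl mulrC ler_pdivrMr// -ler_pdivrMl ?subr_gt0//.
rewrite (@le_trans _ _ m%:R%R) ?ler_nat//.
by near: m; exact: nbhs_infty_ger.
Unshelve. all: by end_near. Qed.

(** The function max (c V, M) of c is nondecreasing and V-Lipschitz, which bounds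
    its difference quotients. *)
Lemma max_slope_bounds (V M c : R) : (0 <= V)%R -> (0 < c)%R ->
  (0 <= (Num.max ((1 + c^-1) * V) M - Num.max V M) * c <= V)%R.
Proof.
move=> V0 c0; have cV0 : (0 <= c^-1 * V)%R by rewrite mulr_ge0// invr_ge0 ltW.
have cV : ((1 + c^-1) * V = V + c^-1 * V)%R by rewrite mulrDl mul1r.
apply/andP; split.
  rewrite mulr_ge0 ?(ltW c0)// subr_ge0 ge_max !le_max cV lerDl cV0/=.
  by rewrite lexx orbT.
rewrite -ler_pdivlMr// lerBlDl ge_max cV [(V / c)%R]mulrC.
have Vmax : (V <= Num.max V M)%R by rewrite le_max lexx.
have Mmax : (M <= Num.max V M)%R by rewrite le_max lexx orbT.
by apply/andP; split; [exact: lerD|rewrite -[leLHS]addr0 lerD].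
Qed.

Section slope.
Context d (Omega : measurableType d) (P : probability Omega R).
Variables (V M : Omega -> R).
Hypotheses (mV : measurable_fun setT V) (mM : measurable_fun setT M).
Hypotheses (V0 : forall w, (0 <= V w)%R) (M0 : forall w, (0 <= M w)%R).
Hypotheses (intV : \int[P]_w (V w)%:E < +oo) (intM : \int[P]_w (M w)%:E < +oo).

Let iV : P.-integrable setT (EFin \o V).
Proof.
apply/integrableP; split; first exact/measurable_EFinP.
by under eq_integral do rewrite gee0_abs ?lee_fin//.
Qed.

Let iM : P.-integrable setT (EFin \o M).
Proof.
apply/integrableP; split; first exact/measurable_EFinP.
by under eq_integral do rewrite gee0_abs ?lee_fin//.
Qed.

Lemma integrable_max (c : R) : (1 <= c)%R ->
  P.-integrable setT (fun w => (Num.max (c * V w) (M w))%:E).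
Proof.
move=> c1; have c0 : (0 <= c)%R by rewrite (le_trans _ c1).
apply: (le_integrable measurableT (g := fun w => c%:E * (V w)%:E + (M w)%:E)).
- apply/measurable_EFinP; apply: measurable_maxr => //.
  exact: measurable_funM.
- move=> w _; rewrite -EFinM -EFinD !gee0_abs ?lee_fin.
  + by rewrite ge_max lerDl M0 lerDr mulr_ge0.
  + by rewrite addr_ge0// mulr_ge0.
  + by rewrite le_max M0 orbT.
- by apply: integrableD => //; exact: integrableZl.
Qed.

Lemma cvg_integral_max_slope :
  (fun m : nat => (\int[P]_w (Num.max ((1 + m.+1%:R^-1) * V w) (M w))%:E -
     \int[P]_w (Num.max (1 * V w) (M w))%:E) * m.+1%:R%:E) @ \oo -->
  \int[P]_w (if (M w <= V w)%R then V w else 0%R)%:E.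
Proof.
have m0 (m : nat) : (0 < m.+1%:R :> R)%R by rewrite ltr0n.
have c1 (m : nat) : (1 <= 1 + m.+1%:R^-1 :> R)%R by rewrite lerDl invr_ge0 ltW.
rewrite (_ : (fun m => _) = fun m => \int[P]_w
  ((Num.max ((1 + m.+1%:R^-1) * V w) (M w) - Num.max (V w) (M w)) * m.+1%:R)%:E).
  have h1 (m : nat) : measurable_fun setT (fun w =>
     ((Num.max ((1 + m.+1%:R^-1) * V w) (M w) - Num.max (V w) (M w)) * m.+1%:R)%:E).
    apply/measurable_EFinP; apply: measurable_funM => //.
    apply: measurable_funB; apply: measurable_maxr => //.
    exact: measurable_funM.
  have h2 : measurable_fun setT (fun w => (if (M w <= V w)%R then V w else 0%R)%:E).
    apply/measurable_EFinP; apply: measurable_fun_ifT => //.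
    exact: measurable_fun_ler.
  have h3 : {ae P, forall w, setT w ->
      ((Num.max ((1 + m.+1%:R^-1) * V w) (M w) - Num.max (V w) (M w)) * m.+1%:R)%:E
      @[m --> \oo] --> (if (M w <= V w)%R then V w else 0%R)%:E}.
    apply: aeW => w _; apply: cvg_EFin; first exact: nearW.
    exact: cvg_max_slope.
  have h5 : {ae P, forall w (m : nat), setT w -> `|(((Num.max ((1 + m.+1%:R^-1) * V w)
      (M w) - Num.max (V w) (M w)) * m.+1%:R)%:E)| <= (EFin \o V) w}.
    apply: aeW => w m _.
    have /andP[b0 b1] := max_slope_bounds (M w) (V0 w) (m0 m).
    by rewrite gee0_abs lee_fin.
  by have [] := dominated_convergence measurableT h1 h2 h3 iV h5.
apply/funext => m.
have i1 := integrable_max (c1 m); have i2 := integrable_max (lexx 1%R).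
rewrite -integralB//.
have i12 : P.-integrable setT (fun w => (Num.max ((1 + m.+1%:R^-1) * V w) (M w))%:E -
    (Num.max (1 * V w) (M w))%:E) by exact: integrableB.
rewrite muleC -integralZl//; apply: eq_integral => w _.
by rewrite muleC mul1r -EFinB -EFinM.
Qed.

End slope.

End max_expectations.

Section score_algebra.
Context {R : realType}.

Definition sum_score n (x u : 'I_n -> \bar R) : \bar R :=
  \sum_(j < n) expeR (u j - x j).

Definition score_ratio n (x u : 'I_n -> \bar R) : \bar R :=
  (fine (score x u) / fine (sum_score x u))%:E.

Lemma score_fin_num n (x u : 'I_n -> \bar R) : (forall j, x j != -oo) ->
  (forall j, u j != +oo) -> score x u \is a fin_num.
Proof. by move=> xNy uy; rewrite ge0_fin_numE ?score_ge0// score_lty. Qed.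

Lemma expeR_fin_num (y : \bar R) : y != +oo -> expeR y \is a fin_num.
Proof. by case: y. Qed.

Lemma sube_neq_y (y z : \bar R) : y != +oo -> z != -oo -> y - z != +oo.
Proof. by case: y z => [y| |] [z| |]. Qed.

Lemma sum_score_fin_num n (x u : 'I_n -> \bar R) : (forall j, x j != -oo) ->
  (forall j, u j != +oo) -> sum_score x u \is a fin_num.
Proof.
move=> xNy uy; apply/sum_fin_numP => j _ _.
by apply: expeR_fin_num; exact: sube_neq_y.
Qed.

Lemma score_ratio_ge0 n (x u : 'I_n -> \bar R) : 0 <= score_ratio x u.
Proof.
rewrite lee_fin divr_ge0// fine_ge0 ?score_ge0//.
by apply: sume_ge0 => j _; exact: expeR_ge0.
Qed.

Lemma expeR_subB (y z x : \bar R) : z \is a fin_num ->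
  expeR (y - z - x) = expeR (- z) * expeR (y - x).
Proof. by move=> zf; rewrite -expeRD addeAC addeC. Qed.

Lemma scoreB n (x u : 'I_n -> \bar R) (z : \bar R) : z \is a fin_num ->
  score x (fun j => u j - z) = expeR (- z) * score x u.
Proof.
move=> zf; rewrite /score; under eq_bigr do rewrite expeR_subB//.
case: z zf => // r _; have e0 : (0 <= expR (- r))%R by exact: expR_ge0.
elim: (index_enum _) => [|j s ih]; first by rewrite !big_nil mule0.
by rewrite !big_cons ih/= maxe_pMr.
Qed.

Lemma sum_scoreB n (x u : 'I_n -> \bar R) (z : \bar R) : z \is a fin_num ->
  sum_score x (fun j => u j - z) = expeR (- z) * sum_score x u.
Proof.
move=> zf; rewrite /sum_score; under eq_bigr do rewrite expeR_subB//.
by rewrite ge0_sume_distrr// => j _; exact: expeR_ge0.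
Qed.

Lemma score_ratioB n (x u : 'I_n -> \bar R) (z : \bar R) : z \is a fin_num ->
  (forall j, x j != -oo) -> (forall j, u j != +oo) ->
  score_ratio x (fun j => u j - z) = score_ratio x u.
Proof.
move=> zf xNy uy; rewrite /score_ratio scoreB// sum_scoreB//.
rewrite !fineM ?score_fin_num ?sum_score_fin_num//; last 2 first.
  by case: z zf.
  by case: z zf.
case: z zf => // r _ /=; congr (_%:E).
by rewrite -mulf_div divff ?mul1r// gt_eqF// expR_gt0.
Qed.

(** The maximum is a sum of products of exp (u i) and of a functional of the
    differences u j - u i, to which a change of measure applies. *)
Lemma score_decomposition n (x u : 'I_n -> \bar R) :
  (forall j, x j != -oo) -> (forall j, u j != +oo) ->
  score x u = \sum_(i < n) expeR (- x i) *
    (expeR (u i) * score_ratio x (fun j => u j - u i)).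
Proof.
move=> xNy uy.
have ratioE i : expeR (u i) * score_ratio x (fun j => u j - u i) =
    expeR (u i) * score_ratio x u.
  case ui : (u i) (uy i) => [r| |]// _; last by rewrite /= !mul0e.
  by rewrite score_ratioB.
transitivity (sum_score x u * score_ratio x u); last first.
  rewrite /sum_score ge0_sume_distrl; last by move=> j _; exact: expeR_ge0.
  by apply: eq_bigr => i _; rewrite ratioE muleA -expeRD addeC.
have sf := sum_score_fin_num xNy uy; have mf := score_fin_num xNy uy.
rewrite /score_ratio -(fineK sf) -EFinM/=.
have [s0|s0] := eqVneq (fine (sum_score x u)) 0%R; last first.
  by rewrite mulrCA divff// mulr1 fineK.
rewrite s0 mul0r; apply/eqP; rewrite eq_le score_ge0 andbT.
by rewrite (le_trans (score_le_sum _ _))// -/(sum_score _ _) -(fineK sf) s0.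
Qed.

Lemma measurable_score_ratio n (x : 'I_n -> \bar R) :
  measurable_fun setT (fun y : n.-tuple (\bar R) => score_ratio x (tnth y)).
Proof.
apply/measurable_EFinP; apply: measurable_funM.
  apply: measurableT_comp => //; apply: measurable_score => j.
  exact: measurable_tnth.
rewrite (_ : (fun y => _) = fun y : n.-tuple (\bar R) =>
    (fine (sum_score x (tnth y)) `^ (-1))%R); last first.
  apply/funext => y; rewrite powR_inv1// fine_ge0//.
  by apply: sume_ge0 => j _; exact: expeR_ge0.
apply: (measurableT_comp (measurable_powR _)).
apply: measurableT_comp => //; apply: emeasurable_sum => j.
apply: (measurableT_comp measurable_expeR); apply: emeasurable_funB => //.
exact: measurable_tnth.
Qed.

End score_algebra.

Section score_invariance.
Context (R : realType) (T : zmodType).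
Context d (Omega : measurableType d) (P : probability Omega R).
Variable Z : T -> Omega -> \bar R.
Hypothesis procZ : process Z.
Hypothesis expZ : forall t, \int[P]_w expeR (Z t w) = 1.

Let mZ t : measurable_fun setT (Z t). Proof. by case: procZ. Qed.
Let Zy t w : Z t w != +oo. Proof. by case: procZ. Qed.

Let mexpZ t : measurable_fun setT (fun w => expeR (Z t w)).
Proof. exact: measurable_expZ. Qed.

Let expZ0 t w : 0 <= expeR (Z t w). Proof. exact: expeR_ge0. Qed.

Definition expected_score n (s : n.-tuple T) (x : 'I_n -> \bar R) : \bar R :=
  \int[P]_w score x (fun j => Z (tnth s j) w).

Definition score_stationary : Prop :=
  forall (h : T) n (s : n.-tuple T) (x : 'I_n -> \bar R),
    (forall j, x j != -oo) ->
    expected_score s x = \int[P]_w score x (fun j => Lshift h Z (tnth s j) w).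

Definition tilt_stationary : Prop :=
  forall a h : T, fdd_eq (tilt P Z (a + h)%R) (Xi (a + h)%R Z)
                         (tilt P Z a) (Lshift h (Xi a Z)).

Lemma score_integrable n (u : 'I_n -> T) (x : 'I_n -> \bar R) :
  (forall j, x j != -oo) -> \int[P]_w score x (fun j => Z (u j) w) < +oo.
Proof.
move=> xNy.
have m1 j : measurable_fun setT (fun w => expeR (Z (u j) w - x j)).
  apply: (measurableT_comp measurable_expeR); exact: emeasurable_funB.
apply: (@le_lt_trans _ _ (\int[P]_w \sum_(j < n) expeR (Z (u j) w - x j))).
  apply: ge0_le_integral => //.
  - by move=> w _; exact: score_ge0.
  - exact: measurable_score.
  - exact: emeasurable_sum.
  - by move=> w _; exact: score_le_sum.
rewrite ge0_integral_sum//; last by move=> j w _; exact: expeR_ge0.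
apply: lte_sum_pinfty => j _.
rewrite (eq_integral (fun w => expeR (- x j) * expeR (Z (u j) w))); last first.
  by move=> w _; rewrite -expeRD addeC.
have : x j != -oo by [].
case: (x j) => [r| |]// _ /=.
  by rewrite ge0_integralZl_EFin ?expR_ge0// expZ mule1 ltry.
by under eq_integral do rewrite mul0e; rewrite integral0.
Qed.

Local Notation tilted := (tilted_law procZ expZ).

Lemma measurable_Xi b t : measurable_fun setT (Xi b Z t).
Proof. exact: emeasurable_funB. Qed.

Lemma tilt_integral a h n (s : n.-tuple T) (phi : n.-tuple (\bar R) -> \bar R) :
  tilt_stationary -> measurable_fun setT phi -> (forall y, 0 <= phi y) ->
  \int[P]_w (expeR (Z (a + h)%R w) * phi (values s (Xi (a + h)%R Z) w)) =
  \int[P]_w (expeR (Z a w) * phi (values s (Lshift h (Xi a Z)) w)).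
Proof.
move=> statZ mphi phi0.
have mXi1 := measurable_Xi (a + h)%R.
have mXi2 t : measurable_fun setT (Lshift h (Xi a Z) t) by exact: measurable_Xi.
rewrite -(integral_tilted_law procZ expZ (a + h)%R
  (g := fun w => phi (values s (Xi (a + h)%R Z) w)))//; last first.
  by apply: (measurableT_comp mphi); exact: measurable_values.
rewrite -(integral_tilted_law procZ expZ a
  (g := fun w => phi (values s (Lshift h (Xi a Z)) w)))//; last first.
  by apply: (measurableT_comp mphi); exact: measurable_values.
apply: (fdd_eq_integral (mu1 := tilted (a + h)%R)
  (mu2 := tilted a)) => //.
exact: statZ.
Qed.

(** Each term in the decomposition of the score is the expectation, under a tilt, of
    a function of the centred process. *)
Theorem tilt_score_stationary : tilt_stationary -> score_stationary.
Proof.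
move=> statZ h n s x xNy.
have decomp (u : T -> T) : \int[P]_w score x (fun j => Z (u (tnth s j)) w) =
    \sum_(i < n) expeR (- x i) * \int[P]_w (expeR (Z (u (tnth s i)) w) *
      score_ratio x (tnth (values s (fun t w' => Z (u t) w' - Z (u (tnth s i)) w') w))).
  have mr i : measurable_fun setT (fun w => expeR (Z (u (tnth s i)) w) *
      score_ratio x (tnth (values s (fun t w' => Z (u t) w' - Z (u (tnth s i)) w') w))).
    apply: emeasurable_funM => //.
    apply: (measurableT_comp (measurable_score_ratio x)).
    by apply: measurable_values => t; exact: emeasurable_funB.
  have r0 i w : 0 <= expeR (Z (u (tnth s i)) w) *
      score_ratio x (tnth (values s (fun t w' => Z (u t) w' - Z (u (tnth s i)) w') w)).
    by rewrite mule_ge0// ?score_ratio_ge0// expeR_ge0.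
  transitivity (\int[P]_w \sum_(i < n) expeR (- x i) *
      (expeR (Z (u (tnth s i)) w) *
      score_ratio x (tnth (values s (fun t w' => Z (u t) w' - Z (u (tnth s i)) w') w)))).
    apply: eq_integral => w _; rewrite score_decomposition//.
    apply: eq_bigr => i _; do 2 congr (_ * _).
    by congr score_ratio; apply/funext => j; rewrite tnth_mktuple.
  rewrite ge0_integral_sum//; last 2 first.
  - by move=> i; exact: emeasurable_funM.
  - by move=> i w _; rewrite mule_ge0// expeR_ge0.
  apply: eq_bigr => i _; have := xNy i; case: (x i) => [r| |]// _ /=.
    by rewrite ge0_integralZl_EFin ?expR_ge0.
  by under eq_integral do rewrite mul0e; rewrite integral0 mul0e.
rewrite /expected_score (decomp id) /Lshift (decomp (fun t => t - h)%R).
apply: eq_bigr => i _; congr (_ * _).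
have := @tilt_integral (tnth s i - h)%R h n s (score_ratio x \o @tnth _ _) statZ
  (measurable_score_ratio x) (fun=> score_ratio_ge0 _ _).
by rewrite subrK.
Qed.

(** The form under which slopes of expected maxima produce tilted probabilities *)
Lemma tilt_orthant n b (u : 'I_n -> T) (x : 'I_n -> \bar R) :
  (forall j, x j != -oo) ->
  tilt P Z b [set w | forall j, Z (u j) w - Z b w <= x j] =
  \int[P]_w (if (fine (score x (fun j => Z (u j) w)) <= fine (expeR (Z b w)))%R
             then fine (expeR (Z b w)) else 0%R)%:E.
Proof.
move=> xNy; rewrite /tilt integral_mkcond; apply: eq_integral => w _.
rewrite patchE; have := Zy b w; case zb : (Z b w) => [r| |]//= _; last first.
  by case: ifP; case: ifP.
have scoreP : (forall j, Z (u j) w - r%:E <= x j) <->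
    (fine (score x (fun j => Z (u j) w)) <= expR r)%R.
  rewrite -lee_fin fineK ?score_fin_num// -{2}(opprK r).
  split => [ux|/le_score ux j].
    by apply/le_score => // j; rewrite EFinN addeC; exact: ux.
  by rewrite addeC -EFinN; exact: ux.
case: ifPn => [/set_mem wP|/negP wP].
  by rewrite ifT//; apply/scoreP => j; have := wP j; rewrite zb.
rewrite ifF//; apply/negP => /scoreP wP'; apply: wP; apply/mem_set => j /=.
by rewrite zb.
Qed.

(** The maximum of c exp (Z b) and of a score is a score of a longer tuple; its
    expectation is thus invariant under shifts, and so is its slope at c = 1. *)
Theorem score_tilt_stationary : score_stationary -> tilt_stationary.
Proof.
move=> statZ a h.
apply: (fdd_eq_orthants (mu1 := tilted (a + h)%R) (mu2 := tilted a)).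
- by move=> t; exact: measurable_Xi.
- by move=> t; exact: measurable_Xi.
- by rewrite [X in X < _]probability_setT ltry.
move=> n s x xNy.
rewrite -[LHS]/(tilt P Z (a + h)%R [set w | forall j, Xi _ Z (tnth s j) w <= x j]).
rewrite -[RHS]/(tilt P Z a
  [set w | forall j, Z (tnth s j - h)%R w - Z a w <= x j]).
rewrite (tilt_orthant _ (tnth s))// (tilt_orthant _ (fun j => tnth s j - h)%R)//.
pose V b w := fine (expeR (Z b w)).
pose M (u : T -> T) w := fine (score x (fun j => Z (u (tnth s j)) w)).
have VE b w : (V b w)%:E = expeR (Z b w) by rewrite fineK// expeR_fin_num.
have ME u w : (M u w)%:E = score x (fun j => Z (u (tnth s j)) w).
  by rewrite fineK// score_fin_num.
have mV b : measurable_fun setT (V b) by exact: measurableT_comp.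
have mM u : measurable_fun setT (M u).
  by apply: measurableT_comp => //; exact: measurable_score.
have V0 b w : (0 <= V b w)%R by rewrite fine_ge0// expeR_ge0.
have M0 u w : (0 <= M u w)%R by rewrite fine_ge0// score_ge0.
have intV b : \int[P]_w (V b w)%:E < +oo.
  by under eq_integral do rewrite VE; rewrite expZ ltry.
have intM u : \int[P]_w (M u w)%:E < +oo.
  by under eq_integral do rewrite ME; exact: score_integrable.
(* the score of a longer tuple, with bound - ln c at the time of the tilt *)
have maxE (c : R) : (0 < c)%R ->
    \int[P]_w (Num.max (c * V (a + h)%R w) (M id w))%:E =
    \int[P]_w (Num.max (c * V a w) (M (fun t => t - h)%R w))%:E.
  move=> c0.
  pose x' (j : 'I_n.+1) := if unlift ord0 j is Some i then x i else (- ln c)%:E.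
  have x'Ny j : x' j != -oo by rewrite /x'; case: unliftP.
  have := statZ h n.+1 [tuple of (a + h)%R :: s] x' x'Ny.
  have scoreE (u : T -> T) w :
      score x' (fun j => Z (u (tnth [tuple of (a + h)%R :: s] j)) w) =
      (Num.max (c * V (u (a + h)%R) w) (M u w))%:E.
    rewrite /score big_ord_recl EFin_max EFinM VE ME; congr maxe.
      rewrite /x' unlift_none tnth0 -{2}(lnK c0) -[X in X * _]/(expeR (ln c)%:E).
      by rewrite -expeRD EFinN oppeK addeC.
    by apply: eq_bigr => i _; rewrite /x' liftK tnthS.
  rewrite /expected_score /Lshift.
  under eq_integral do rewrite (scoreE id).
  under [RHS]eq_integral do rewrite (scoreE (fun t => t - h)%R).
  by rewrite addrK.
have c1 := cvg_integral_max_slope (mV (a + h)%R) (mM id) (V0 _) (M0 _) (intV _)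
  (intM _).
have c2 := cvg_integral_max_slope (mV a) (mM (fun t => t - h)%R) (V0 _) (M0 _)
  (intV _) (intM _).
have E : (fun m : nat =>
  (\int[P]_w (Num.max ((1 + m.+1%:R^-1) * V (a + h)%R w) (M id w))%:E -
   \int[P]_w (Num.max (1 * V (a + h)%R w) (M id w))%:E) * m.+1%:R%:E) =
  fun m : nat =>
  (\int[P]_w (Num.max ((1 + m.+1%:R^-1) * V a w) (M (fun t => t - h)%R w))%:E -
   \int[P]_w (Num.max (1 * V a w) (M (fun t => t - h)%R w))%:E) * m.+1%:R%:E.
  apply/funext => m.
  have m0 : (0 < 1 + m.+1%:R^-1 :> R)%R by rewrite addr_gt0// invr_gt0 ltr0n.
  by rewrite (maxE _ m0) (maxE _ ltr01).
rewrite E in c1; exact: (cvg_unique _ c1 c2).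
Qed.

End score_invariance.

(** * Comparison of max-stable processes, and laws of paths *)

Section max_stable_comparison.
Context (R : realType) (I : Type).
Context d1 (Omega1 : measurableType d1) (P1 : probability Omega1 R).
Context d2 (Omega2 : measurableType d2) (P2 : probability Omega2 R).
Context e1 (Theta1 : measurableType e1) (Q1 : probability Theta1 R).
Context e2 (Theta2 : measurableType e2) (Q2 : probability Theta2 R).
Variables (zeta1 : I -> Omega1 -> \bar R) (Z1 : I -> Theta1 -> \bar R).
Variables (zeta2 : I -> Omega2 -> \bar R) (Z2 : I -> Theta2 -> \bar R).
Hypotheses (procZ1 : process Z1) (procZ2 : process Z2).
Hypothesis max_stable1 : max_stable P1 zeta1 Q1 Z1.
Hypothesis max_stable2 : max_stable P2 zeta2 Q2 Z2.
Let score1 n (s : n.-tuple I) x := \int[Q1]_w score x (fun j => Z1 (tnth s j) w).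
Let score2 n (s : n.-tuple I) x := \int[Q2]_w score x (fun j => Z2 (tnth s j) w).
Hypothesis score1_fin : forall n (s : n.-tuple I) x,
  (forall j, x j != -oo) -> score1 s x < +oo.
Hypothesis score2_fin : forall n (s : n.-tuple I) x,
  (forall j, x j != -oo) -> score2 s x < +oo.

(** The distribution functions of max-stable processes are the exponentials of
    minus the expected scores, so either family determines the other. *)
Theorem max_stable_fdd_eq : fdd_eq P1 zeta1 P2 zeta2 <->
  forall n (s : n.-tuple I) x, (forall j, x j != -oo) -> score1 s x = score2 s x.
Proof.
have fin1 n s x : (forall j, x j != -oo) -> @score1 n s x \is a fin_num.
  by move=> xNy; rewrite ge0_fin_numE ?score1_fin// integral_ge0// => w _;
    exact: score_ge0.
have fin2 n s x : (forall j, x j != -oo) -> @score2 n s x \is a fin_num.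
  by move=> xNy; rewrite ge0_fin_numE ?score2_fin// integral_ge0// => w _;
    exact: score_ge0.
split => [eqz n s x xNy|eqs].
  have := eqz n s (orthant x) (measurable_orthant x); rewrite /fdd.
  have E d (Omega : measurableType d) (zeta : I -> Omega -> \bar R) :
      [set w | orthant x [tuple zeta (tnth s j) w | j < n]] =
      [set w | forall j, zeta (tnth s j) w <= x j].
    apply/seteqP; split => w wx j; first by have := wx j; rewrite tnth_mktuple.
    by rewrite tnth_mktuple; exact: wx.
  rewrite !E (max_stable_orthant procZ1 max_stable1)//; last exact: score1_fin.
  rewrite (max_stable_orthant procZ2 max_stable2)//; last exact: score2_fin.
  move=> [/expR_inj/oppr_inj]; rewrite -/(score1 s x) -/(score2 s x) => e.
  by rewrite -[LHS]fineK ?fin1// e fineK// fin2.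
apply: fdd_eq_orthants => [t|t||n s x xNy].
- exact: (max_stable_measurable max_stable1).
- exact: (max_stable_measurable max_stable2).
- by rewrite [X in X < _]probability_setT ltry.
apply: (etrans (max_stable_orthant procZ1 max_stable1 xNy (score1_fin s xNy))).
apply/esym.
apply: (etrans (max_stable_orthant procZ2 max_stable2 xNy (score2_fin s xNy))).
by rewrite -/(score1 s x) -/(score2 s x) eqs.
Qed.

End max_stable_comparison.

Section path_space.
Context (R : realType) (I : choiceType).

Definition evaluations : set (set (I -> \bar R)) :=
  \bigcup_t preimage_set_system setT (fun f : I -> \bar R => f t) measurable.

Definition path : Type := g_sigma_algebraType evaluations.
HB.instance Definition _ := Measurable.copy path (g_sigma_algebraType evaluations).

Lemma measurable_evaluation t : measurable_fun [set: path] (fun f : path => f t).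
Proof.
move=> _ B mB; rewrite setTI; apply: sub_sigma_algebra.
by exists t => //; exists B => //; rewrite setTI.
Qed.

Lemma measurable_to_path d (Omega : measurableType d) (Y : I -> Omega -> \bar R) :
  (forall t, measurable_fun setT (Y t)) ->
  measurable_fun [set: Omega] (fun w => (Y ^~ w : path)).
Proof.
move=> mY; apply: (@measurability _ _ Omega path setT (fun w => Y ^~ w) evaluations erefl).
move=> _ [_ [t _ [B mB <-]] <-].
by have := mY t measurableT B mB; rewrite !setTI.
Qed.

Lemma Fminf_measurableE (A : set (I -> \bar R)) :
  Fminf_measurable A <-> exists2 C : set path, measurable C & Fminf R I `&` C = A.
Proof.
rewrite /Fminf_measurable.
rewrite (_ : \bigcup_t _ = preimage_set_system (Fminf R I) id evaluations).
  by rewrite g_sigma_preimageE; split => -[C mC <-]; exists C.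
apply/seteqP; split => [_ [t _ [B mB <-]]|_ [_ [t _ [B mB <-]] <-]].
  exists ((fun f : I -> \bar R => f t) @^-1` B) => //.
  by exists t => //; exists B => //; rewrite setTI.
by exists t => //; exists B => //; rewrite setTI.
Qed.

(** Paths below finitely many bounds: the counterpart of orthants *)
Definition below (l : seq (I * \bar R)) : set path :=
  [set f | forall p, p \in l -> f p.1 <= p.2].

Lemma below_generate : @measurable _ path = <<s range below >>.
Proof.
have mbelow l : measurable (below l).
  rewrite (_ : below l = \bigcap_(p in [set` l]) [set f | f p.1 <= p.2])//.
  rewrite bigcap_seq; apply: bigsetI_measurable => p _.
  rewrite -[X in measurable X]setTI; apply: measurable_lee => //.
  exact: measurable_evaluation.
apply/seteqP; split; last first.
  apply: smallest_sub; first exact: sigma_algebra_measurable.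
  by move=> _ [l _ <-].
apply: smallest_sub; first exact: smallest_sigma_algebra.
move=> A [t _].
suff mt : measurable_fun [set: g_sigma_algebraType (range below)]
    (fun f => (f : I -> \bar R) t).
  by move=> [B mB <-]; exact: (mt measurableT B mB).
move=> mT; apply: (measurability _ (ErealGenOInfty.measurableE R)) => //.
move=> _ [_ [r ->] <-]; rewrite setTI.
rewrite (_ : _ @^-1` _ = ~` below [:: (t, r%:E)]).
  by apply: measurableC; apply: sub_sigma_algebra; exists [:: (t, r%:E)].
apply/seteqP; split => f /=; rewrite in_itv/= andbT.
  by move=> rf /(_ (t, r%:E)); rewrite mem_head leNgt rf => /(_ erefl).
rewrite ltNge => fP; apply/negP => fr; apply: fP => p.
by rewrite inE => /eqP ->.
Qed.

(** The sets of paths below finitely many bounds are stable under intersection and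
    generate the sigma-algebra. *)
Lemma fdd_eq_path d1 d2 (Omega1 : measurableType d1) (Omega2 : measurableType d2)
    (mu1 : {measure set Omega1 -> \bar R}) (mu2 : {measure set Omega2 -> \bar R})
    (Y1 : I -> Omega1 -> \bar R) (Y2 : I -> Omega2 -> \bar R) (C : set path) :
  (forall t, measurable_fun setT (Y1 t)) ->
  (forall t, measurable_fun setT (Y2 t)) ->
  mu1 setT < +oo -> fdd_eq mu1 Y1 mu2 Y2 -> measurable C ->
  mu1 [set w | C (Y1 ^~ w)] = mu2 [set w | C (Y2 ^~ w)].
Proof.
move=> mY1 mY2 mu1T Y12 mC.
pose m1 := image_measure mu1 (measurable_to_path mY1).
pose m2 := image_measure mu2 (measurable_to_path mY2).
rewrite -[LHS]/(m1 C) -[RHS]/(m2 C).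
apply: (measure_unique (range below) (fun=> setT)) => //.
- exact: below_generate.
- move=> _ _ [k _ <-] [l _ <-]; exists (k ++ l) => //.
  apply/seteqP; split => f /= fP.
    by split=> p pl; apply: fP; rewrite mem_cat pl ?orbT.
  by move=> p; rewrite mem_cat => /orP[|] pl; [exact: fP.1|exact: fP.2].
- by move=> _; exists [::] => //; apply/seteqP; split.
- by rewrite bigcup_const//; exists 0%N.
- move=> _ [l _ <-].
  have E d (Omega : measurableType d) (Y : I -> Omega -> \bar R) :
      [set w | below l (Y ^~ w)] = [set w | orthant (fun j => (tnth (in_tuple l) j).2)
        [tuple Y (tnth [tuple of [seq p.1 | p <- in_tuple l]] j) w | j < size l]].
    apply/seteqP; split => w wx.
      by move=> j; rewrite tnth_mktuple tnth_map; apply: wx; exact: mem_tnth.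
    move=> p /(tnthP (in_tuple l))[j ->]; have := wx j.
    by rewrite tnth_mktuple tnth_map.
  rewrite -[LHS]/(mu1 [set w | below l (Y1 ^~ w)]).
  rewrite -[RHS]/(mu2 [set w | below l (Y2 ^~ w)]) !E.
  by apply: Y12; exact: measurable_orthant.
Qed.

End path_space.

(** * Functionals invariant under the addition of constants *)

Section shift_invariant_functionals.
Context (R : realType) (T : zmodType).
Context d (Omega : measurableType d) (P : probability Omega R).
Variable Z : T -> Omega -> \bar R.
Hypothesis procZ : process Z.
Hypothesis expZ : forall t, \int[P]_w expeR (Z t w) = 1.

Let mZ t : measurable_fun setT (Z t). Proof. by case: procZ. Qed.
Let Zy t w : Z t w != +oo. Proof. by case: procZ. Qed.
Let mexpZ t : measurable_fun setT (fun w => expeR (Z t w)).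
Proof. exact: measurable_expZ. Qed.

Let expZ0 t w : 0 <= expeR (Z t w). Proof. exact: expeR_ge0. Qed.

Local Notation tilted := (tilted_law procZ expZ).

Definition functional_stationary : Prop :=
  forall Gamma : (T -> \bar R) -> R,
    (forall f, Fminf R T f -> (0 <= Gamma f)%R) ->
    (forall B, measurable B -> Fminf_measurable (Fminf R T `&` Gamma @^-1` B)) ->
    (forall f c, Fminf R T f -> Gamma (fun t => f t + c%:E) = Gamma f) ->
    forall a h : T,
      has_expectation P
        (fun w => expeR (Z (a + h)%R w) * (Gamma (Z ^~ w))%:E) ->
      has_expectation P
        (fun w => expeR (Z a w) * (Gamma (Lshift h (Z ^~ w)))%:E) ->
      \int[P]_w (expeR (Z (a + h)%R w) * (Gamma (Z ^~ w))%:E) =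
      \int[P]_w (expeR (Z a w) * (Gamma (Lshift h (Z ^~ w)))%:E).

(** Gamma is only constrained on paths that are not identically -oo. Where Z b is
    -oo, which the tilt at b does not charge, its value is replaced by 0. *)
Let tilted_value (Gamma : (T -> \bar R) -> R) (b : T) (Y : T -> Omega -> \bar R)
  (w : Omega) : R := if Z b w == -oo then 0%R else Gamma (Y ^~ w).

(** Invariance of Gamma under the addition of - Z b w expresses its value through
    the centred path, to which one set C applies for all tilts. *)
Lemma tilted_value_preimage (Gamma : (T -> \bar R) -> R) B :
  (forall B, measurable B -> Fminf_measurable (Fminf R T `&` Gamma @^-1` B)) ->
  (forall f c, Fminf R T f -> Gamma (fun t => f t + c%:E) = Gamma f) ->
  measurable B -> exists2 C : set (path R T), measurable C &
    forall b t0 (u : T -> T) w, u t0 = b -> Z b w != -oo ->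
      (B (Gamma (fun t => Z (u t) w)) <-> C (fun t => Z (u t) w - Z b w)).
Proof.
move=> mGamma shiftGamma mB.
have /Fminf_measurableE[C mC CB] := mGamma B mB.
exists C => // b t0 u w ut0 Zb.
have Zbf : Z b w \is a fin_num by rewrite fin_numE Zb Zy.
have Yin : Fminf R T (fun t => Z (u t) w - Z b w).
  split=> [t|]; first exact: sube_neq_y.
  by exists t0; rewrite ut0 subee.
have GammaE : Gamma (fun t => Z (u t) w) = Gamma (fun t => Z (u t) w - Z b w).
  rewrite -(shiftGamma _ (fine (Z b w)) Yin); congr Gamma; apply/funext => t.
  by rewrite fineK// subeK.
have -> : C (fun t => Z (u t) w - Z b w) =
    (Fminf R T `&` C) (fun t => Z (u t) w - Z b w).
  by apply/propext; split => [|[]].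
by rewrite CB GammaE; split => [|[]].
Qed.

Lemma tilted_law_eq b (A A' : set Omega) :
  (forall w, Z b w != -oo -> A w <-> A' w) -> tilted b A = tilted b A'.
Proof.
move=> AA'; rewrite -[LHS]/(tilt P Z b A) -[RHS]/(tilt P Z b A') /tilt.
rewrite [LHS]integral_mkcond [RHS]integral_mkcond; apply: eq_integral => w _; rewrite !patchE.
have [->/=|Zb] := eqVneq (Z b w) -oo; first by case: ifP; case: ifP.
suff -> : (w \in A) = (w \in A') by [].
by apply/idP/idP => /set_mem/(AA' w Zb)/mem_set.
Qed.

Lemma integral_tilted_value (Gamma : (T -> \bar R) -> R) b t0 (u : T -> T) :
  u t0 = b ->
  (forall f, Fminf R T f -> (0 <= Gamma f)%R) ->
  (forall B, measurable B -> Fminf_measurable (Fminf R T `&` Gamma @^-1` B)) ->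
  (forall f c, Fminf R T f -> Gamma (fun t => f t + c%:E) = Gamma f) ->
  let V := tilted_value Gamma b (fun t => Z (u t)) in
  [/\ measurable_fun setT V, (forall w, 0 <= V w)%R &
      \int[P]_w (expeR (Z b w) * (Gamma (fun t => Z (u t) w))%:E) =
      \int[tilted b]_w (V w)%:E].
Proof.
move=> ut0 Gamma0 mGamma shiftGamma V.
have mNy : measurable [set w | Z b w = -oo].
  rewrite -[X in measurable X]setTI; apply: measurable_eqe => //.
have mV : measurable_fun setT V.
  move=> _ B mB; rewrite setTI.
  have [C mC /(_ b t0 u _ ut0) CB] := tilted_value_preimage mGamma shiftGamma mB.
  have -> : V @^-1` B = ([set w | Z b w = -oo] `&` [set _ | B 0%R]) `|`
      (~` [set w | Z b w = -oo] `&` [set w | C (fun t => Z (u t) w - Z b w)]).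
    apply/seteqP; split => w; rewrite /V /tilted_value/=.
      case: eqVneq => [Zb B0|Zb]; first by left.
      by move=> /(CB w Zb) Cw; right; split => //; apply/eqP.
    case: eqVneq => [Zb [[]|[]]//|Zb [[/eqP]|[_ Cw]]].
      by rewrite (negbTE Zb).
    exact/(CB w Zb).
  apply: measurableU; apply: measurableI => //.
  - have [B0|B0] := pselect (B 0%R).
      by rewrite (_ : [set _ | _] = setT)//; apply/seteqP; split.
    by rewrite (_ : [set _ | _] = set0)//; apply/seteqP; split.
  - exact: measurableC.
  - have mY t : measurable_fun setT (fun w => Z (u t) w - Z b w).
      exact: emeasurable_funB.
    by have := measurable_to_path mY measurableT mC; rewrite setTI.
have V0 w : (0 <= V w)%R.
  rewrite /V /tilted_value; case: eqVneq => // Zb; apply: Gamma0.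
  by split=> [t|]; [exact: Zy|exists t0; rewrite ut0].
have mEV : measurable_fun setT (fun w => (V w)%:E) by apply/measurable_EFinP.
split=> //; rewrite integral_tilted_law//.
apply: eq_integral => w _; rewrite /V /tilted_value.
by case: eqVneq => // ->; rewrite !mul0e.
Qed.

(** The centred paths under both tilts have the same law on the space of paths. *)
Theorem tilt_functional_stationary :
  tilt_stationary P Z -> functional_stationary.
Proof.
move=> statZ Gamma Gamma0 mGamma shiftGamma a h _ _.
have [mV1 V1_ge0 ->] := @integral_tilted_value Gamma (a + h)%R (a + h)%R id erefl
  Gamma0 mGamma shiftGamma.
have uh : (fun t => t - h)%R (a + h)%R = a by rewrite addrK.
have [mV2 V2_ge0 ->] := @integral_tilted_value Gamma a (a + h)%R
  (fun t => t - h)%R uh Gamma0 mGamma shiftGamma.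
set V1 := tilted_value _ _ _ in mV1 V1_ge0 *.
set V2 := tilted_value _ _ _ in mV2 V2_ge0 *.
have V12 B : measurable B ->
    tilted (a + h)%R (V1 @^-1` B) = tilted a (V2 @^-1` B).
  move=> mB.
  have [C mC CB] := tilted_value_preimage mGamma shiftGamma mB.
  have VC b t0 (u : T -> T) : u t0 = b ->
      tilted b (tilted_value Gamma b (fun t => Z (u t)) @^-1` B) =
      tilted b [set w | C (fun t => Z (u t) w - Z b w)].
    move=> ut0; apply: tilted_law_eq => w Zb.
    rewrite /tilted_value/= (negbTE Zb); exact: (CB b t0 u w ut0 Zb).
  rewrite (VC _ (a + h)%R id)// (VC _ (a + h)%R (fun t => t - h)%R)//.
  apply: (fdd_eq_path (Y1 := Xi (a + h)%R Z) (Y2 := Lshift h (Xi a Z))) => //.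
  - by move=> t; exact: measurable_Xi.
  - by move=> t; exact: measurable_Xi.
  - by rewrite [X in X < _]probability_setT ltry.
  - exact: statZ.
have normE (V : Omega -> R) b : (forall w, 0 <= V w)%R -> forall mV : measurable_fun setT V,
    \int[tilted b]_w (V w)%:E =
    \int[image_measure (tilted b) mV]_y `|y%:E|.
  move=> V0 mV; rewrite integral_image//; last exact: measurableT_comp.
  by apply: eq_integral => w _; rewrite gee0_abs ?lee_fin.
rewrite (normE V1 _ V1_ge0 mV1) (normE V2 _ V2_ge0 mV2).
by apply: eq_measure_integral => B mB _; exact: V12.
Qed.

(** The finite-dimensional events of the centred process are functionals of the path
    that are invariant under the addition of constants. *)
Theorem functional_tilt_stationary :
  functional_stationary -> tilt_stationary P Z.
Proof.
move=> statZ a h n s B mB; rewrite /fdd.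
pose Gamma (f : T -> \bar R) : R := \1_B [tuple f (tnth s j) - f (a + h)%R | j < n].
have mtuple (c : T) (u : T -> T) : measurable_fun [set: path R T]
    (fun f : path R T => [tuple f (u (tnth s j)) - f c | j < n]).
  apply/measurable_fun_tnthP => j.
  rewrite (_ : _ \o _ = fun f : path R T => f (u (tnth s j)) - f c); last first.
    by apply/funext => f /=; rewrite tnth_mktuple.
  by apply: emeasurable_funB; exact: measurable_evaluation.
have mGamma : measurable_fun [set: path R T] Gamma.
  apply: (measurableT_comp (measurable_indic mB)); exact: (mtuple _ id).
have mGammaZ (u : T -> T) :
    measurable_fun setT (fun w => Gamma (fun t => Z (u t) w)).
  exact: (measurableT_comp mGamma (measurable_to_path (fun t => mZ (u t)))).
have hasE b (u : T -> T) : has_expectation P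
    (fun w => expeR (Z b w) * (Gamma (fun t => Z (u t) w))%:E).
  split.
    by apply: emeasurable_funM; [exact: measurable_expZ|exact/measurable_EFinP].
  right; rewrite (eq_integral (cst 0)) ?integral0 ?ltry// => w _.
  rewrite funenegE max_r// oppe_le0 mule_ge0// lee_fin /Gamma indicE.
  by case: (_ \in _).
have intE b (u : T -> T) : u (a + h)%R = b ->
    \int[P]_w (expeR (Z b w) * (Gamma (fun t => Z (u t) w))%:E) =
    tilt P Z b [set w | B [tuple Z (u (tnth s j)) w - Z b w | j < n]].
  move=> <-; rewrite /tilt [RHS]integral_mkcond; apply: eq_integral => w _.
  rewrite patchE /Gamma indicE.
  rewrite (_ : (_ \in [set w0 | _]) =
    ([tuple Z (u (tnth s j)) w - Z (u (a + h)%R) w | j < n] \in B)).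
    by case: (_ \in B); rewrite (mule1, mule0).
  by apply/idP/idP => /set_mem ?; apply/mem_set.
have := statZ Gamma _ _ _ a h (hasE _ id) (hasE a (fun t => t - h)%R).
rewrite (intE _ id erefl) (intE a (fun t => t - h)%R); last by rewrite addrK.
apply.
- by move=> f _; rewrite /Gamma indicE; case: (_ \in _).
- move=> C mC; apply/Fminf_measurableE; exists (Gamma @^-1` C) => //.
  by rewrite -[X in measurable X]setTI; exact: mGamma.
- move=> f c [fy _]; rewrite /Gamma; congr (\1_B _).
  apply: eq_mktuple => j.
  case: (f (tnth s j)) (fy (tnth s j)) => [x| |]//.
  all: case: (f (a + h)%R) (fy (a + h)%R) => [y| |]// _ _.
  by rewrite -!EFinD; congr (_%:E); ring.
Qed.

End shift_invariant_functionals.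

(** * Moments of bounded variables *)

Section threshold_polynomials.
Context {R : realType}.
Implicit Types (u t th z : R).

Lemma Bernoulli_ineq z n : (-1 <= z)%R -> (1 + n%:R * z <= (1 + z) ^+ n)%R.
Proof.
move=> z1; elim: n => [|n ih]; first by rewrite mul0r addr0 expr0.
rewrite exprS; apply: (@le_trans _ _ ((1 + z) * (1 + n%:R * z))%R).
  have : (0 <= n%:R * z ^+ 2)%R by rewrite mulr_ge0// sqr_ge0.
  rewrite -natr1; nra.
by rewrite ler_wpM2l//; lra.
Qed.

Lemma cvg_mulrn_expr z : (0 <= z < 1)%R ->
  (fun n : nat => n%:R * z ^+ n)%R @ \oo --> (0 : R)%R.
Proof.
move=> /andP[z0 z1]; have [->|zn0] := eqVneq z 0%R.
  apply: cvg_near_cst; exists 1%N => // -[//|n] _.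
  by rewrite expr0n mulr0.
have zgt0 : (0 < z)%R by rewrite lt_neqAle eq_sym zn0.
pose t := Num.sqrt z; have tt : (t ^+ 2 = z)%R by rewrite sqr_sqrtr.
have t0 : (0 < t)%R by rewrite sqrtr_gt0.
have t1 : (t < 1)%R by rewrite -(@ltr_pXn2r _ 2)// ?nnegrE ?ltW// tt expr1n.
pose c := (t^-1 - 1)%R.
have c0 : (0 < c)%R by rewrite subr_gt0 invf_gt1.
have tn n : (n%:R * t ^+ n <= c^-1)%R.
  have c1 : (1 + c = t^-1)%R by rewrite /c addrC subrK.
  have := @Bernoulli_ineq c n; rewrite c1 exprVn => h.
  have {}h : (n%:R * c <= (t ^+ n)^-1)%R.
    by apply: le_trans (h _); [rewrite lerDr ler01|lra].
  have tn0 : (0 < t ^+ n)%R by rewrite exprn_gt0.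
  rewrite -(ler_pM2r c0) mulVf ?gt_eqF// mulrAC.
  apply: le_trans (ler_wpM2r (ltW tn0) h) _.
  by rewrite mulVf ?lt0r_neq0.
apply: (@squeeze_cvgr _ _ _ _ (fun=> 0%R) (fun n => c^-1 * t ^+ n)%R).
- near=> n; rewrite mulr_ge0//= ?exprn_ge0//.
  by rewrite -tt -exprM mulnC exprM expr2 mulrA ler_wpM2r// exprn_ge0// ltW.
- exact: cvg_cst.
- rewrite -(mulr0 c^-1%R); apply: cvgM; first exact: cvg_cst.
  by apply: cvg_expr; rewrite ger0_norm// ltW.
Unshelve. all: by end_near. Qed.

Definition threshold_degree th n : nat := Num.truncn (n%:R / th ^+ n).

(** These polynomials in u approximate the indicator function of u < th on the
    unit interval, also at u = th thanks to the factor n in their degree. *)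
Lemma cvg_threshold th u : (0 < th <= 1)%R -> (0 <= u <= 1)%R ->
  (fun n => (1 - u ^+ n) ^+ threshold_degree th n)%R @ \oo --> ((u < th)%R%:R : R).
Proof.
move=> /andP[th0 th1] /andP[u0 u1].
have thn n : (0 < th ^+ n)%R by rewrite exprn_gt0.
have nth0 n : (0 <= n%:R / th ^+ n)%R by rewrite divr_ge0// ltW.
have un n : (0 <= u ^+ n <= 1)%R by rewrite exprn_ge0//= exprn_ile1.
have degle n : ((threshold_degree th n)%:R <= n%:R / th ^+ n)%R by rewrite truncn_le.
have deggt n : (n%:R / th ^+ n < (threshold_degree th n).+1%:R)%R.
  exact: truncnS_gt.
have val01 n : (0 <= (1 - u ^+ n) ^+ threshold_degree th n <= 1)%R.
  have /andP[un0 un1] := un n.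
  by rewrite exprn_ge0 ?subr_ge0//= exprn_ile1 ?subr_ge0// gerBl.
(* below th, Bernoulli's inequality bounds the polynomial from below by
   1 - n (u / th) ^ n; from th on, (1 - x) ^ N <= (1 + x) ^ - N, and the same
   inequality bounds the right-hand side by 1 / n *)
have [uth|thu] := ltP u th.
  apply: (@squeeze_cvgr _ _ _ _ (fun n => 1 - n%:R * (u / th) ^+ n)%R (fun=> 1%R)).
  - near=> n; case/andP: (val01 n) => _ ->; rewrite andbT.
    apply: (@le_trans _ _ (1 + (threshold_degree th n)%:R * - u ^+ n)%R).
      have -> : (n%:R * (u / th) ^+ n = n%:R / th ^+ n * u ^+ n)%R.
        by rewrite expr_div_n mulrA mulrAC.
      by rewrite lerD2l mulrN lerN2 ler_wpM2r// exprn_ge0.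
    by apply: Bernoulli_ineq; rewrite lerN2; case/andP: (un n).
  - rewrite -[X in _ --> X]subr0; apply: cvgB; first exact: cvg_cst.
    apply: cvg_mulrn_expr; rewrite divr_ge0 ?(ltW th0)//=.
    by rewrite ltr_pdivrMr// mul1r.
  - exact: cvg_cst.
apply: (@squeeze_cvgr _ _ _ _ (fun=> 0%R) (fun n => n%:R^-1)%R).
- near=> n; case/andP: (val01 n) => -> _ /=.
  have n0 : (0 < n%:R :> R)%R by rewrite ltr0n; near: n; exists 1%N.
  set N := threshold_degree th n; set x := (u ^+ n)%R.
  have /andP[x0 x1] : (0 <= x <= 1)%R by exact: un.
  have nN : (n%:R <= 1 + N%:R * x)%R.
    have h : (n%:R <= (1 + N%:R) * th ^+ n)%R.
      by rewrite -ler_pdivrMr// addrC natr1 ltW.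
    have thx : (th ^+ n <= x)%R by rewrite lerXn2r ?nnegrE// ltW.
    have th1n : (th ^+ n <= 1)%R by rewrite exprn_ile1// ltW.
    have N0 : (0 <= N%:R :> R)%R by [].
    have : (N%:R * th ^+ n <= N%:R * x)%R by rewrite ler_wpM2l.
    nra.
  rewrite -[leRHS]mul1r ler_pdivlMr//.
  apply: (@le_trans _ _ ((1 - x) ^+ N * (1 + x) ^+ N)%R).
    rewrite ler_wpM2l ?exprn_ge0 ?subr_ge0//.
    by apply: le_trans nN _; apply: Bernoulli_ineq; lra.
  rewrite -exprMn exprn_ile1//; nra.
- exact: cvg_cst.
- by rewrite -cvg_shiftS/=; exact: cvg_harmonic.
Unshelve. all: by end_near. Qed.

End threshold_polynomials.

(** * The law of the integral of a path *)

Section joint_measurability.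
Context (R : realType) dS (S : measurableType dS).
Variables (mu : {sigma_finite_measure set S -> \bar R}) (D : set S).
Context d (Omega : measurableType d) (Y : S -> Omega -> \bar R).
Hypothesis mD : measurable D.
Hypothesis mYD : measurable_paths D Y.
Variables (g : \bar R -> \bar R) (E : set S).
Hypotheses (mg : measurable_fun setT g) (g0 : forall y, 0 <= g y).
Hypotheses (mE : measurable E) (ED : E `<=` D).

Lemma measurable_patched :
  measurable_fun setT (fun x : S * Omega => if x.1 \in E then g (Y x.1 x.2) else 0).
Proof.
have mED : measurable (E `*` [set: Omega]) by exact: measurableX.
have mDD : measurable (D `*` [set: Omega]) by exact: measurableX.
rewrite (_ : (fun x => _) =
    (fun x : S * Omega => g (Y x.1 x.2)) \_ (E `*` [set: Omega])).
  apply/(measurable_restrictT _ mED); apply: (measurableT_comp mg).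
  by apply: (measurable_funS mDD) => // x [Ex _]; split => //; exact: ED.
apply/funext => x; rewrite patchE.
by have -> : (x \in E `*` [set: Omega]) = (x.1 \in E)
  by apply/idP/idP => /set_mem => [[/mem_set]|Ex]//; apply/mem_set.
Qed.

Lemma measurable_patched_section w :
  measurable_fun setT (fun s => if s \in E then g (Y s w) else 0).
Proof.
have mpair : measurable_fun [set: S] (fun s => (s, w)) by exact: measurable_fun_pair.
exact: (measurableT_comp measurable_patched mpair).
Qed.

Definition path_integral (w : Omega) : \bar R := \int[mu]_(s in E) g (Y s w).

Lemma path_integralE w :
  path_integral w = \int[mu]_s (if s \in E then g (Y s w) else 0).
Proof.
rewrite /path_integral integral_mkcond; apply: eq_integral => s _.
by rewrite patchE.
Qed.

Lemma path_integral_ge0 w : 0 <= path_integral w.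
Proof. exact: integral_ge0. Qed.

Lemma measurable_path_integral : measurable_fun setT path_integral.
Proof.
rewrite (_ : path_integral = fun w =>
    \int[mu]_s (if s \in E then g (Y s w) else 0)); last first.
  by apply/funext => w; exact: path_integralE.
have f0 (x : S * Omega) : 0 <= (if x.1 \in E then g (Y x.1 x.2) else 0).
  by case: ifP.
exact: (measurable_fun_fubini_tonelli_G (m1 := mu) _ measurable_patched f0).
Qed.

End joint_measurability.

Section moments.
Context (R : realType) dS (S : measurableType dS).
Variables (mu : {sigma_finite_measure set S -> \bar R}) (D : set S).
Hypothesis mD : measurable D.
Context d1 (Omega1 : measurableType d1) (m1 : probability Omega1 R).
Context d2 (Omega2 : measurableType d2) (m2 : probability Omega2 R).
Variables (Y1 : S -> Omega1 -> \bar R) (Y2 : S -> Omega2 -> \bar R).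
Hypothesis mY1 : forall t, measurable_fun setT (Y1 t).
Hypothesis mY2 : forall t, measurable_fun setT (Y2 t).
Hypotheses (mYD1 : measurable_paths D Y1) (mYD2 : measurable_paths D Y2).
Hypothesis Y12 : fdd_eq m1 Y1 m2 Y2.
Variables (g : \bar R -> \bar R) (E : set S).
Hypotheses (mg : measurable_fun setT g) (g0 : forall y, 0 <= g y).
Hypotheses (mE : measurable E) (ED : E `<=` D).

Lemma measurable_expe d (Omega : measurableType d) (f : Omega -> \bar R) k :
  measurable_fun setT f -> measurable_fun setT (fun w => f w ^+ k).
Proof.
move=> mf; elim: k => [|k ih]; first exact: measurable_cst.
by under eq_fun do rewrite expeS; exact: emeasurable_funM.
Qed.

Lemma moment_step d (Omega : measurableType d) (m : probability Omega R)
    (Y : S -> Omega -> \bar R) (V : Omega -> \bar R) :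
  measurable_paths D Y -> measurable_fun setT V -> (forall w, 0 <= V w) ->
  \int[m]_w (V w * path_integral mu Y g E w) =
  \int[mu]_s (if s \in E then \int[m]_w (V w * g (Y s w)) else 0).
Proof.
move=> mYD mV V0.
have mp := measurable_patched mD mYD mg mE ED.
transitivity (\int[m]_w \int[mu]_s (V w * (if s \in E then g (Y s w) else 0))).
  apply: eq_integral => w _; rewrite path_integralE ge0_integralZl//.
  - exact: (measurable_patched_section mD mYD mg mE ED).
  - by move=> s _; case: ifP.
have f0 (x : S * Omega) : 0 <= V x.2 * (if x.1 \in E then g (Y x.1 x.2) else 0).
  by rewrite mule_ge0//; case: ifP.
rewrite -(fubini_tonelli (m1 := mu) (m2 := m)
  (fun x : S * Omega => V x.2 * (if x.1 \in E then g (Y x.1 x.2) else 0)))//.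
  apply: eq_integral => s _; rewrite /fubini_F/=.
  by case: ifP => // _; under eq_integral do rewrite mule0; rewrite integral0.
apply: emeasurable_funM => //; exact: (measurableT_comp mV measurable_snd).
Qed.

(** A power of the integral of g along the path is an iterated integral over
    times, so its mixed moments only involve finitely many coordinates. *)
Lemma moments_eq k n (s : n.-tuple S) (phi : n.-tuple (\bar R) -> \bar R) :
  measurable_fun setT phi -> (forall y, 0 <= phi y) ->
  \int[m1]_w (phi (values s Y1 w) * path_integral mu Y1 g E w ^+ k) =
  \int[m2]_w (phi (values s Y2 w) * path_integral mu Y2 g E w ^+ k).
Proof.
elim: k n s phi => [|k ih] n s phi mphi phi0.
  under eq_integral do rewrite expe0 mule1.
  under [RHS]eq_integral do rewrite expe0 mule1.
  exact: fdd_eq_integral.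
have stepE d (Omega : measurableType d) (m : probability Omega R)
    (Y : S -> Omega -> \bar R) : (forall t, measurable_fun setT (Y t)) ->
    measurable_paths D Y ->
    \int[m]_w (phi (values s Y w) * path_integral mu Y g E w ^+ k.+1) =
    \int[mu]_t (if t \in E then
      \int[m]_w (phi (values s Y w) * g (Y t w) * path_integral mu Y g E w ^+ k)
      else 0).
  move=> mY mYD.
  have mI := measurable_path_integral mu mD mYD mg g0 mE ED.
  transitivity (\int[m]_w (phi (values s Y w) * path_integral mu Y g E w ^+ k *
      path_integral mu Y g E w)).
    by apply: eq_integral => w _; rewrite expeS (muleC (path_integral _ _ _ _ _)) muleA.
  have mV : measurable_fun setT
      (fun w => phi (values s Y w) * path_integral mu Y g E w ^+ k).
    apply: emeasurable_funM; last exact: measurable_expe.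
    by apply: (measurableT_comp mphi); exact: measurable_values.
  have V0 w : 0 <= phi (values s Y w) * path_integral mu Y g E w ^+ k.
    by rewrite mule_ge0// expe_ge0// path_integral_ge0.
  rewrite (moment_step m mYD mV V0).
  apply: eq_integral => t _; case: ifP => // _; apply: eq_integral => w _.
  by rewrite muleAC.
rewrite !stepE//; apply: eq_integral => t _; case: ifP => // _.
pose phi' (y : n.+1.-tuple (\bar R)) := phi [tuple of behead y] * g (thead y).
have phi'E d (Omega : measurableType d) (Y : S -> Omega -> \bar R) w :
    phi' (values [tuple of t :: s] Y w) = phi (values s Y w) * g (Y t w).
  rewrite /phi'; congr (phi _ * g _); last by rewrite /thead tnth_mktuple tnth0.
  apply: eq_from_tnth => j; rewrite tnth_behead !tnth_mktuple.
  rewrite (_ : inord j.+1 = lift ord0 j) ?tnthS//.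
  by apply/ord_inj; rewrite lift0 inordK// ltnS.
under eq_integral do rewrite -phi'E.
under [RHS]eq_integral do rewrite -phi'E.
apply: ih.
- apply: emeasurable_funM.
    apply: (measurableT_comp mphi); apply/measurable_fun_tnthP => j.
    rewrite (_ : _ \o _ = @tnth _ _ ^~ (inord j.+1)).
      exact: measurable_tnth.
    by apply/funext => y /=; rewrite tnth_behead.
  by apply: (measurableT_comp mg); exact: measurable_tnth.
- by move=> y; rewrite mule_ge0.
Qed.

End moments.

Section bounded_moment_problem.
Context (R : realType).
Context d1 (Omega1 : measurableType d1) (m1 : probability Omega1 R).
Context d2 (Omega2 : measurableType d2) (m2 : probability Omega2 R).
Variables (V1 : Omega1 -> R) (V2 : Omega2 -> R).
Variables (A1 : set Omega1) (A2 : set Omega2).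
Hypotheses (mV1 : measurable_fun setT V1) (mV2 : measurable_fun setT V2).
Hypotheses (mA1 : measurable A1) (mA2 : measurable A2).
Hypotheses (V1_01 : forall w, (0 <= V1 w <= 1)%R).
Hypotheses (V2_01 : forall w, (0 <= V2 w <= 1)%R).

Lemma integral_horner d (Omega : measurableType d) (m : probability Omega R)
    (V : Omega -> R) (A : set Omega) (p : {poly R}) :
  measurable_fun setT V -> measurable A -> (forall w, (0 <= V w <= 1)%R) ->
  \int[m]_w (\1_A w * p.[V w])%:E =
  \sum_(i < size p) (p`_i)%:E * \int[m]_w (\1_A w * V w ^+ i)%:E.
Proof.
move=> mV mA V01.
have mAV i : measurable_fun setT (fun w => \1_A w * V w ^+ i)%R.
  by apply: measurable_funM => //; exact: measurable_funX.
have iAV i : m.-integrable setT (fun w => (\1_A w * V w ^+ i)%:E).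
  apply: (le_integrable measurableT (g := cst 1)).
  - exact/measurable_EFinP.
  - move=> w _; have /andP[v0 v1] := V01 w.
    rewrite /= normr1 lee_fin ger0_norm ?mulr_ge0 ?exprn_ge0//.
    by rewrite mulr_ile1 ?exprn_ge0 ?exprn_ile1// indicE; case: (_ \in _).
  - exact: finite_measure_integrable_cst.
transitivity (\int[m]_w \sum_(i < size p) (p`_i)%:E * (\1_A w * V w ^+ i)%:E).
  apply: eq_integral => w _; rewrite horner_coef mulr_sumr -sumEFin.
  by apply: eq_bigr => i _; rewrite -EFinM mulrCA.
rewrite integral_sum//; last by move=> i; exact: integrableZl.
by apply: eq_bigr => i _; rewrite integralZl.
Qed.

(** Moments determine the law of a bounded variable: polynomials approximate the
    indicator functions of half-lines. *)
Lemma moments_determine_tail :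
  (forall k, \int[m1]_w (\1_A1 w * V1 w ^+ k)%:E =
             \int[m2]_w (\1_A2 w * V2 w ^+ k)%:E) ->
  forall r : R, m1 (A1 `&` [set w | (r < V1 w)%R]) =
                m2 (A2 `&` [set w | (r < V2 w)%R]).
Proof.
move=> momentE r.
have tailE d (Omega : measurableType d) (m : probability Omega R)
    (V : Omega -> R) (A : set Omega) : measurable_fun setT V -> measurable A ->
    m (A `&` [set w | (r < V w)%R]) = \int[m]_w (\1_A w * (r < V w)%R%:R)%:E.
  move=> mV mA.
  have mr : measurable [set w | (r < V w)%R].
    rewrite -[X in measurable X]setTI (_ : [set w | _] = V @^-1` `]r, +oo[).
      by apply: mV => //; exact: measurable_itv.
    by apply/seteqP; split => w /=; rewrite in_itv/= andbT.
  rewrite -[X in m X]setIT -integral_indic//; last exact: measurableI.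
  apply: eq_integral => w _; rewrite indicI/=; congr (_ * _)%:E.
  by rewrite indicE; congr (nat_of_bool _)%:R; apply/idP/idP => [/set_mem|/mem_set].
have [r0|r0] := ltP r 0%R.
  have rE d (Omega : measurableType d) (m : probability Omega R)
      (V : Omega -> R) (A : set Omega) : measurable_fun setT V -> measurable A ->
      (forall w, (0 <= V w <= 1)%R) -> m (A `&` [set w | (r < V w)%R]) =
      \int[m]_w (\1_A w * V w ^+ 0)%:E.
    move=> mV mA V01; rewrite tailE//; apply: eq_integral => w _.
    by rewrite expr0 (lt_le_trans r0)//; case/andP: (V01 w).
  by rewrite !rE.
have [r1|r1] := leP 1%R r.
  have rE d (Omega : measurableType d) (m : probability Omega R)
      (V : Omega -> R) (A : set Omega) :
      (forall w, (0 <= V w <= 1)%R) -> m (A `&` [set w | (r < V w)%R]) = 0.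
    move=> V01; rewrite [X in m X](_ : _ = set0) ?measure0//.
    apply/seteqP; split => // w [_ /= rV]; case/andP: (V01 w) => _ v1.
    by move: rV; rewrite ltNge (le_trans v1 r1).
  by rewrite !rE.
have th01 : (0 < 1 - r <= 1)%R by apply/andP; split; lra.
pose p n : {poly R} := ((1 - (1 - 'X) ^+ n) ^+ threshold_degree (1 - r)%R n)%R.
have pE n v : (p n).[v] = ((1 - (1 - v) ^+ n) ^+ threshold_degree (1 - r) n)%R.
  by rewrite /p !hornerE.
have cvgV d (Omega : measurableType d) (m : probability Omega R)
    (V : Omega -> R) (A : set Omega) : measurable_fun setT V -> measurable A ->
    (forall w, (0 <= V w <= 1)%R) ->
    (fun n => \int[m]_w (\1_A w * (p n).[V w])%:E) @ \oo -->
    m (A `&` [set w | (r < V w)%R]).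
  move=> mV mA V01; rewrite tailE//.
  have A01 w : (0 <= (\1_A w : R) <= 1)%R.
    by rewrite indicE; case: (_ \in _); rewrite lexx ler01.
  have u01 w : (0 <= 1 - V w <= 1)%R.
    by case/andP: (V01 w) => ? ?; apply/andP; split; lra.
  apply: bounded_cvg.
  - move=> n; under eq_fun do rewrite pE; apply: measurable_funM => //.
    apply: measurable_funX; apply: measurable_funB => //; apply: measurable_funX.
    exact: measurable_funB.
  - apply: measurable_funM => //; apply: measurable_natr_bool.
    exact: measurable_fun_ltr.
  - move=> n w; rewrite pE.
    have /andP[u0 u1] := u01 w; have /andP[A0 A1'] := A01 w.
    have un0 : (0 <= 1 - (1 - V w) ^+ n <= 1)%R.
      by rewrite subr_ge0 exprn_ile1//= gerBl exprn_ge0.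
    case/andP: un0 => un0 un1.
    by rewrite mulr_ge0 ?exprn_ge0//= mulr_ile1 ?exprn_ge0// exprn_ile1.
  - apply: aeW => w; apply: cvgM; first exact: cvg_cst.
    under eq_fun do rewrite pE.
    have := cvg_threshold th01 (u01 w).
    by rewrite (_ : (1 - V w < 1 - r)%R = (r < V w)%R)//; apply/idP/idP => ?; lra.
have c1 := cvgV _ _ m1 V1 A1 mV1 mA1 V1_01.
have c2 := cvgV _ _ m2 V2 A2 mV2 mA2 V2_01.
have E : (fun n => \int[m1]_w (\1_A1 w * (p n).[V1 w])%:E) =
    fun n => \int[m2]_w (\1_A2 w * (p n).[V2 w])%:E.
  apply/funext => n; rewrite !integral_horner//.
  by apply: eq_bigr => i _; rewrite momentE.
rewrite E in c1; exact: (cvg_unique _ c1 c2).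
Qed.

End bounded_moment_problem.

Section law_of_path_integral.
Context (R : realType) dS (S : measurableType dS).
Variables (mu : {sigma_finite_measure set S -> \bar R}) (D : set S).
Hypothesis mD : measurable D.

(** Truncating the integrand and the domain of integration makes the integral of
    the exponential bounded, so that its moments determine its law. *)
Let truncation (m : nat) (y : \bar R) : \bar R := mine (expeR y) m%:R%:E.

Let measurable_truncation m : measurable_fun setT (truncation m).
Proof. by apply: measurable_mine => //; exact: measurable_expeR. Qed.

Let truncation_ge0 m y : 0 <= truncation m y.
Proof. by rewrite le_min expeR_ge0 lee_fin/=. Qed.

Let truncation_nd m k y : (m <= k)%N -> truncation m y <= truncation k y.
Proof.
move=> mk; rewrite le_min ge_min lexx/= ge_min orbC.
by rewrite lee_fin ler_nat mk.
Qed.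

Let cvg_truncation y : (truncation m y) @[m --> \oo] --> expeR y.
Proof.
have := expeR_ge0 y; rewrite /truncation; case: (expeR y) => [r| |]// _.
- apply: cvg_near_cst; near=> m; apply/min_idPl; rewrite lee_fin.
  by near: m; exact: nbhs_infty_ger.
- rewrite (_ : (fun m => _) = fun m : nat => m%:R%:E); first by apply/cvgeryP/cvgr_idn.
  by apply/funext => m; apply/min_idPr; rewrite leey.
Unshelve. all: by end_near. Qed.

Section one_process.
Context d (Omega : measurableType d) (Y : S -> Omega -> \bar R).
Hypothesis mYD : measurable_paths D Y.

Let total w := path_integral mu Y expeR D w.

(** The truncation level and the domain F m grow together. *)
Lemma path_integral_truncation (F : (set S)^nat) w :
  [set: S] = \bigcup_i F i -> nondecreasing_seq F -> (forall i, measurable (F i)) ->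
  total w = ereal_sup (range (fun m => path_integral mu Y (truncation m) (D `&` F m) w)).
Proof.
move=> FT ndF mF.
pose k m s := if s \in D `&` F m then truncation m (Y s w) else 0.
have mDF m : measurable (D `&` F m) by exact: measurableI.
have mk m : measurable_fun setT (k m).
  exact: (measurable_patched_section mD mYD (measurable_truncation m) (mDF m)
    (@subIsetl _ _ _)).
have k0 m s : 0 <= k m s by rewrite /k; case: ifP.
have ndk s : nondecreasing_seq (k ^~ s).
  move=> m m' mm'; rewrite /k; case: ifP => [/set_mem[Ds Fs]|_]; last by case: ifP.
  rewrite mem_set; first exact: truncation_nd.
  by split=> //; move: s Fs {Ds}; apply/subsetPset/ndF.
have ndI : nondecreasing_seq
    (fun m => path_integral mu Y (truncation m) (D `&` F m) w).
  move=> m m' mm'; rewrite !path_integralE.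
  apply: ge0_le_integral => //.
  - by move=> s _; exact: (k0 m).
  - exact: (mk m).
  - exact: (mk m').
  - by move=> s _; exact: ndk.
have /cvg_lim <-// := ereal_nondecreasing_cvgn ndI.
rewrite /total path_integralE.
rewrite (_ : (fun m => _) = fun m => \int[mu]_s k m s); last first.
  by apply/funext => m; rewrite path_integralE.
rewrite -monotone_convergence//.
apply: eq_integral => s _; apply/esym/cvg_lim => //.
case: ifPn => [/set_mem Ds|/negP sD]; last first.
  apply: cvg_near_cst; apply: nearW => m; rewrite /k memNset// => -[Ds _].
  by apply: sD; exact/mem_set.
have [N _ FNs] : (\bigcup_i F i) s by rewrite -FT.
apply: cvg_trans; last exact: cvg_truncation.
apply: near_eq_cvg; exists N => // m /= Nm; rewrite /k mem_set//.
by split=> //; move: s FNs {Ds}; apply/subsetPset/ndF.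
Qed.

End one_process.

Context d1 (Omega1 : measurableType d1) (m1 : probability Omega1 R).
Context d2 (Omega2 : measurableType d2) (m2 : probability Omega2 R).
Variables (Y1 : S -> Omega1 -> \bar R) (Y2 : S -> Omega2 -> \bar R).
Hypothesis mY1 : forall t, measurable_fun setT (Y1 t).
Hypothesis mY2 : forall t, measurable_fun setT (Y2 t).
Hypotheses (mYD1 : measurable_paths D Y1) (mYD2 : measurable_paths D Y2).
Hypothesis Y12 : fdd_eq m1 Y1 m2 Y2.

(** The truncated integrals are bounded, so their moments, restricted to an event on
    finitely many values, determine their tails on this event. *)
Lemma truncated_tail_eq m (F : set S) n (s : n.-tuple S) B (r : R) :
  measurable F -> mu F < +oo -> measurable B ->
  m1 (values s Y1 @^-1` B `&`
      [set w | r%:E < path_integral mu Y1 (truncation m) (D `&` F) w]) =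
  m2 (values s Y2 @^-1` B `&`
      [set w | r%:E < path_integral mu Y2 (truncation m) (D `&` F) w]).
Proof.
move=> mF muF mB.
have mDF : measurable (D `&` F) by exact: measurableI.
have muDF : mu (D `&` F) < +oo.
  by apply: le_lt_trans muF; apply: le_measure => //; rewrite ?inE//; exact: subIsetr.
(* K bounds the truncated integrals, so that V takes values in the unit
   interval *)
pose K := (m%:R * fine (mu (D `&` F)) + 1)%R.
have K0 : (0 < K)%R by rewrite ltr_wpDl// mulr_ge0// fine_ge0.
have int_le d (Omega : measurableType d) (Y : S -> Omega -> \bar R) w :
    measurable_paths D Y ->
    0 <= path_integral mu Y (truncation m) (D `&` F) w <= K%:E.
  move=> mYD; rewrite path_integral_ge0//=.
  apply: (@le_trans _ _ (m%:R%:E * mu (D `&` F))).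
    rewrite -integral_cst// /path_integral [leLHS]integral_mkcond [leRHS]integral_mkcond.
    apply: ge0_le_integral => //.
    - by move=> s' _; rewrite patchE; case: ifP.
    - have := measurable_patched_section mD mYD (measurable_truncation m) mDF
        (@subIsetl _ _ _) w.
      by congr measurable_fun; apply/funext => s' /=; rewrite patchE.
    - by apply/(measurable_restrictT _ mDF); exact: measurable_cst.
    - move=> s' _; rewrite !patchE; case: ifP => // _.
      by rewrite /truncation ge_min lexx orbT.
  rewrite -[mu _]fineK ?ge0_fin_numE// -EFinM lee_fin /K lerDl//.
pose V d (Omega : measurableType d) (Y : S -> Omega -> \bar R) w :=
  (K^-1 * fine (path_integral mu Y (truncation m) (D `&` F) w))%R.
have intE d (Omega : measurableType d) (Y : S -> Omega -> \bar R) w :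
    measurable_paths D Y ->
    path_integral mu Y (truncation m) (D `&` F) w = (K * V _ _ Y w)%:E.
  move=> mYD; rewrite /V mulVKf ?gt_eqF// fineK// ge0_fin_numE.
    by have /andP[_ h] := int_le _ _ Y w mYD; rewrite (le_lt_trans h)// ltry.
  exact: path_integral_ge0.
have V01 d (Omega : measurableType d) (Y : S -> Omega -> \bar R) w :
    measurable_paths D Y -> (0 <= V _ _ Y w <= 1)%R.
  move=> mYD; have := int_le _ _ Y w mYD.
  rewrite intE// !lee_fin => /andP[h1 h2]; apply/andP; split.
    by move: h1; rewrite pmulr_rge0.
  by move: h2; rewrite -[leRHS]mulr1 ler_pM2l.
have mV d (Omega : measurableType d) (Y : S -> Omega -> \bar R) :
    measurable_paths D Y -> measurable_fun setT (V _ _ Y).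
  move=> mYD; apply: measurable_funM => //; apply: measurableT_comp => //.
  exact: (measurable_path_integral mu mD mYD (measurable_truncation m)
    (truncation_ge0 m) mDF (@subIsetl _ _ _)).
have mA d (Omega : measurableType d) (Y : S -> Omega -> \bar R) :
    (forall t, measurable_fun setT (Y t)) -> measurable (values s Y @^-1` B).
  by move=> mY; rewrite -[X in measurable X]setTI; exact: measurable_values.
have momentE d (Omega : measurableType d) (mm : probability Omega R)
    (Y : S -> Omega -> \bar R) k : (forall t, measurable_fun setT (Y t)) ->
    measurable_paths D Y ->
    \int[mm]_w (\1_(values s Y @^-1` B) w * V _ _ Y w ^+ k)%:E =
    (K^-1 ^+ k)%:E * \int[mm]_w ((\1_B (values s Y w))%:E *
      path_integral mu Y (truncation m) (D `&` F) w ^+ k).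
  move=> mY mYD.
  have mI := measurable_path_integral mu mD mYD (measurable_truncation m)
    (truncation_ge0 m) mDF (@subIsetl _ _ _).
  rewrite -ge0_integralZl_EFin//.
  - apply: eq_integral => w _; rewrite intE// -EFin_expe -!EFinM; congr (_%:E).
    rewrite mulrCA -exprMn mulKf ?gt_eqF//.
  - by move=> w _; rewrite mule_ge0 ?lee_fin// expe_ge0// path_integral_ge0.
  - apply: emeasurable_funM; last exact: measurable_expe.
    apply/measurable_EFinP; apply: (measurableT_comp (measurable_indic mB)).
    exact: measurable_values.
  - by rewrite exprn_ge0// invr_ge0 ltW.
have tailE d (Omega : measurableType d) (Y : S -> Omega -> \bar R) :
    measurable_paths D Y ->
    [set w | r%:E < path_integral mu Y (truncation m) (D `&` F) w] =
    [set w | (K^-1 * r < V _ _ Y w)%R].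
  move=> mYD; apply/seteqP; split => w /=; rewrite intE// lte_fin.
    by rewrite ltr_pdivrMl.
  by rewrite ltr_pdivrMl.
rewrite !tailE//; apply: moments_determine_tail.
- exact: mV.
- exact: mV.
- exact: mA.
- exact: mA.
- by move=> w; exact: V01.
- by move=> w; exact: V01.
move=> k; rewrite !momentE//; congr (_ * _).
apply: (moments_eq mu mD mY1 mY2 mYD1 mYD2 Y12 (measurable_truncation m)
  (truncation_ge0 m) mDF (@subIsetl _ _ _) k s (phi := fun y => (\1_B y)%:E)).
  by apply/measurable_EFinP; exact: measurable_indic.
by move=> y; rewrite lee_fin.
Qed.

(** Truncated integrals increase to the integral, and so do their tails; the tails
    give the probabilities of orthants. *)
Theorem joint_law_path_integral n (s : n.-tuple S) (B : set (n.+1.-tuple (\bar R))) :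
  measurable B ->
  m1 [set w | B [tuple of path_integral mu Y1 expeR D w :: values s Y1 w]] =
  m2 [set w | B [tuple of path_integral mu Y2 expeR D w :: values s Y2 w]].
Proof.
move=> mB.
have /sigma_finiteP[F [FT ndF mF]] := sigma_finiteT mu.
have mF' i : measurable (F i) by case: (mF i).
pose I d (Omega : measurableType d) (Y : S -> Omega -> \bar R) :=
  path_integral mu Y expeR D.
have mI d (Omega : measurableType d) (Y : S -> Omega -> \bar R) :
    measurable_paths D Y -> measurable_fun setT (I _ _ Y).
  by move=> mYD; exact: (measurable_path_integral mu mD mYD measurable_expeR
    (@expeR_ge0 R) mD).
have mtup d (Omega : measurableType d) (Y : S -> Omega -> \bar R) :
    measurable_paths D Y -> (forall t, measurable_fun setT (Y t)) ->
    measurable_fun setT (fun w => [tuple of I _ _ Y w :: values s Y w]).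
  by move=> mYD mY; apply: measurable_cons; [exact: mI|exact: measurable_values].
pose nu1 := image_measure m1 (mtup _ _ _ mYD1 mY1).
pose nu2 := image_measure m2 (mtup _ _ _ mYD2 mY2).
apply: (@measure_eq_orthants _ _ nu1 nu2) => //.
  by rewrite [X in X < _]probability_setT ltry.
move=> x xNy.
pose C : set (n.-tuple (\bar R)) := orthant (fun j => x (lift ord0 j)).
have mC : measurable C by exact: measurable_orthant.
have mA d (Omega : measurableType d) (Y : S -> Omega -> \bar R) :
    (forall t, measurable_fun setT (Y t)) -> measurable (values s Y @^-1` C).
  by move=> mY; rewrite -[X in measurable X]setTI; exact: measurable_values.
have splitE d (Omega : measurableType d) (Y : S -> Omega -> \bar R) :
    [set w | orthant x [tuple of I _ _ Y w :: values s Y w]] =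
    values s Y @^-1` C `&` [set w | I _ _ Y w <= x ord0].
  apply/seteqP; split => w /=.
    move=> wx; split; last by have := wx ord0; rewrite tnth0.
    by move=> j; have := wx (lift ord0 j); rewrite tnthS.
  move=> [wC w0] j; case: (unliftP ord0 j) => [i|] ->; last by rewrite tnth0.
  by rewrite tnthS; exact: wC.
suff : m1 (values s Y1 @^-1` C `&` [set w | I _ _ Y1 w <= x ord0]) =
    m2 (values s Y2 @^-1` C `&` [set w | I _ _ Y2 w <= x ord0]).
  by rewrite -!splitE.
have AE : m1 (values s Y1 @^-1` C) = m2 (values s Y2 @^-1` C) by exact: Y12.
case x0 : (x ord0) (xNy ord0) => [r| |]// _; last first.
  have TE d (Omega : measurableType d) (Y : S -> Omega -> \bar R) :
      [set w | I _ _ Y w <= +oo] = setT.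
    by apply/seteqP; split => // w _ /=; rewrite leey.
  by rewrite !TE !setIT.
have tailE : m1 (values s Y1 @^-1` C `&` [set w | r%:E < I _ _ Y1 w]) =
    m2 (values s Y2 @^-1` C `&` [set w | r%:E < I _ _ Y2 w]).
  have cvgI d (Omega : measurableType d) (mm : probability Omega R)
      (Y : S -> Omega -> \bar R) : measurable_paths D Y ->
      (forall t, measurable_fun setT (Y t)) ->
      (fun m => mm (values s Y @^-1` C `&`
        [set w | r%:E < path_integral mu Y (truncation m) (D `&` F m) w])) @ \oo -->
      mm (values s Y @^-1` C `&` [set w | r%:E < I _ _ Y w]).
    move=> mYD mY.
    pose L m := values s Y @^-1` C `&`
      [set w | r%:E < path_integral mu Y (truncation m) (D `&` F m) w].
    have mDF m : measurable (D `&` F m) by exact: measurableI.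
    have mL m : measurable (L m).
      apply: measurableI; first exact: mA.
      rewrite -[X in measurable X]setTI; apply: measurable_lte => //.
      exact: (measurable_path_integral mu mD mYD (measurable_truncation m)
        (truncation_ge0 m) (mDF m) (@subIsetl _ _ _)).
    have supE w := path_integral_truncation mYD w FT ndF mF'.
    rewrite (_ : values s Y @^-1` C `&` _ = \bigcup_m L m); last first.
      apply/seteqP; split => w.
        move=> [wC]; rewrite /= /I supE => /ereal_sup_gt[_ [m _ <-] rm].
        by exists m.
      move=> [m _ [wC rm]]; split => //=; rewrite /I supE.
      by apply: lt_le_trans rm _; apply: ereal_sup_ubound; exists m.
    apply: (nondecreasing_cvg_mu (F := L)) => //; first exact: bigcupT_measurable.
    move=> m m' mm'; apply/subsetPset => w [wC rm]; split => //=.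
    apply: lt_le_trans rm _; rewrite !path_integralE.
    have mk m0 : measurable_fun setT
        (fun s' => if s' \in D `&` F m0 then truncation m0 (Y s' w) else 0).
      exact: (measurable_patched_section mD mYD (measurable_truncation m0) (mDF m0)
        (@subIsetl _ _ _)).
    apply: ge0_le_integral => //.
    - by move=> s' _; case: ifP.
    - move=> s' _; case: ifP => [/set_mem[Ds Fs]|_]; last by case: ifP.
      rewrite mem_set; first exact: truncation_nd.
      by split=> //; move: s' Fs {Ds}; apply/subsetPset/ndF.
  have c1 := cvgI _ _ m1 Y1 mYD1 mY1; have c2 := cvgI _ _ m2 Y2 mYD2 mY2.
  suff E : (fun m => m1 (values s Y1 @^-1` C `&`
      [set w | r%:E < path_integral mu Y1 (truncation m) (D `&` F m) w])) =
      fun m => m2 (values s Y2 @^-1` C `&`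
      [set w | r%:E < path_integral mu Y2 (truncation m) (D `&` F m) w]).
    by rewrite E in c1; exact: (cvg_unique _ c1 c2).
  by apply/funext => m; apply: truncated_tail_eq => //; case: (mF m).
have complE d (Omega : measurableType d) (mm : probability Omega R)
    (Y : S -> Omega -> \bar R) : measurable_paths D Y ->
    (forall t, measurable_fun setT (Y t)) ->
    mm (values s Y @^-1` C `&` [set w | I _ _ Y w <= r%:E]) =
    mm (values s Y @^-1` C) - mm (values s Y @^-1` C `&` [set w | r%:E < I _ _ Y w]).
  move=> mYD mY.
  have mr : measurable [set w | r%:E < I _ _ Y w].
    by rewrite -[X in measurable X]setTI; apply: measurable_lte => //; exact: mI.
  rewrite (_ : _ `&` [set w | I _ _ Y w <= r%:E] =
      values s Y @^-1` C `\` [set w | r%:E < I _ _ Y w]); last first.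
    apply/seteqP; split => w [wC wr]; split => //=.
      by move: wr; rewrite /= leNgt => /negP.
    by rewrite leNgt; apply/negP.
  rewrite measureD//; first exact: mA.
  by rewrite -ge0_fin_numE// fin_num_measure//; exact: mA.
by rewrite !complE// AE tailE.
Qed.

End law_of_path_integral.

(** * Mixtures of shifted tilts *)

Section conull_domain.
Context d (T : measurableType d) (R : realType).
Variables (mu : {measure set T -> \bar R}) (D : set T).
Hypotheses (mD : measurable D) (muD : mu (~` D) = 0).
Import HBNNSimple.

(** The integral of a nonnegative function is a supremum over simple functions,
    so f may fail to be measurable outside D. *)
Lemma integral_conull (f : T -> \bar R) : (forall x, 0 <= f x) ->
  \int[mu]_x f x = \int[mu]_(x in D) f x.
Proof.
move=> f0; apply/eqP; rewrite eq_le; apply/andP; split; last first.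
  rewrite ge0_integralTE// ge0_integralE//; apply: le_ereal_sup => _ [h hf <-].
  exists h => // x; apply: le_trans (hf x) _.
  by rewrite patchE; case: ifP.
rewrite ge0_integralTE// ge0_integralE//; apply: ge_ereal_sup => _ [h hf <-].
rewrite -integralT_nnsfun (@ge0_negligible_integral _ _ _ mu setT (~` D))//; last 3 first.
- exact: measurableC.
- exact/measurable_EFinP.
- by move=> x _; rewrite lee_fin.
rewrite setDE setCK setTI integral_mkcond.
rewrite (_ : (_ \_ D) = EFin \o (proj_nnsfun h mD)); last first.
  apply/funext => x; rewrite /patch/= mindicE.
  by case: ifP => _; rewrite ?mulr1 ?mulr0.
rewrite integralT_nnsfun; apply: ereal_sup_ubound; exists (proj_nnsfun h mD) => // x.
by rewrite patchE/= mindicE; case: ifP => _; rewrite ?mulr1 ?mulr0.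
Qed.

End conull_domain.

Section spectral_mixture.
Context (R : realType) dT (T : measurableType dT).
Context d (Omega : measurableType d) (P : probability Omega R).
Variable Z : T -> Omega -> \bar R.
Hypothesis procZ : process Z.
Hypothesis expZ : forall t, \int[P]_w expeR (Z t w) = 1.
Variables (mu : {sigma_finite_measure set T -> \bar R}) (D : set T).
Hypotheses (mD : measurable D) (mZD : measurable_paths D Z).

Let mZ t : measurable_fun setT (Z t). Proof. by case: procZ. Qed.

Variable M : Omega -> \bar R.
Hypotheses (mM : measurable_fun setT M) (M0 : forall w, 0 <= M w).

(** The value 1 at times outside D removes them from the exponent of the exponential
    formula. *)
Definition tilted_cdf (q : R * T) : R :=
  if q.2 \in D then fine (tilt P Z q.2 [set w | M w <= (expR (- q.1))%:E]) else 1%R.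

Let mMle (q : R) : measurable [set w | M w <= (expR (- q))%:E].
Proof. by rewrite -[X in measurable X]setTI; exact: measurable_lee. Qed.

Lemma measurable_tilted_cdf : measurable_fun setT tilted_cdf.
Proof.
pose h (x : (R * T) * Omega) : \bar R :=
  (if x.1.2 \in D then expeR (Z x.1.2 x.2) else 0) *
  ((M x.2 <= (expR (- x.1.1))%:E)%E : bool)%:R%:E.
have mZp := measurable_patched mD mZD measurable_expeR mD (@subset_refl _ D).
have mh : measurable_fun setT h.
  apply: emeasurable_funM.
    have m2 : measurable_fun setT (fun x : (R * T) * Omega => (x.1.2, x.2)).
      apply: measurable_fun_pair => //; exact: measurableT_comp.
    exact: (measurableT_comp mZp m2).
  apply/measurable_EFinP/measurable_natr_bool; apply: measurable_fun_lee.
    exact: (measurableT_comp mM measurable_snd).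
  apply/measurable_EFinP; apply: measurableT_comp => //; apply: measurable_funN.
  exact: (measurableT_comp measurable_fst measurable_fst).
have h0 x : 0 <= h x.
  by rewrite mule_ge0 ?lee_fin//; case: ifP => // _; exact: expeR_ge0.
have mI := measurable_fun_fubini_tonelli_F (m2 := P) _ mh h0.
have mN : measurable_fun setT (fun q : R * T => \1_(~` D) q.2 : R).
  by apply: measurableT_comp => //; apply: measurable_indic; exact: measurableC.
rewrite (_ : tilted_cdf = fun q =>
    fine (fubini_F P h q) + \1_(~` D) q.2)%R; last first.
  apply/funext => -[q t]; rewrite /tilted_cdf /fubini_F/= /h/= indicE in_setC.
  case: ifP => tD /=.
    rewrite addr0 /tilt integral_mkcond; congr (fine _); apply: eq_integral => w _.
    rewrite patchE; case: (boolP (M w <= _)) => Mw.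
      by rewrite mem_set// mule1.
    by rewrite memNset ?mule0//; exact/negP.
  by under eq_integral do rewrite mul0e; rewrite integral0/= add0r.
by apply: measurable_funD => //; exact: measurableT_comp.
Qed.

(** Integrating exp (- p) dp gives the expectations of M under the tilts, and
    integrating their densities exp (Z t) over t gives the integral of the path. *)
Lemma integral_tilted_cdf :
  \int[lebesgue_measure \x mu]_q ((1 - tilted_cdf q)%:E * (expR (- q.1))%:E) =
  \int[P]_w (M w * path_integral mu Z expeR D w).
Proof.
have cdf01 q : (0 <= 1 - tilted_cdf q)%R.
  rewrite subr_ge0 /tilted_cdf; case: ifP => // _; rewrite -lee_fin fineK.
    exact: (probability_le1 (tilted_law procZ expZ q.2)).
  exact: (fin_num_measure (tilted_law procZ expZ q.2)).
rewrite (moment_step mu mD measurable_expeR (@expeR_ge0 R) mD (@subset_refl _ D) P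
  mZD mM M0).
have mg : measurable_fun setT
    (fun q : R * T => (1 - tilted_cdf q)%:E * (expR (- q.1))%:E).
  apply: emeasurable_funM; apply/measurable_EFinP.
    by apply: measurable_funB => //; exact: measurable_tilted_cdf.
  apply: measurableT_comp => //; apply: measurable_funN; exact: measurable_fst.
rewrite fubini_tonelli2//; last by move=> q; rewrite mule_ge0// lee_fin ?expR_ge0.
apply: eq_integral => t _; rewrite /fubini_G /tilted_cdf/=.
case: ifP => tD; last first.
  by under eq_integral do rewrite subrr mul0e; rewrite integral0.
rewrite [LHS](integral_probability_score (tilted_law procZ expZ t) mM M0).
rewrite [LHS]integral_tilted_law//.
by apply: eq_integral => w _; rewrite muleC.
Qed.

End spectral_mixture.

Section lne_algebra.
Context {R : realType}.

Lemma lneM_expR (r : R) (y : \bar R) : 0 <= y ->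
  lne ((expR r)%:E * y) = r%:E + lne y.
Proof.
case: y => [y| |]//; rewrite ?lee_fin => y0.
  have [->|yN0] := eqVneq y 0%R; first by rewrite mule0 le0_lneNy.
  have yp : (0 < y)%R by rewrite lt_neqAle eq_sym yN0.
  rewrite -EFinM !lne_EFin ?mulr_gt0 ?expR_gt0// lnM ?posrE ?expR_gt0//.
  by rewrite expRK.
by rewrite gt0_muley ?lte_fin ?expR_gt0.
Qed.

Lemma score_normalized n (x u : 'I_n -> \bar R) (y : \bar R) :
  0 < y -> y < +oo ->
  score x (fun j => u j - lne y) * y = score x u.
Proof.
case: y => [y| |]//; rewrite lte_fin => y0 _.
rewrite lne_EFin// scoreB// muleAC /= -EFinM expRN lnK ?posrE//.
by rewrite mulVf ?gt_eqF// mul1e.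
Qed.

End lne_algebra.

Section shifted_marks.
Context (R : realType) (k : time_kind) (n : nat).
Local Notation T := (time R k n).
Context d (Omega : measurableType d) (F : set (set Omega)).
Variables (mu : {sigma_finite_measure set T -> \bar R}) (D : set T).
Hypothesis mD : measurable D.
Variable X : T -> Omega -> \bar R.
Hypothesis mX : measurable_shifts D F X.
Local Notation OmegaF := (g_sigma_algebraType F).

(** The paths are only known to be measurable after a shift by a time in D, so
    they are cut off when the shift is outside D. *)
Let cut (s : T) (q : T * OmegaF) : \bar R :=
  if q.1 \in D then X (s - q.1)%R q.2 else 0.

Let measurable_cut s : measurable_fun setT (cut s).
Proof.
have [m1 _] := mX.
exact: (measurable_patched (Omega := OmegaF) mD (m1 s) (@measurable_id _ _ setT)
  mD (@subset_refl _ D)).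
Qed.

Let measurable_paths_cut : measurable_paths D cut.
Proof.
have [_ m2] := mX; move: m2; rewrite /measurable_paths.
have mDD : measurable (D `*` D) by exact: measurableX.
have mDDT : measurable ((D `*` D) `*` [set: OmegaF]) by exact: measurableX.
move=> /(measurable_restrictT _ mDDT) m2.
have mr : measurable_fun setT (fun x : T * (T * OmegaF) => ((x.1, x.2.1), x.2.2)).
  apply: measurable_fun_pair; first apply: measurable_fun_pair.
  - exact: measurable_fst.
  - exact: (measurableT_comp measurable_fst measurable_snd).
  - exact: (measurableT_comp measurable_snd measurable_snd).
have := measurableT_comp m2 mr; move=> /(measurable_funS measurableT).
move=> /(_ (D `*` setT) (@subsetT _ _)); apply: eq_measurable_fun => -[s [t w]].
rewrite inE => -[/= Ds _]; rewrite /cut patchE/=.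
case: ifPn => [/set_mem[[_ /= Dt] _]|/negP sD]; first by rewrite mem_set.
by rewrite ifF//; apply/negP => /set_mem Dt; apply: sD; exact/mem_set.
Qed.

Definition mark_score m (x : 'I_m -> \bar R) (s : m.-tuple T) (t : T) (w : Omega) :=
  score x (fun j => X (tnth s j - t)%R w
    - lne (\int[mu]_(u in D) expeR (X (u - t)%R w))).

(** The measurability that the exponential formula with marks requires *)
Lemma measurable_mark_event m (x : 'I_m -> \bar R) (s : m.-tuple T) :
  measurable [set y : (R * T) * OmegaF |
    D y.1.2 -> mark_score x s y.1.2 y.2 <= (expR (- y.1.1))%:E].
Proof.
pose c (y : (R * T) * OmegaF) := score x (fun j => cut (tnth s j) (y.1.2, y.2)
    - lne (path_integral mu cut expeR D (y.1.2, y.2))).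
have mpair : measurable_fun setT (fun y : (R * T) * OmegaF => (y.1.2, y.2)).
  by apply: measurable_fun_pair => //; exact: measurableT_comp.
have mI := measurable_path_integral mu mD measurable_paths_cut measurable_expeR
  (@expeR_ge0 R) mD (@subset_refl _ D).
have mc : measurable_fun setT c.
  apply: measurable_score => j; apply: emeasurable_funB.
    exact: (measurableT_comp (measurable_cut _) mpair).
  exact: (measurableT_comp (measurableT_comp measurable_lne mI) mpair).
have mD' : measurable [set y : (R * T) * OmegaF | D y.1.2].
  have mt : measurable_fun setT (fun y : (R * T) * OmegaF => y.1.2).
    exact: measurableT_comp.
  by have := mt measurableT D mD; rewrite setTI.
rewrite (_ : [set y | _] = ~` [set y : (R * T) * OmegaF | D y.1.2] `|`
    [set y | c y <= (expR (- y.1.1))%:E]).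
  apply: measurableU; first exact: measurableC.
  rewrite -[X in measurable X]setTI; apply: measurable_lee => //.
  apply/measurable_EFinP; apply: measurableT_comp => //; apply: measurable_funN.
  exact: (measurableT_comp measurable_fst measurable_fst).
have cE y : D y.1.2 -> c y = mark_score x s y.1.2 y.2.
  move=> Dy; rewrite /c /mark_score /path_integral /cut/= mem_set//.
by apply/seteqP; split => y /=; have [Dy|Dy] := pselect (D y.1.2);
  [rewrite cE//; right; auto|left|rewrite cE// => -[]//|].
Qed.

Hypothesis F_measurable : F `<=` @measurable _ Omega.

Lemma measurable_paths_shift t : D t -> measurable_paths D (fun u w => X (u - t)%R w).
Proof.
move=> Dt; have [_ m2] := mX.
have mDD : measurable (D `*` D) by exact: measurableX.
have mr : measurable_fun setT (fun x : T * Omega => ((x.1, t), x.2 : OmegaF)).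
  apply: measurable_fun_pair; first exact: measurable_fun_pair.
  exact: (measurableT_comp (measurable_id_sub F_measurable) measurable_snd).
apply: (measurable_comp (F := (D `*` D) `*` [set: OmegaF]) _ _ m2
  (measurable_funS measurableT (@subsetT _ _) mr)).
- exact: measurableX.
- by move=> _ [[s w] [/= Ds _] <-].
Qed.

End shifted_marks.

Section null_sets.
Context d (Omega : measurableType d) (R : realType) (P : probability Omega R).
Context dE (E : measurableType dE) (X : nat -> Omega -> E).
Variables (nu : {measure set E -> \bar R}) (g : E -> \bar R).
Hypothesis poissonX : poisson_process P X (fun A => \int[nu]_(x in A) g x).

(** A Poisson variable with mean 0 vanishes almost surely. *)
Lemma poisson_avoids_null A : measurable A -> \int[nu]_(x in A) g x = 0 ->
  {ae P, forall w, forall i, ~ A (X i w)}.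
Proof.
move=> mA lA; have [mX count _] := poissonX.
have mN := measurable_point_count poissonX mA.
have := count A 0%N mA; rewrite lA ltry => /(_ isT).
rewrite /= oppr0 expR0 expr0 fact0 divr1 mulr1 => P1.
have mZ : measurable [set w | point_count (R := R) X A w = 0].
  by rewrite -[X in measurable X]setTI; exact: (mN measurableT [set 0]).
have := ae_of_probability1 mZ P1; apply: filterS => w /= w0 i Aw.
have : \d_(X i w) A <= point_count (R := R) X A w.
  rewrite /point_count (nneseries_split 0 i.+1)// add0n big_mkord big_ord_recr/=.
  rewrite -addeA addeC -addeA leeDl// adde_ge0//.
    by apply: nneseries_ge0.
  by apply: sume_ge0.
by rewrite w0 diracE mem_set// lee_fin ler10.
Qed.

End null_sets.

Section tilted_representation.
Context (R : realType) (k : time_kind) (n : nat).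
Local Notation T := (time R k n).
Context d (Omega : measurableType d) (P : probability Omega R).
Variable Z : T -> Omega -> \bar R.
Hypothesis procZ : process Z.
Hypothesis expZ : forall t, \int[P]_w expeR (Z t w) = 1.
Variables (mu : {sigma_finite_measure set T -> \bar R}) (D : set T).
Hypotheses (mD : measurable D) (muD : mu (~` D) = 0) (mZD : measurable_paths D Z).
Hypothesis totalZ : {ae P, forall w, 0 < \int[mu]_t expeR (Z t w) < +oo}.

Let mZ t : measurable_fun setT (Z t). Proof. by case: procZ. Qed.
Let Zy t w : Z t w != +oo. Proof. by case: procZ. Qed.
Let total w := path_integral mu Z expeR D w.

Let mtotal : measurable_fun setT total.
Proof.
exact: (measurable_path_integral mu mD mZD measurable_expeR
  (@expeR_ge0 R) mD (@subset_refl _ D)).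
Qed.

Let total_ge0 w : 0 <= total w.
Proof. by apply: path_integral_ge0 => y; exact: expeR_ge0. Qed.

Let measurable_section d' (Omega' : measurableType d') (Y : T -> Omega' -> \bar R) w :
  measurable_paths D Y -> measurable_fun D (fun t => expeR (Y t w)).
Proof.
move=> mYD; have mpair : measurable_fun [set: T] (fun t => (t, w)).
  exact: measurable_fun_pair.
apply: (measurableT_comp measurable_expeR).
apply: (measurable_comp (F := D `*` [set: Omega']) _ _ mYD
  (measurable_funS measurableT (@subsetT _ _) mpair)).
- exact: measurableX.
- by move=> _ [t Dt <-].
Qed.

Section one_orthant.
Context m (s : m.-tuple T) (x : 'I_m -> \bar R).

Let M w := score x (fun j => Z (tnth s j) w - lne (total w)).

Let mM : measurable_fun setT M.
Proof.
apply: measurable_score => j; apply: emeasurable_funB => //.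
exact: (measurableT_comp measurable_lne mtotal).
Qed.

Let M0 w : 0 <= M w. Proof. exact: score_ge0. Qed.

(** Subtracting ln (total w) divides the score by total w, which is almost surely
    positive and finite. *)
Lemma integral_normalized_score :
  \int[P]_w (M w * total w) = \int[P]_w score x (fun j => Z (tnth s j) w).
Proof.
apply: ge0_ae_eq_integral => //.
- exact: emeasurable_funM.
- exact: measurable_score.
- by move=> w _; apply: mule_ge0.
- by move=> w _; exact: score_ge0.
apply: filterS totalZ => w.
have -> : \int[mu]_t expeR (Z t w) = total w.
  by apply: (integral_conull mD muD) => t; exact: expeR_ge0.
move=> /andP[S0 Sy] _; exact: score_normalized.
Qed.

(** Centring at t divides the exponential of the path and its integral by the same
    factor exp (Z t w), and the tilt at t does not charge the outcomes where this
    factor is 0. *)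
Lemma tilt_mark_event t (e : \bar R) :
  tilt P Z t [set w | score x (fun j => Xi t Z (tnth s j) w
    - lne (path_integral mu (Xi t Z) expeR D w)) <= e] =
  tilt P Z t [set w | M w <= e].
Proof.
rewrite /tilt [LHS]integral_mkcond [RHS]integral_mkcond; apply: eq_integral => w _.
rewrite !patchE; case zt : (Z t w) (Zy t w) => [r| |]// _; last by do 2 case: ifP.
suff E : score x (fun j => Xi t Z (tnth s j) w
    - lne (path_integral mu (Xi t Z) expeR D w)) = M w.
  rewrite (_ : (w \in [set w | M w <= e]) = (M w <= e)); last first.
    by apply/idP/idP => [/set_mem|/mem_set].
  rewrite (_ : (w \in _) = (M w <= e))//.
  by rewrite -E; apply/idP/idP => [/set_mem|/mem_set].
have -> : path_integral mu (Xi t Z) expeR D w = (expR (- r))%:E * total w.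
  rewrite -ge0_integralZl_EFin ?expR_ge0//; last 2 first.
  - by move=> u _; exact: expeR_ge0.
  - exact: measurable_section.
  by apply: eq_integral => u _; rewrite /Xi zt expeRD muleC.
rewrite lneM_expR// /M; congr score; apply/funext => j.
rewrite /Xi zt; case: (Z (tnth s j) w) (lne (total w)) => [a| |] [b| |]//=.
by congr (_%:E); ring.
Qed.

Context d' (Omega' : measurableType d') (P' : probability Omega' R).
Variables (F : set (set Omega')) (X : T -> Omega' -> \bar R).
Hypothesis F_measurable : F `<=` @measurable _ Omega'.
Hypothesis statZ : tilt_stationary P Z.
Hypotheses (procX : process X) (mX : measurable_shifts D F X).
Hypothesis fddX : fdd_eq P' X (tilt P Z 0%R) (Xi 0%R Z).

(** Stationarity of the tilts says that the shifted mark X has the law of the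
    path of Z, tilted and centred at the time of the shift. *)
Lemma mark_event_probability (q : R * T) :
  P' [set w | D q.2 -> mark_score mu D X x s q.2 w <= (expR (- q.1))%:E] =
  (tilted_cdf P Z D M q)%:E.
Proof.
case: q => p t /=; rewrite /tilted_cdf/=; case: ifPn => [/set_mem Dt|/negP tD].
  pose B : set (m.+1.-tuple (\bar R)) := [set y | score x (fun j =>
    tnth y (lift ord0 j) - lne (tnth y ord0)) <= (expR (- p))%:E].
  have mB : measurable B.
    rewrite -[X in measurable X]setTI; apply: measurable_lee => //.
    apply: measurable_score => j; apply: emeasurable_funB.
      exact: measurable_tnth.
    by apply: (measurableT_comp measurable_lne); exact: measurable_tnth.
  pose Y u w := X (u - t)%R w.
  have fddY : fdd_eq (tilted_law procZ expZ t) (Xi t Z) P' Y.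
    move=> j s' C mC; have := statZ 0%R t s' mC; rewrite add0r.
    move=> e; apply: (etrans e); apply/esym.
    exact: (fdd_eq_Lshift t fddX s' mC).
  have mXi : measurable_paths D (Xi t Z).
    apply: emeasurable_funB => //.
    exact: (measurable_funS measurableT (@subsetT _ _) (measurableT_comp (mZ t) measurable_snd)).
  have mY : forall u, measurable_fun setT (Y u).
    by have [mXX _] := procX => u; exact: mXX.
  have := joint_law_path_integral mu mD (measurable_Xi procZ t) mY mXi
    (measurable_paths_shift mD mX F_measurable Dt) fddY s mB.
  have BE e (Theta : measurableType e) (V : T -> Theta -> \bar R) :
      [set w | B [tuple of path_integral mu V expeR D w :: values s V w]] =
      [set w | score x (fun j => V (tnth s j) w
        - lne (path_integral mu V expeR D w)) <= (expR (- p))%:E].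
    apply/funext => w; rewrite /B /mkset tnth0; congr (score _ _ <= _).
    by apply/funext => j; rewrite tnthS tnth_mktuple.
  rewrite !BE => e; rewrite (_ : [set w | _] = [set w | score x (fun j => Y (tnth s j) w
        - lne (path_integral mu Y expeR D w)) <= (expR (- p))%:E]); last first.
    by apply/seteqP; split => w //=; apply.
  rewrite -[LHS]e [LHS]tilt_mark_event fineK//.
  apply: (fin_num_measure (tilted_law procZ expZ t)).
  by rewrite -[X in measurable X]setTI; exact: measurable_lee.
rewrite (_ : [set w | _] = setT) ?probability_setT//.
by apply/seteqP; split => // w _ Dt; case: tD; exact/mem_set.
Qed.

End one_orthant.
End tilted_representation.

Lemma ae_eq_measure d (T : measurableType d) (R : realType)
    (mu : {measure set T -> \bar R}) (A B : set T) :
  measurable A -> measurable B -> {ae mu, forall w, A w <-> B w} -> mu A = mu B.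
Proof.
move=> mA mB AB; rewrite -[A]setIT -[B]setIT -!integral_indic//.
apply: ge0_ae_eq_integral => //.
- exact/measurable_EFinP/measurable_indic.
- exact/measurable_EFinP/measurable_indic.
apply: filterS AB => w ABw _; rewrite !indicE.
by congr (nat_of_bool _)%:R%:E; apply/idP/idP => /set_mem/ABw/mem_set.
Qed.

Section tilted_representation_law.
Context (R : realType) (k : time_kind) (n : nat).
Local Notation T := (time R k n).
Context d (Omega : measurableType d) (P : probability Omega R).
Variable Z : T -> Omega -> \bar R.
Hypothesis procZ : process Z.
Hypothesis expZ : forall t, \int[P]_w expeR (Z t w) = 1.
Hypothesis statZ : tilt_stationary P Z.
Variables (mu : {sigma_finite_measure set T -> \bar R}) (D : set T).
Hypotheses (mD : measurable D) (muD : mu (~` D) = 0) (mZD : measurable_paths D Z).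
Hypothesis totalZ : {ae P, forall w, 0 < \int[mu]_t expeR (Z t w) < +oo}.
Context d' (Omega' : measurableType d') (P' : probability Omega' R).
Variables (p : nat -> Omega' -> R) (tau : nat -> Omega' -> T).
Variables (X : nat -> T -> Omega' -> \bar R) (G : option nat -> set (set Omega')).
Variable eta : T -> Omega' -> \bar R.
Hypothesis poissonX : poisson_process P' (fun i w => (p i w, tau i w))
  (fun A => \int[lebesgue_measure \x mu]_(x in A) (expR (- x.1))%:E).
Hypothesis indepG : independent_marks P' G (fun i w => (p i w, tau i w)) X.
Hypothesis Xi0 : forall i, process (X i) /\ fdd_eq P' (X i) (tilt P Z 0%R) (Xi 0%R Z).
Hypothesis mX : forall i, measurable_shifts D (G (Some i)) (X i).
Hypothesis meta : forall t, measurable_fun setT (eta t).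
Hypothesis etaE : forall t, {ae P', forall w, eta t w =
  ereal_sup (range (fun i => (p i w)%:E + Lshift (tau i w) (X i) t w
    - lne (\int[mu]_s expeR (Lshift (tau i w) (X i) s w))))}.

Let mZ t : measurable_fun setT (Z t). Proof. by case: procZ. Qed.

Let tau_in_D : {ae P', forall w, forall i, D (tau i w)}.
Proof.
have mA : measurable ([set: R] `*` ~` D) by apply: measurableX => //; exact: measurableC.
have A0 : (lebesgue_measure \x mu) ([set: R] `*` ~` D) = 0.
  by rewrite product_measure1E//= ?muD ?mule0//; exact: measurableC.
have lA : \int[lebesgue_measure \x mu]_(x in [set: R] `*` ~` D) (expR (- x.1))%:E = 0.
  apply: null_set_integral => //; apply/measurable_EFinP.
  apply: measurableT_comp => //; apply: measurable_funN.
  exact: (measurable_funS measurableT (@subsetT _ _) measurable_fst).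
have := poisson_avoids_null (nu := lebesgue_measure \x mu) poissonX mA lA; apply: filterS => w wA i.
by apply: contrapT => tD; apply: (wA i).
Qed.

(** The exponential formula for the points (p, tau), whose marks are shifted by tau;
    it yields the same exponent as for the max-stable process associated to Z. *)
Lemma tilted_representation_orthant m (s : m.-tuple T) (x : 'I_m -> \bar R) :
  (forall j, x j != -oo) ->
  P' [set w | forall j, eta (tnth s j) w <= x j] =
  (expR (- fine (\int[P]_w score x (fun j => Z (tnth s j) w))))%:E.
Proof.
move=> xNy.
have [mutG mpX mXG] := indepG.
have Gm i : G i `<=` @measurable _ Omega' by case: mutG => _ [].
pose H i : set ((R * T) * g_sigma_algebraType (G (Some i))) :=
  [set y | D y.1.2 -> mark_score mu D (X i) x s y.1.2 y.2 <= (expR (- y.1.1))%:E].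
pose g (q : R * T) : \bar R := (expR (- q.1))%:E.
have mg : measurable_fun setT g.
  apply/measurable_EFinP; apply: measurableT_comp => //; apply: measurable_funN.
  exact: measurable_fst.
have g0 q : 0 <= g q by rewrite lee_fin expR_ge0.
have gfin q : g q \is a fin_num by [].
pose M w := score x (fun j => Z (tnth s j) w - lne (path_integral mu Z expeR D w)).
have mI := measurable_path_integral mu mD mZD measurable_expeR
  (@expeR_ge0 R) mD (@subset_refl _ D).
have mM : measurable_fun setT M.
  apply: measurable_score => j; apply: emeasurable_funB => //.
  exact: (measurableT_comp measurable_lne mI).
have M0 w : 0 <= M w by exact: score_ge0.
have mF := measurable_tilted_cdf P mD mZD mM.
have mH i : measurable (H i) by exact: measurable_mark_event.
have PH i q : P' (xsection (H i) q) = (tilted_cdf P Z D M q)%:E.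
  have [procX fddX] := Xi0 i.
  rewrite -(mark_event_probability procZ expZ mu mD mZD s x (Gm (Some i)) statZ procX
    (mX i) fddX).
  by congr (P' _); apply/seteqP; split => w; rewrite /xsection/= inE.
have intE : \int[lebesgue_measure \x mu]_q ((1 - tilted_cdf P Z D M q)%:E * g q) =
    \int[P]_w score x (fun j => Z (tnth s j) w).
  rewrite -(integral_normalized_score procZ mD muD mZD totalZ s x).
  exact: integral_tilted_cdf.
have intfin : \int[P]_w score x (fun j => Z (tnth s j) w) < +oo.
  exact: (score_integrable procZ expZ (tnth s)).
have := marked_poisson_avoidance (nu := lebesgue_measure \x mu) mg g0 gfin poissonX
  mutG mpX mH mF PH.
rewrite intE => /(_ intfin) <-.
have mE : measurable [set w | forall j, eta (tnth s j) w <= x j].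
  apply: measurable_forall_ord => j; rewrite -[X in measurable X]setTI.
  exact: measurable_lee.
have mHi i : measurable [set w | H i ((p i w, tau i w), w)].
  have mXG' : measurable_fun [set: Omega'] (fun w => (p i w, tau i w)).
    by case: poissonX.
  have := measurable_fun_pair mXG' (measurable_id_sub (Gm (Some i))) measurableT (mH i).
  by rewrite setTI.
apply: ae_eq_measure => //; first exact: bigcapT_measurable.
have etaE' : {ae P', forall w, forall j, eta (tnth s j) w =
    ereal_sup (range (fun i => (p i w)%:E + Lshift (tau i w) (X i) (tnth s j) w
      - lne (\int[mu]_s expeR (Lshift (tau i w) (X i) s w))))}.
  by apply: filter_forall => j; exact: etaE.
apply: filterS2 tau_in_D etaE' => w tauD etaw; split => [wx i _ /= Di|wx j].
  apply/le_score => // j; apply: le_trans (wx j); rewrite etaw.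
  apply: ereal_sup_ubound; exists i => //.
  by rewrite addeA (integral_conull mD muD)// => u; exact: expeR_ge0.
rewrite etaw; apply: ge_ereal_sup => _ [i _ <-].
have /le_score := wx i I (tauD i); rewrite -addeA (integral_conull mD muD).
  by apply.
by move=> u; exact: expeR_ge0.
Qed.

Context dz (Omegaz : measurableType dz) (Pz : probability Omegaz R).
Variable zeta : T -> Omegaz -> \bar R.
Hypothesis zetaZ : max_stable Pz zeta P Z.

Theorem tilted_representation : fdd_eq Pz zeta P' eta.
Proof.
apply: fdd_eq_orthants => // [t||m s x xNy].
- exact: (max_stable_measurable zetaZ).
- by rewrite [X in X < _]probability_setT ltry.
apply/esym; apply: (etrans (tilted_representation_orthant s xNy)); apply/esym.
apply: (max_stable_orthant procZ zetaZ xNy).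
exact: (score_integrable procZ expZ (tnth s)).
Qed.

End tilted_representation_law.

(** * Countable products of a probability space *)

Section sequence_space.
Context d (T : measurableType d).

Definition coordinate_events : set (set (nat -> T)) :=
  \bigcup_i preimage_set_system setT (fun f : nat -> T => f i) measurable.

Definition sequences : Type := g_sigma_algebraType coordinate_events.
HB.instance Definition _ := Measurable.copy sequences
  (g_sigma_algebraType coordinate_events).

Definition scons (x : T) (f : nat -> T) (i : nat) : T := if i is j.+1 then f j else x.

Lemma measurable_coordinate i : measurable_fun [set: sequences] (fun f : sequences => f i).
Proof.
move=> _ B mB; rewrite setTI; apply: sub_sigma_algebra.
by exists i => //; exists B => //; rewrite setTI.
Qed.

Lemma measurable_scons :
  measurable_fun [set: T * sequences] (fun y => scons y.1 y.2 : sequences).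
Proof.
apply: (@measurability _ _ (T * sequences)%type sequences setT _ coordinate_events erefl).
move=> _ [_ [i _ [B mB <-]] <-]; rewrite !setTI.
have mi : measurable_fun [set: T * sequences] (fun y => scons y.1 y.2 i).
  case: i => [|i] /=; first exact: measurable_fst.
  exact: (measurableT_comp (measurable_coordinate i) measurable_snd).
by have := mi measurableT B mB; rewrite setTI.
Qed.

Definition depends_on_first (n : nat) (A : set sequences) :=
  forall f g : sequences, (forall i, (i < n)%N -> f i = g i) -> A f -> A g.

Definition cylinder (A : set sequences) := measurable A /\ exists n, depends_on_first n A.

Definition tail_section (A : set sequences) (x : T) : set sequences :=
  [set f | A (scons x f)].

Lemma measurable_tail_section A x : measurable A -> measurable (tail_section A x).
Proof.
move=> mA; have mx : measurable_fun [set: sequences] (fun f : sequences => (x, f)).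
  exact: measurable_fun_pair.
by have := (measurableT_comp measurable_scons mx) measurableT A mA; rewrite setTI.
Qed.

Lemma depends_on_firstW n m A : (n <= m)%N ->
  depends_on_first n A -> depends_on_first m A.
Proof. by move=> nm An f g fg; apply: An => i /leq_trans/(_ nm); exact: fg. Qed.

Lemma depends_tail_section n A x : depends_on_first n.+1 A ->
  depends_on_first n (tail_section A x).
Proof. by move=> An f g fg; apply: An => -[|i]//=; rewrite ltnS; exact: fg. Qed.

Lemma cylinder_tail_section A x : cylinder A -> cylinder (tail_section A x).
Proof.
move=> [mA [n An]]; split; first exact: measurable_tail_section.
by exists n; apply: depends_tail_section; exact: depends_on_firstW An.
Qed.

Lemma cylinder0 : cylinder set0.
Proof. by split => //; exists 0%N. Qed.

Lemma cylinderU A B : cylinder A -> cylinder B -> cylinder (A `|` B).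
Proof.
move=> [mA [n An]] [mB [m Bm]]; split; first exact: measurableU.
exists (maxn n m) => f g fg [Af|Bf]; [left|right].
- by apply: An Af => i i_n; apply: fg; rewrite leq_max i_n.
- by apply: Bm Bf => i i_m; apply: fg; rewrite leq_max i_m orbT.
Qed.

Lemma cylinderC A : cylinder A -> cylinder (~` A).
Proof.
move=> [mA [n An]]; split; first exact: measurableC.
by exists n => f g fg Af Ag; apply: Af; apply: An Ag => i i_n; rewrite fg.
Qed.

Lemma cylinder_coordinate i B : measurable B -> cylinder [set f | B (f i)].
Proof.
move=> mB; split.
  by have := measurable_coordinate i measurableT mB; rewrite setTI.
by exists i.+1 => f g fg /=; rewrite fg.
Qed.

Context (R : realType) (Q : probability T R).

(** The law of a sequence whose first n entries are independent with law Q, and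
    whose other entries are constant. *)
Fixpoint prefix_law (n : nat) : probability sequences R :=
  if n is m.+1 then image_measure (Q \x prefix_law m) measurable_scons
  else dirac (point : sequences).

(** Integration with respect to the first entry *)
Lemma prefix_lawS n A : measurable A ->
  prefix_law n.+1 A = \int[Q]_x prefix_law n (tail_section A x).
Proof.
move=> mA; apply: eq_integral => x _ /=; congr (prefix_law n _).
by apply/seteqP; split => f; rewrite /xsection/= inE.
Qed.

Lemma measurable_prefix_law n A : measurable A ->
  measurable_fun setT (fun x => prefix_law n (tail_section A x)).
Proof.
move=> mA; have mC : measurable ((fun y : T * sequences => scons y.1 y.2) @^-1` A).
  by have := measurable_scons measurableT mA; rewrite setTI.
have := measurable_fun_xsection (prefix_law n) mC; congr measurable_fun.
apply/funext => x /=; congr (prefix_law n _).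
by apply/seteqP; split => f; rewrite /xsection/= inE.
Qed.

(** The entries beyond the first n do not matter to such a set. *)
Lemma prefix_law_stable n k A : measurable A -> depends_on_first n A ->
  (n <= k)%N -> prefix_law k A = prefix_law n A.
Proof.
elim: n k A => [|n ih] k A mA An nk.
  have [[f Af]|A0] := pselect (exists f, A f).
    have -> : A = setT by apply/seteqP; split => // g _; exact: An Af.
    by rewrite !probability_setT.
  have -> : A = set0 by apply/seteqP; split => // g Ag; apply: A0; exists g.
  by rewrite !measure0.
case: k nk => // k nk; rewrite !prefix_lawS//; apply: eq_integral => x _.
by apply: ih => //; [exact: measurable_tail_section|exact: depends_tail_section].
Qed.

Lemma prefix_law_box n (E : nat -> set T) : (forall i, measurable (E i)) ->
  prefix_law n [set f | forall i, (i < n)%N -> E i (f i)] = \prod_(i < n) Q (E i).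
Proof.
have mbox m (F : nat -> set T) : (forall i, measurable (F i)) ->
    measurable [set f : sequences | forall i, (i < m)%N -> F i (f i)].
  move=> mF; rewrite (_ : [set f | _] = \bigcap_(i in [set i | (i < m)%N])
      [set f : sequences | F i (f i)])//.
  by apply: bigcap_measurableType => i _; have [] := cylinder_coordinate i (mF i).
elim: n E => [|n ih] E mE.
  rewrite big_ord0 (_ : [set f | _] = setT) ?probability_setT//.
  by apply/seteqP; split.
rewrite prefix_lawS; last exact: mbox.
rewrite big_ord_recl -(ih (fun i => E i.+1))//.
transitivity (\int[Q]_x ((\1_(E 0%N) x)%:E *
    prefix_law n [set f | forall i, (i < n)%N -> E i.+1 (f i)])).
  apply: eq_integral => x _; rewrite indicE; have [xE|xE] := boolP (x \in E 0%N).
    rewrite mul1e; congr (prefix_law n _); apply/seteqP; split => f /=.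
      by move=> fE i i_n; have := fE i.+1 i_n.
    by move=> fE [|i] /=; [move=> _; exact/set_mem|rewrite ltnS; exact: fE].
  rewrite mul0e (_ : tail_section _ _ = set0) ?measure0//.
  apply/seteqP; split => // f /= /(_ 0%N isT)/= Ex.
  by move: xE; rewrite mem_set.
rewrite -[prefix_law n _]fineK ?fin_num_measure//; last exact: (mbox n (fun i => E i.+1)).
under eq_integral do rewrite muleC.
rewrite ge0_integralZl_EFin ?fine_ge0//.
- by rewrite integral_indic// setIT muleC.
- exact/measurable_EFinP/measurable_indic.
Qed.

End sequence_space.

Section infinite_product.
Context d (T : measurableType d) (R : realType) (Q : probability T R).

Definition cylinder_space : Type := sequences T.
HB.instance Definition _ := Pointed.on cylinder_space.
HB.instance Definition _ := @isAlgebraOfSets.Build default_measure_display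
  cylinder_space (@cylinder d T) (@cylinder0 d T) (@cylinderU d T) (@cylinderC d T).

(** The eventual value of the probabilities of A under the prefix laws; it exists
    for cylinders. *)
Definition cylinder_probability (A : set cylinder_space) : \bar R :=
  xget 0 [set y | \forall n \near \oo, prefix_law Q n A = y].
Local Notation prob := cylinder_probability.

Lemma cylinder_probabilityE n A : measurable (A : set (sequences T)) ->
  depends_on_first n A -> prob A = prefix_law Q n A.
Proof.
move=> mA An; apply: xget_unique => /= [|y].
  by exists n => // m /= nm; exact: prefix_law_stable.
move=> [m _ my]; rewrite -(my (maxn n m)) /=; last exact: leq_maxr.
by rewrite (prefix_law_stable Q mA An)// leq_maxl.
Qed.

Lemma cylinder_probability_ge0 A : 0 <= prob A.
Proof.
rewrite /prob; case: xgetP => //= y _ [m _ my].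
by rewrite -(my m)/=.
Qed.

Lemma cylinder_probability_tail A : cylinder A ->
  prob A = \int[Q]_x prob (tail_section A x).
Proof.
move=> [mA [n An]].
rewrite (@cylinder_probabilityE n.+1)//; last exact: depends_on_firstW An.
rewrite prefix_lawS//; apply: eq_integral => x _.
rewrite (@cylinder_probabilityE n)//; first exact: measurable_tail_section.
by apply: depends_tail_section; exact: depends_on_firstW An.
Qed.

Lemma measurable_cylinder_probability_tail A : cylinder A ->
  measurable_fun setT (fun x => prob (tail_section A x)).
Proof.
move=> [mA [n An]]; rewrite (_ : (fun x => _) =
    fun x => prefix_law Q n (tail_section A x)); first exact: measurable_prefix_law.
apply/funext => x; rewrite (@cylinder_probabilityE n)//.
  exact: measurable_tail_section.
by apply: depends_tail_section; exact: depends_on_firstW An.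
Qed.

Lemma cylinder_probability_le1 A : cylinder A -> prob A <= 1.
Proof.
by move=> [mA [n An]]; rewrite (cylinder_probabilityE mA An) probability_le1.
Qed.

Lemma le_cylinder_probability A B : cylinder A -> cylinder B -> A `<=` B ->
  prob A <= prob B.
Proof.
move=> [mA [n An]] [mB [m Bm]] AB.
rewrite (@cylinder_probabilityE (maxn n m))//; last first.
  by apply: depends_on_firstW An; exact: leq_maxl.
rewrite (@cylinder_probabilityE (maxn n m) B)//; last first.
  by apply: depends_on_firstW Bm; exact: leq_maxr.
by apply: le_measure => //; rewrite inE.
Qed.

Section decreasing_cylinders.

(** The hypothesis under which decreasing cylinders have a common element *)
Definition persistent (A : nat -> set (sequences T)) :=
  [/\ forall n, cylinder (A n), nonincreasing_seq A &
      exists2 e : R, (0 < e)%R & forall n, e%:E <= prob (A n)].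

(** Otherwise the probabilities of the sections would tend to 0 for every first
    entry, and so would their integrals. *)
Lemma persistent_tail A : persistent A ->
  exists x, persistent (fun n => tail_section (A n) x).
Proof.
move=> [cA ndA [e e0 eA]]; apply: contrapT => noX.
have fin x n : prob (tail_section (A n) x) \is a fin_num.
  rewrite ge0_fin_numE ?cylinder_probability_ge0//.
  apply: (@le_lt_trans _ _ 1); last exact: ltry.
  by apply: cylinder_probability_le1; exact: cylinder_tail_section.
pose f n x := fine (prob (tail_section (A n) x)).
have fE n x : (f n x)%:E = prob (tail_section (A n) x) by rewrite fineK.
have nd x : nonincreasing_seq (fun n => tail_section (A n) x).
  move=> m n mn; apply/subsetPset => g.
  by have /subsetPset := ndA _ _ mn; exact.
have cvg0 x : f n x @[n --> \oo] --> 0%R.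
  apply/cvgrPdist_lt => r r0.
  have [N fN] : exists N, (f N x < r)%R.
    apply: contrapT => /forallNP fr; apply: noX; exists x; split => //.
      by move=> n; exact: cylinder_tail_section.
    exists r => // n; rewrite -fE lee_fin leNgt; apply/negP; exact: fr.
  exists N => // n /= Nn; rewrite sub0r normrN ger0_norm.
    apply: le_lt_trans fN; rewrite -lee_fin !fE.
    apply: le_cylinder_probability; try exact: cylinder_tail_section.
    exact/subsetPset/nd.
  by rewrite -lee_fin fE cylinder_probability_ge0.
have mf n : measurable_fun setT (f n).
  by apply: measurableT_comp => //; exact: measurable_cylinder_probability_tail.
have f01 n x : (0 <= f n x <= 1)%R.
  rewrite -!lee_fin fE cylinder_probability_ge0/=.
  by apply: cylinder_probability_le1; exact: cylinder_tail_section.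
have m0 : measurable_fun [set: T] (cst 0%R : T -> R) by exact: measurable_cst.
have := bounded_cvg mf m0 f01 (aeW Q cvg0).
rewrite integral0 => lim0.
suff : e%:E <= 0 by rewrite lee_fin leNgt e0.
apply: (cvge_to_ge lim0); apply: nearW => n.
under eq_integral do rewrite fE.
by rewrite -cylinder_probability_tail.
Qed.

(** Entries are chosen one after the other, keeping the sections persistent; the
    resulting sequence belongs to every cylinder. *)
Lemma persistent_nonempty A : persistent A -> exists f, forall n, A n f.
Proof.
move=> pA.
pose next B := if pselect (persistent B) is left pB
  then projT1 (cid (persistent_tail pB)) else point.
pose step B := fun n => tail_section (B n) (next B).
pose B k := iter k step A.
have pB k : persistent (B k).
  elim: k => [//|k ih]; rewrite /B iterS -/(B k) /step /next.
  by case: pselect => // pBk; exact: (projT2 (cid (persistent_tail pBk))).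
pose f k : T := next (B k).
(* the members of B k n are the sequences that belong to A n once they are
   preceded by the first k entries of f *)
pose glue k (g : nat -> T) i := if (i < k)%N then f i else g (i - k)%N.
have BE k n g : B k n g <-> A n (glue k g).
  elim: k g => [|k ih] g.
    by rewrite (_ : glue 0%N g = g)//; apply/funext => i; rewrite /glue subn0.
  rewrite /B iterS -/(B k) /step /tail_section/= ih.
  rewrite (_ : glue k _ = glue k.+1 g)//; apply/funext => i; rewrite /glue ltnS.
  case: (ltngtP i k) => [ik|ki|->].
  - by [].
  - by rewrite -[(i - k)%N]prednK ?subn_gt0//= subnS.
  - by rewrite subnn.
exists f => n; have [cA _ _] := pA; have [mA [m Am]] := cA n.
have [cB _ [e e0 eB]] := pB m.
have [[g Bg]|B0] := pselect (exists g, B m n g).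
  by move/BE : Bg; apply: Am => i im; rewrite /glue im.
have := eB n; rewrite (_ : B m n = set0); last first.
  by apply/seteqP; split => // g Bg; apply: B0; exists g.
rewrite (@cylinder_probabilityE 0%N)// measure0 lee_fin leNgt e0//.
Qed.

End decreasing_cylinders.
End infinite_product.

Section product_measure.
Context d (T : measurableType d) (R : realType) (Q : probability T R).
Local Notation prob := (cylinder_probability Q).

Lemma cylinder_probabilityD A B : cylinder A -> cylinder B -> A `<=` B ->
  prob B = prob A + prob (B `\` A).
Proof.
move=> cA cB AB; have [mA [n An]] := cA; have [mB [m Bm]] := cB.
have An' : depends_on_first (maxn n m) A.
  by apply: depends_on_firstW An; exact: leq_maxl.
have Bm' : depends_on_first (maxn n m) B.
  by apply: depends_on_firstW Bm; exact: leq_maxr.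
have BA : depends_on_first (maxn n m) (B `\` A).
  move=> f g fg [Bf Af]; split; first exact: Bm' Bf.
  by move=> Ag; apply: Af; apply: An' Ag => i im; rewrite fg.
rewrite !(@cylinder_probabilityE _ _ _ _ (maxn n m))//; last exact: measurableD.
rewrite -measureU//; last 2 first.
- exact: measurableD.
- by rewrite setDE setICA setICr setI0.
by rewrite setDUK.
Qed.

Let prob0 : prob set0 = 0.
Proof. by rewrite (@cylinder_probabilityE _ _ _ _ 0%N). Qed.

(** Countable additivity on cylinders amounts to continuity at the empty set, which
    is [persistent_nonempty]. *)
Let prob_semi_sigma_additive :
  semi_sigma_additive (prob : set (cylinder_space T) -> \bar R).
Proof.
move=> F cF tF cU; set U := \bigcup_n F n.
pose D n : set (cylinder_space T) := U `\` \big[setU/set0]_(i < n) F i.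
have cD n : cylinder (D n).
  have : measurable (D n) by apply: measurableD => //; exact: bigsetU_measurable.
  exact.
have DS n : D n = F n `|` D n.+1.
  rewrite /D big_ord_recr/= setDUr; apply/seteqP; split => f.
    move=> [Uf Df]; have [Ff|Ff] := pselect (F n f); [by left|right].
    by split.
  move=> [Ff|[]//]; split; first by exists n.
  rewrite -bigcup_mkord => -[i /= i_n Fi].
  by move: i_n; rewrite (tF i n I I) ?ltnn//; exists f.
have DF n : D n.+1 = D n `\` F n.
  rewrite (DS n) setDUl setDv set0U; apply/seteqP; split => [f Df|f []//].
  by split => // Ff; case: Df => _; apply; rewrite big_ord_recr/=; right.
have splitU n : prob U = \sum_(i < n) prob (F i) + prob (D n).
  elim: n => [|n ih]; first by rewrite big_ord0 add0e /D big_ord0 setD0.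
  rewrite ih big_ord_recr/= -addeA; congr (_ + _).
  rewrite DF; apply: cylinder_probabilityD => //; first exact: cF.
  by rewrite DS; left.
have fin A : cylinder A -> prob A \is a fin_num.
  move=> cA; rewrite ge0_fin_numE ?cylinder_probability_ge0//.
  by apply: (le_lt_trans (cylinder_probability_le1 Q cA)); rewrite ltry.
have ndD : nonincreasing_seq D.
  by apply/nonincreasing_seqP => n; apply/subsetPset; rewrite DF; exact: subDsetl.
have D0 : prob (D n) @[n --> \oo] --> 0.
  apply/fine_cvgP; split; first by apply: nearW => n; exact: fin.
  apply/cvgrPdist_lt => r r0.
  have [N DN] : exists N, prob (D N) < r%:E.
    apply: contrapT => /forallNP Dr.
    have [|f Df] := @persistent_nonempty _ _ _ Q D.
      split => //; exists r => // n; rewrite leNgt; apply/negP; exact: Dr.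
    have [[n _ Ff] _] := Df 0%N.
    by have := Df n.+1; rewrite DF => -[].
  exists N => // n /= Nn; rewrite sub0r normrN ger0_norm; last first.
    by rewrite fine_ge0// cylinder_probability_ge0.
  rewrite -lte_fin fineK ?fin//; apply: le_lt_trans DN.
  by apply: le_cylinder_probability => //; exact/subsetPset/ndD.
rewrite (_ : (fun n => _) = fun n => prob U - prob (D n)); last first.
  by apply/funext => n; rewrite big_mkord (splitU n) addeK// fin.
rewrite -[X in _ --> X]sube0; apply: cvgeB => //; last exact: cvg_cst.
by rewrite fin_num_adde_defl// fin.
Qed.

HB.instance Definition _ := isMeasure.Build _ _ _
  (cylinder_probability Q : set (cylinder_space T) -> \bar R)
  prob0 (@cylinder_probability_ge0 _ _ _ Q) prob_semi_sigma_additive.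

(** The law of a sequence of independent variables with law Q *)
Definition product_law :=
  measure_extension (cylinder_probability Q : set (cylinder_space T) -> \bar R).

HB.instance Definition _ := Measure.on product_law.

Lemma product_law_cylinder A : cylinder A -> product_law A = prob A.
Proof. by move=> cA; rewrite /product_law /measure_extension/= measurable_mu_extE. Qed.

Let product_lawT : product_law setT = 1.
Proof.
rewrite product_law_cylinder; last by split => //; exists 0%N.
by rewrite (@cylinder_probabilityE _ _ _ _ 0%N)// probability_setT.
Qed.

HB.instance Definition _ := Measure_isProbability.Build _ _ _ product_law product_lawT.

Local Notation S := (g_sigma_algebraType (@measurable _ (cylinder_space T))).

Lemma measurable_entry i : measurable_fun [set: S] (fun f : S => f i).
Proof.
move=> _ B mB; rewrite setTI; apply: sub_sigma_algebra.
exact: (cylinder_coordinate i mB).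
Qed.

Lemma product_law_independent (s : seq nat) (B : nat -> set T) : uniq s ->
  (forall i, measurable (B i)) ->
  product_law (\bigcap_(i in [set` s]) [set f | B i (f i)]) = \prod_(i <- s) Q (B i).
Proof.
move=> us mB.
pose n := (\max_(i <- s) i).+1.
have sn i : i \in s -> (i < n)%N by move=> si; rewrite ltnS; exact: leq_bigmax_seq.
pose E i := if i \in s then B i else setT.
have mE i : measurable (E i) by rewrite /E; case: ifP.
have boxE : \bigcap_(i in [set` s]) [set f | B i (f i)] =
    [set f : sequences T | forall i, (i < n)%N -> E i (f i)].
  apply/seteqP; split => f fE i /=.
    by move=> _; rewrite /E; case: ifP => // si; exact: fE.
  by move=> si; have := fE i (sn _ si); rewrite /E si.
have An : depends_on_first n [set f : sequences T | forall i, (i < n)%N -> E i (f i)].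
  by move=> f g fg fE i i_n; rewrite -fg//; exact: fE.
have mA : measurable [set f : sequences T | forall i, (i < n)%N -> E i (f i)].
  rewrite (_ : [set f | _] = \bigcap_(i in [set i | (i < n)%N])
      [set f : sequences T | E i (f i)])//.
  by apply: bigcap_measurableType => i _; have [] := cylinder_coordinate i (mE i).
rewrite boxE product_law_cylinder; last by split => //; exists n.
rewrite (cylinder_probabilityE _ mA An) prefix_law_box//.
rewrite -(big_mkord xpredT (fun i => Q (E i))).
rewrite (eq_bigr (fun i => if i \in s then Q (B i) else 1)); last first.
  by move=> i _; rewrite /E; case: ifP => // _; rewrite probability_setT.
rewrite -big_mkcond -big_filter; apply: perm_big; apply: uniq_perm => //.
  by rewrite filter_uniq// iota_uniq.
move=> i; rewrite mem_filter mem_index_iota /=.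
by case si : (i \in s) => //=; rewrite sn.
Qed.

End product_measure.

(** * Representation by a tilt at a single time *)

Lemma measurable_time_singleton (R : realType) k n (a : time R k n) : measurable [set a].
Proof.
rewrite -[X in measurable X]setCK; apply: measurableC; apply: sub_sigma_algebra.
case: k a => [a|//]; rewrite /time_open/= openC.
apply: accessible_closed_set1; apply: hausdorff_accessible.
exact: norm_hausdorff.
Qed.

Section centred_process.
Context (R : realType) (T : zmodType).
Context d (Omega : measurableType d) (P : probability Omega R).
Variable Z : T -> Omega -> \bar R.
Hypothesis procZ : process Z.
Hypothesis expZ : forall t, \int[P]_w expeR (Z t w) = 1.
Hypothesis finZ : P [set w | -oo < Z 0%R w] = 1.

Let mZ t : measurable_fun setT (Z t). Proof. by case: procZ. Qed.
Let Zy t w : Z t w != +oo. Proof. by case: procZ. Qed.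

(** A version of the tilted process Xi 0 Z that does not take the value +oo, and
    that is 0 at the origin everywhere *)
Definition centred (t : T) (w : Omega) : \bar R :=
  if Z 0%R w == -oo then 0 else Z t w - Z 0%R w.

Lemma centred0 w : centred 0%R w = 0.
Proof.
rewrite /centred; case: ifPn => // z0; rewrite subee// fin_numE z0.
exact: Zy.
Qed.

Lemma process_centred : process centred.
Proof.
split => [t|t w]; last first.
  rewrite /centred; case: ifPn => // z0; exact: sube_neq_y.
rewrite /centred; apply: measurable_fun_ifT => //; last exact: emeasurable_funB.
exact: measurable_fun_eqe.
Qed.

Lemma fdd_eq_centred n (s : n.-tuple T) (B : set (n.-tuple (\bar R))) :
  measurable B ->
  tilt P Z 0%R [set w | B (values s centred w)] = fdd (tilt P Z 0%R) (Xi 0%R Z) s B.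
Proof.
move=> mB; rewrite /fdd /tilt integral_mkcond [RHS]integral_mkcond.
apply: eq_integral => w _; rewrite !patchE.
have [z0|z0] := eqVneq (Z 0%R w) -oo; first by rewrite z0 /=; do 2 case: ifP.
suff E : values s centred w = [tuple Xi 0%R Z (tnth s j) w | j < n].
  rewrite (_ : (w \in [set w | B (values s centred w)]) =
      (w \in [set w | B [tuple Xi 0%R Z (tnth s j) w | j < n]]))//.
  by apply/idP/idP => /set_mem/= wB; apply/mem_set; rewrite /= -?E// E.
by apply: eq_mktuple => j; rewrite /centred (negbTE z0).
Qed.

(** The density exp (Z 0) of the tilt compensates the centring at 0. *)
Lemma integral_score_centred n (x : 'I_n -> \bar R) (u : 'I_n -> T) :
  \int[tilted_law procZ expZ 0%R]_w score x (fun j => centred (u j) w) =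
  \int[P]_w score x (fun j => Z (u j) w).
Proof.
have [mC _] := process_centred.
have mS : measurable_fun setT (fun w => score x (fun j => centred (u j) w)).
  by apply: measurable_score => j; exact: mC.
rewrite [LHS](integral_tilted_law procZ expZ 0%R mS (fun=> score_ge0 _ _)).
have mfin : measurable [set w | -oo < Z 0%R w].
  by rewrite -[X in measurable X]setTI; apply: measurable_lte.
apply: ge0_ae_eq_integral => //.
- by apply: emeasurable_funM => //; exact: measurable_expZ.
- exact: measurable_score.
- by move=> w _; rewrite mule_ge0 ?expeR_ge0 ?score_ge0.
- by move=> w _; exact: score_ge0.
apply: filterS (ae_of_probability1 mfin finZ) => w /= z0 _.
have zfin : Z 0%R w \is a fin_num by rewrite fin_numE Zy andbT gt_eqF.
rewrite /centred gt_eqF// scoreB// muleA -expeRD subee//.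
by rewrite /= expR0 mul1e.
Qed.

End centred_process.

Section singleton_domain.
Context dT (T : measurableType dT) (R : realType) (a : T).
Hypothesis ma : measurable [set a].

Lemma integral_dirac_singleton (f : T -> \bar R) : (forall t, 0 <= f t) ->
  \int[dirac a]_t f t = f a.
Proof.
move=> f0; rewrite (integral_conull ma)//; last by rewrite /= diracE in_setC in_set1 eqxx.
rewrite integral_dirac//; last exact: measurable_fun_set1.
by rewrite diracE in_set1 eqxx mul1e.
Qed.

Lemma measurable_paths_singleton d (Omega : measurableType d) (Y : T -> Omega -> \bar R) :
  measurable_fun setT (Y a) -> measurable_paths [set a] Y.
Proof.
move=> mY; have m2 : measurable_fun setT (fun x : T * Omega => Y a x.2).
  exact: (measurableT_comp mY measurable_snd).
have := measurable_funS measurableT (@subsetT _ ([set a] `*` setT)) m2.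
by apply: eq_measurable_fun => -[t w]; rewrite inE => -[/= -> _].
Qed.

End singleton_domain.

Section sequence_of_copies.
Context (R : realType).
Context d1 (Omega1 : measurableType d1) (P1 : probability Omega1 R).
Context d2 (Omega2 : measurableType d2) (P2 : probability Omega2 R).
Local Notation E := (Omega1 * Omega2)%type.

Definition copies_law := product_law (P1 \x P2).
Definition copies : Type := g_sigma_algebraType (@measurable _ (cylinder_space E)).
HB.instance Definition _ := Measurable.copy copies
  (g_sigma_algebraType (@measurable _ (cylinder_space E))).

(** The first source of randomness is read in entry 0, and the independent copies
    of the second one in the entries 1, 2, etc. *)
Definition first_source (w : copies) : Omega1 := (w 0%N).1.
Definition second_source (i : nat) (w : copies) : Omega2 := (w i.+1).2.

Let entry_index (j : option nat) : nat := if j is Some i then i.+1 else 0%N.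

Definition entry_events (j : option nat) : set (set copies) :=
  preimage_set_system setT (fun w : copies => w (entry_index j)) measurable.

Lemma copies_law_entry i (A : set E) : measurable A ->
  (copies_law : probability copies R) [set w | A (w i)] = (P1 \x P2) A.
Proof.
move=> mA; have := @product_law_independent _ _ _ (P1 \x P2) [:: i] (fun=> A) isT (fun=> mA).
rewrite big_seq1 => <-; congr (product_law _ _).
apply/seteqP; split => w /=; first by move=> wA j; rewrite /= inE => /eqP ->.
by move=> /(_ i); apply; rewrite /= inE.
Qed.

Lemma first_source_law (A : set Omega1) : measurable A ->
  (copies_law : probability copies R) [set w | A (first_source w)] = P1 A.
Proof.
move=> mA; have mAT : measurable (A `*` [set: Omega2]) by exact: measurableX.
rewrite (_ : [set w | _] = [set w : copies | (A `*` [set: Omega2]) (w 0%N)]).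
  rewrite copies_law_entry//; transitivity (P1 A * P2 setT).
    exact: product_measure1E.
  by rewrite probability_setT mule1.
by apply/seteqP; split => w //= [].
Qed.

Lemma second_source_law i (A : set Omega2) : measurable A ->
  (copies_law : probability copies R) [set w | A (second_source i w)] = P2 A.
Proof.
move=> mA; have mAT : measurable ([set: Omega1] `*` A) by exact: measurableX.
rewrite (_ : [set w | _] = [set w : copies | ([set: Omega1] `*` A) (w i.+1)]).
  rewrite copies_law_entry//; transitivity (P1 setT * P2 A).
    exact: product_measure1E.
  by rewrite probability_setT mul1e.
by apply/seteqP; split => w //= [].
Qed.

Lemma measurable_first_source : measurable_fun setT first_source.
Proof. exact: (measurableT_comp measurable_fst (measurable_entry 0)). Qed.

Lemma measurable_second_source i : measurable_fun setT (second_source i).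
Proof. exact: (measurableT_comp measurable_snd (measurable_entry i.+1)). Qed.

Lemma measurable_first_source_entry :
  measurable_fun [set: g_sigma_algebraType (entry_events None)] first_source.
Proof.
move=> _ A mA; apply: sub_sigma_algebra; exists (A `*` setT) => //.
  exact: measurableX.
by apply/seteqP; split => w /= [] // _ [].
Qed.

Lemma measurable_second_source_entry i :
  measurable_fun [set: g_sigma_algebraType (entry_events (Some i))] (second_source i).
Proof.
move=> _ A mA; apply: sub_sigma_algebra; exists (setT `*` A) => //.
  exact: measurableX.
by apply/seteqP; split => w /= [] // _ [].
Qed.

Lemma entry_events_independent :
  mutually_independent (copies_law : probability copies R) entry_events.
Proof.
have mentry i := @measurable_entry _ E i.
split; first by move=> j; apply: sigma_algebra_preimage; exact: sigma_algebra_measurable.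
split.
  by move=> j _ [A mA <-]; exact: mentry.
move=> s F us sF.
pose B j := if pselect (entry_events j (F j)) is left Fj
  then projT1 (cid2 Fj) else setT.
have BP j : entry_events j (F j) ->
    measurable (B j) /\ F j = [set w | B j (w (entry_index j))].
  move=> Fj; rewrite /B; case: pselect => // Fj'; case: cid2 => /= C mC CF; split => //.
  by rewrite -CF setTI.
have mB j : measurable (B j).
  rewrite /B; case: pselect => // Fj'; by case: cid2.
pose index j : option nat := if j is i.+1 then Some i else None.
have indexK j : index (entry_index j) = j by case: j.
have inj : injective entry_index by exact: can_inj indexK.
have us' : uniq (map entry_index s) by rewrite map_inj_uniq.
have := @product_law_independent _ _ _ (P1 \x P2) _ (fun i => B (index i)) us'
  (fun i => mB _).
rewrite big_map => prodE.
rewrite (_ : \bigcap_(j in [set` s]) F j =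
  \bigcap_(i in [set` map entry_index s]) [set f | B (index i) (f i)]).
  rewrite [LHS]prodE; apply: eq_big_seq => j js.
  by have [mBj ->] := BP j (sF j js); rewrite indexK copies_law_entry.
apply/seteqP; split => w wF.
  move=> i /mapP[j js ->]; have := wF j js.
  by have [_ ->] := BP j (sF j js); rewrite /= indexK.
move=> j js; have [_ ->] := BP j (sF j js).
by have := wF (entry_index j) (map_f _ js); rewrite /= indexK.
Qed.

End sequence_of_copies.

Section dirac_representation.
Context (R : realType) (k : time_kind) (n : nat).
Local Notation T := (time R k n).
Context d (Omega : measurableType d) (P : probability Omega R).
Variable Z : T -> Omega -> \bar R.
Hypothesis procZ : process Z.
Hypothesis expZ : forall t, \int[P]_w expeR (Z t w) = 1.
Hypothesis finZ : P [set w | -oo < Z 0%R w] = 1.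
Context dz (Omegaz : measurableType dz) (Pz : probability Omegaz R).
Variables (p : nat -> Omegaz -> R) (a : T).
Hypothesis poissonp : poisson_process Pz p
  (fun A => \int[lebesgue_measure]_(x in A) (expR (- x))%:E).

Local Notation Q := (tilted_law procZ expZ 0%R).
Local Notation Omega' := (copies Omegaz Omega).
Local Notation P' := (copies_law Pz Q : probability Omega' R).
Local Notation G := (@entry_events _ Omegaz _ Omega).

Let point_p i (w : Omega') : R := p i (first_source w).
Let mark i (t : T) (w : Omega') : \bar R := centred Z t (second_source i w).
Let eta (t : T) (w : Omega') : \bar R :=
  ereal_sup (range (fun i => (point_p i w)%:E + Lshift a (mark i) t w)).

Let mp i : measurable_fun setT (p i). Proof. by case: poissonp. Qed.

Let measurable_mark_entry i t :
  measurable_fun [set: g_sigma_algebraType (G (Some i))] (mark i t).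
Proof.
have [mC _] := process_centred procZ.
exact: (measurableT_comp (mC t) (@measurable_second_source_entry _ Omegaz _ Omega i)).
Qed.

Let measurable_mark i t : measurable_fun setT (mark i t).
Proof.
have [mC _] := process_centred procZ.
exact: (measurableT_comp (mC t) (@measurable_second_source _ Omegaz _ Omega i)).
Qed.

Let process_mark i : process (mark i).
Proof.
split => [t|t w]; first exact: measurable_mark.
by have [_ Cy] := process_centred procZ; exact: Cy.
Qed.

Let fdd_eq_mark i : fdd_eq P' (mark i) Q (centred Z).
Proof.
move=> m s B mB; rewrite /fdd.
have mC : measurable [set w | B [tuple centred Z (tnth s j) w | j < m]].
  have [mC _] := process_centred procZ.
  by have := measurable_values s mC measurableT mB; rewrite setTI.
exact: (second_source_law Pz Q i mC).
Qed.

Let fdd_eq_mark_tilt i : fdd_eq P' (mark i) (tilt P Z 0%R) (Xi 0%R Z).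
Proof.
move=> m s B mB; apply: (etrans (fdd_eq_mark i s mB)).
exact: (fdd_eq_centred P Z s mB).
Qed.

Let poisson_point : poisson_process P' point_p
  (fun A => \int[lebesgue_measure]_(x in A) (expR (- x))%:E).
Proof.
have [_ count indep] := poissonp.
have mcount A : measurable A -> measurable_fun setT (point_count (R := R) p A).
  move=> mA; exact: (measurable_point_count (nu := lebesgue_measure) poissonp mA).
have eventE (C : set Omegaz) : measurable C ->
    P' [set w | C (first_source w)] = Pz C by exact: first_source_law.
have mevent A (x : \bar R) : measurable A -> measurable [set w | point_count (R := R) p A w = x].
  by move=> mA; rewrite -[X in measurable X]setTI; exact: (mcount A mA measurableT [set x]).
split.
- move=> i; exact: (measurableT_comp (mp i) (@measurable_first_source _ Omegaz _ Omega)).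
- move=> A m mA lA; rewrite -count//.
  exact: (eventE _ (mevent A m%:R%:E mA)).
- move=> m A x mA tA.
  have mall : measurable [set w | forall j, point_count (R := R) p (A j) w = x j].
    by apply: measurable_forall_ord => j; exact: mevent.
  apply: (etrans (eventE _ mall)); rewrite indep//; apply: eq_bigr => j _.
  by apply/esym; exact: (eventE _ (mevent _ (x j) (mA j))).
Qed.

(** Counting the points (p i, a) in A amounts to counting the points p i in the
    section of A at a. *)
Let poisson_marked_point : poisson_process P' (fun i w => (point_p i w, a))
  (fun A => \int[lebesgue_measure \x dirac a]_(x in A) (expR (- x.1))%:E).
Proof.
have [mpp count indep] := poisson_point.
pose sec (A : set (R * T)) : set R := ysection A a.
have msec A : measurable A -> measurable (sec A) by exact: measurable_ysection.
have countE A w : point_count (R := R) (fun i w => (point_p i w, a)) A w =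
    point_count (R := R) point_p (sec A) w.
  rewrite /point_count; apply: eq_eseriesr => i _; rewrite !diracE.
  by rewrite mem_ysection.
have intE A : measurable A ->
    \int[lebesgue_measure \x dirac a]_(x in A) (expR (- x.1))%:E =
    \int[lebesgue_measure]_(x in sec A) (expR (- x))%:E.
  move=> mA; rewrite integral_mkcond [RHS]integral_mkcond fubini_tonelli2//.
  - rewrite integral_dirac_singleton//.
    + apply: eq_integral => r _; rewrite /fubini_G !patchE/=.
      by rewrite mem_ysection.
    + exact: measurable_time_singleton.
    + move=> t; apply: integral_ge0 => r _; rewrite patchE.
      by case: ifP => // _; rewrite lee_fin expR_ge0.
  - apply/(measurable_restrictT _ mA); apply/measurable_EFinP.
    apply: measurableT_comp => //; apply: measurable_funN.
    exact: (measurable_funS measurableT (@subsetT _ _) measurable_fst).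
  - by move=> q; rewrite patchE; case: ifP => // _; rewrite lee_fin expR_ge0.
split.
- by move=> i; exact: measurable_fun_pair.
- move=> A m mA; rewrite intE// => lA; rewrite -count//; last exact: msec.
  by congr (P' _); apply/seteqP; split => w /=; rewrite countE.
- move=> m A x mA tA; under eq_set do under eq_forall do rewrite countE.
  rewrite indep.
  + by apply: eq_bigr => j _; congr (P' _); apply/seteqP; split => w /=; rewrite countE.
  + by move=> j; exact: msec.
  + move=> i j _ _ [r []]; rewrite /sec /ysection/= !inE => Ai Aj.
    by apply: tA => //; exists (r, a).
Qed.

Let max_stable_eta : max_stable P' eta Q (Lshift a (centred Z)).
Proof.
exists point_p, (fun i => Lshift a (mark i)), G; split => //.
- split; first exact: entry_events_independent.
    by move=> i; exact: (measurableT_comp (mp i) (@measurable_first_source_entry _ Omegaz _ Omega)).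
  by move=> i t; exact: measurable_mark_entry.
- move=> i; split; first exact: process_Lshift.
  exact: fdd_eq_Lshift (fdd_eq_mark i).
Qed.

Let integral_mark i w : \int[dirac a]_s expeR (Lshift a (mark i) s w) = 1.
Proof.
rewrite (integral_dirac_singleton (measurable_time_singleton a)); last first.
  by move=> t; exact: expeR_ge0.
by rewrite /Lshift subrr /mark centred0//= expR0.
Qed.

Let ma : measurable [set a]. Proof. exact: measurable_time_singleton. Qed.

Let measurable_shifts_mark i : measurable_shifts [set a] (G (Some i)) (mark i).
Proof.
split => [t|].
  exact: (measurable_paths_singleton (Omega := g_sigma_algebraType (G (Some i)))
    (Y := fun u : T => mark i (t - u)%R) (@measurable_mark_entry i (t - a)%R)).
rewrite (_ : [set a] `*` [set a] = [set (a, a)]); last first.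
  by apply/seteqP; split => [[u v] [/= -> ->]|_ ->].
exact: (measurable_paths_singleton (Omega := g_sigma_algebraType (G (Some i)))
  (a := (a, a)) (Y := fun x : T * T => mark i (x.1 - x.2)%R) (@measurable_mark_entry i (a - a)%R)).
Qed.

Variable zeta : T -> Omegaz -> \bar R.

(** zeta is the max-stable mixture, with mixing measure mu, of the shifts of the tilt
    of Z at the origin. *)
Definition represents (mu : {sigma_finite_measure set T -> \bar R}) (D : set T) : Prop :=
  forall (d' : measure_display) (Omega' : measurableType d')
    (P' : probability Omega' R)
    (p : nat -> Omega' -> R) (tau : nat -> Omega' -> time R k n)
    (X : nat -> time R k n -> Omega' -> \bar R)
    (G : option nat -> set (set Omega'))
    (eta : time R k n -> Omega' -> \bar R),
  poisson_process P' (fun i w => (p i w, tau i w))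
    (fun A => \int[lebesgue_measure \x mu]_(x in A) (expR (- x.1))%:E) ->
  independent_marks P' G (fun i w => (p i w, tau i w)) X ->
  (forall i, process (X i) /\ fdd_eq P' (X i) (tilt P Z 0%R) (Xi 0%R Z)) ->
  (forall i, measurable_shifts D (G (Some i)) (X i)) ->
  (forall t, measurable_fun setT (eta t)) ->
  (forall t, {ae P', forall w, eta t w =
    ereal_sup (range (fun i => (p i w)%:E + Lshift (tau i w) (X i) t w
      - lne (\int[mu]_s expeR (Lshift (tau i w) (X i) s w))))}) ->
  fdd_eq Pz zeta P' eta.

Lemma represents_dirac : represents (dirac a) [set a] -> fdd_eq Pz zeta P' eta.
Proof.
move=> repr; apply: (repr _ _ P' point_p (fun=> cst a) mark G eta).
- exact: poisson_marked_point.
- split; first exact: entry_events_independent.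
    move=> i; apply: measurable_fun_pair => //.
    exact: (measurableT_comp (mp i) (@measurable_first_source_entry _ Omegaz _ Omega)).
  by move=> i t; exact: measurable_mark_entry.
- by move=> i; split; [exact: process_mark|exact: fdd_eq_mark_tilt].
- exact: measurable_shifts_mark.
- by move=> t; exact: (max_stable_measurable max_stable_eta).
- move=> t; apply: aeW => w; congr ereal_sup; apply/seteqP.
  by split => _ [i _ <-]; exists i => //; rewrite integral_mark lne1 sube0.
Qed.

Hypothesis zetaZ : max_stable Pz zeta P Z.

(** For the Dirac measure at a, the representation is the max-stable process of the
    tilt of Z at 0, shifted by a, and this tilt has the scores of Z. *)
Theorem represents_dirac_score m (s : m.-tuple T) (x : 'I_m -> \bar R) :
  represents (dirac a) [set a] -> (forall j, x j != -oo) ->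
  expected_score P Z s x = \int[P]_w score x (fun j => Lshift a Z (tnth s j) w).
Proof.
move=> /represents_dirac zeta_eta xNy.
have procC : process (Lshift a (centred Z)) by exact/process_Lshift/process_centred.
have scoreE j (s' : j.-tuple T) x' :
    \int[Q]_w score x' (fun i => Lshift a (centred Z) (tnth s' i) w) =
    \int[P]_w score x' (fun i => Lshift a Z (tnth s' i) w).
  exact: (integral_score_centred procZ expZ finZ x' (fun i => tnth s' i - a)%R).
have fin1 j (s' : j.-tuple T) x' : (forall i, x' i != -oo) ->
    \int[P]_w score x' (fun i => Z (tnth s' i) w) < +oo.
  by move=> x'Ny; exact: (score_integrable procZ expZ (tnth s')).
have fin2 j (s' : j.-tuple T) x' : (forall i, x' i != -oo) ->
    \int[Q]_w score x' (fun i => Lshift a (centred Z) (tnth s' i) w) < +oo.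
  move=> x'Ny; rewrite scoreE.
  exact: (score_integrable procZ expZ (fun i => tnth s' i - a)%R).
have [/(_ zeta_eta _ s x xNy) e _] :=
  max_stable_fdd_eq procZ procC zetaZ max_stable_eta fin1 fin2.
by rewrite /expected_score e scoreE.
Qed.

End dirac_representation.

(** * Equivalence of the four assertions *)

Theorem theorem2p5 (R : realType) (k : time_kind) (n : nat) (n_gt0 : (0 < n)%N)
    (d : measure_display) (Omega : measurableType d) (P : probability Omega R)
    (Z : time R k n -> Omega -> \bar R)
    (dz : measure_display) (Omegaz : measurableType dz)
    (Pz : probability Omegaz R) (zeta : time R k n -> Omegaz -> \bar R)
    (procZ : process Z)
    (expZ : forall t, \int[P]_w expeR (Z t w) = 1)
    (zetaZ : max_stable Pz zeta P Z)
    (finZ : forall h, P [set w | -oo < Z h w] = 1) :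
  [<->
    (* a *)
    forall (h : time R k n)
      (d' : measure_display) (Omega' : measurableType d')
      (P' : probability Omega' R) (zeta' : time R k n -> Omega' -> \bar R),
      max_stable P' zeta' P (Lshift h Z) -> fdd_eq Pz zeta P' zeta';
    (* b *)
    forall (mu : {sigma_finite_measure set (time R k n) -> \bar R})
      (D : set (time R k n)),
      measurable D -> mu (~` D) = 0 -> measurable_paths D Z ->
      {ae P, forall w, 0 < \int[mu]_t expeR (Z t w) < +oo} ->
      forall (d' : measure_display) (Omega' : measurableType d')
        (P' : probability Omega' R)
        (p : nat -> Omega' -> R) (tau : nat -> Omega' -> time R k n)
        (X : nat -> time R k n -> Omega' -> \bar R)
        (G : option nat -> set (set Omega'))
        (eta : time R k n -> Omega' -> \bar R),
      poisson_process P' (fun i w => (p i w, tau i w))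
        (fun A => \int[lebesgue_measure \x mu]_(x in A) (expR (- x.1))%:E) ->
      independent_marks P' G (fun i w => (p i w, tau i w)) X ->
      (forall i, process (X i) /\ fdd_eq P' (X i) (tilt P Z 0%R) (Xi 0%R Z)) ->
      (forall i, measurable_shifts D (G (Some i)) (X i)) ->
      (forall t, measurable_fun setT (eta t)) ->
      (forall t, {ae P', forall w, eta t w =
        ereal_sup (range (fun i => (p i w)%:E + Lshift (tau i w) (X i) t w
          - lne (\int[mu]_s expeR (Lshift (tau i w) (X i) s w))))}) ->
      fdd_eq Pz zeta P' eta;
    (* c *)
    forall Gamma : (time R k n -> \bar R) -> R,
      (forall f, Fminf R (time R k n) f -> (0 <= Gamma f)%R) ->
      (forall B, measurable B ->
        Fminf_measurable (Fminf R (time R k n) `&` Gamma @^-1` B)) ->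
      (forall f c, Fminf R (time R k n) f ->
        Gamma (fun t => f t + c%:E) = Gamma f) ->
      forall a h : time R k n,
        has_expectation P
          (fun w => expeR (Z (a + h)%R w) * (Gamma (Z ^~ w))%:E) ->
        has_expectation P
          (fun w => expeR (Z a w) * (Gamma (Lshift h (Z ^~ w)))%:E) ->
        \int[P]_w (expeR (Z (a + h)%R w) * (Gamma (Z ^~ w))%:E) =
        \int[P]_w (expeR (Z a w) * (Gamma (Lshift h (Z ^~ w)))%:E);
    (* d *)
    forall a h : time R k n,
      fdd_eq (tilt P Z (a + h)%R) (Xi (a + h)%R Z)
             (tilt P Z a) (Lshift h (Xi a Z))].
Proof.
have fin m (s : m.-tuple (time R k n)) x : (forall j, x j != -oo) ->
    \int[P]_w score x (fun j => Z (tnth s j) w) < +oo.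
  by move=> xNy; exact: (score_integrable procZ expZ (tnth s)).
have shift_fin h m (s : m.-tuple (time R k n)) x : (forall j, x j != -oo) ->
    \int[P]_w score x (fun j => Lshift h Z (tnth s j) w) < +oo.
  by move=> xNy; exact: (score_integrable procZ expZ (fun j => tnth s j - h)%R).
have a_score : (forall (h : time R k n)
      (d' : measure_display) (Omega' : measurableType d')
      (P' : probability Omega' R) (zeta' : time R k n -> Omega' -> \bar R),
      max_stable P' zeta' P (Lshift h Z) -> fdd_eq Pz zeta P' zeta') <->
    score_stationary P Z.
  split => [statz h m s x xNy|statZ h d' Omega' P' zeta' zeta'Z].
    have zetah := max_stable_Lshift h zetaZ.
    have [+ _] := max_stable_fdd_eq procZ (process_Lshift h procZ) zetaZ zetah
      fin (shift_fin h).
    by apply => //; exact: (statz h _ _ _ _ zetah).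
  apply/(max_stable_fdd_eq procZ (process_Lshift h procZ) zetaZ zeta'Z
    fin (shift_fin h)) => m s x xNy.
  exact: statZ.
tfae.
- move=> /a_score/(score_tilt_stationary procZ expZ) statZ mu D mD muD mZD SZ.
  move=> d' Omega' P' p tau X G eta poissonX indepG lawX mX meta etaE.
  exact: (tilted_representation procZ expZ statZ mD muD mZD SZ poissonX indepG
    lawX mX meta etaE zetaZ).
- move=> repr.
  apply: (tilt_functional_stationary procZ expZ); apply: (score_tilt_stationary procZ expZ).
  move=> h m s x xNy.
  have [p [_ [_ [poissonp _ _ _]]]] := zetaZ.
  apply: (represents_dirac_score procZ expZ (finZ 0%R) (a := h) poissonp zetaZ s _ xNy).
  have mh : measurable [set h] by exact: measurable_time_singleton.
  have [mZ Zy] := procZ.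
  apply: (repr (dirac h)) => //.
  + by rewrite /= diracE in_setC in_set1 eqxx.
  + exact: measurable_paths_singleton.
  + have mfin : measurable [set w | -oo < Z h w].
      by rewrite -[X in measurable X]setTI; apply: measurable_lte.
    apply: filterS (ae_of_probability1 mfin (finZ h)) => w /= zh.
    rewrite integral_dirac_singleton//; last by move=> t; exact: expeR_ge0.
    by move: zh (Zy h w); case: (Z h w) => [r| |]//; rewrite /= lte_fin expR_gt0 ltry.
- exact: (functional_tilt_stationary procZ).
- by move=> /(tilt_score_stationary procZ expZ)/a_score.
Qed.
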